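(* Let $q \in \mathbb{C}\setminus\{0\}$ with $q^2 \neq 1$, let $n \ge 1$, $V=\mathbb{C}^n$, let $p \ge 0$ be an integer, and assume that $[p]! \ne 0$, where $[k] = \frac{q^k-q^{-k}}{q-q^{-1}}$ and $[k]! = [k][k-1]\cdots[1]$. Let $\rho$ be the natural action of the Iwahori--Hecke algebra $H_p(q)$ on $V^{\otimes p}$ and let $\pi$ be the natural representation of $U_q(\mathfrak{gl}(V))$ on $V^{\otimes p}$. Then $\rho(H_p(q))$ and $\pi(U_q(\mathfrak{gl}(V)))$ are mutual commutants of each other in $\operatorname{End}(V^{\otimes p})$, namely $$\operatorname{End}(V^{\otimes p})^{\rho(H_p(q))} = \pi(U_q(\mathfrak{gl}(V))), \qquad \operatorname{End}(V^{\otimes p})^{\pi(U_q(\mathfrak{gl}(V)))} = \rho(H_p(q)).$$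
   Context: For an algebra $A$ of operators on $V^{\otimes p}$, $\operatorname{End}(V^{\otimes p})^{A}$ denotes the set of $\mathbb{C}$-linear endomorphisms of $V^{\otimes p}$ commuting with every element of $A$. A square root $q^{1/2}$ of $q$ is fixed. $e_1,\dots,e_n$ is the standard basis of $V$; the symbol $\otimes$ between vectors is omitted. Hecke algebra: $H_p(q)$ is the unital associative $\mathbb{C}$-algebra with generators $t_1,\dots,t_{p-1}$ and relations $(t_r-q)(t_r+q^{-1})=0$, $t_rt_{r+1}t_r=t_{r+1}t_rt_{r+1}$, $t_rt_s=t_st_r$ for $|r-s|>1$ (so $H_0(q)=H_1(q)=\mathbb{C}$). The action $\rho$ on $V^{\otimes p}$ is: $t_r$ acts as $\operatorname{id}_V^{\otimes (r-1)}\otimes t\otimes \operatorname{id}_V^{\otimes(p-r-1)}$, where $t\in\operatorname{End}(V\otimes V)$ is given by $t\,e_ie_i=q\,e_ie_i$; $t\,e_ie_j=e_je_i$ for $i>j$; $t\,e_ie_j=e_je_i+(q-q^{-1})e_ie_j$ for $i<j$. Quantum enveloping algebra: $U_q(\mathfrak{gl}(V))$ is the unital associative $\mathbb{C}$-algebra with generators $q^{\pm\varepsilon_1/2},\dots,q^{\pm\varepsilon_n/2}$, $\hat e_1,\dots,\hat e_{n-1}$, $\hat f_1,\dots,\hat f_{n-1}$ and relations: $q^{\varepsilon_i/2}q^{\varepsilon_j/2}=q^{\varepsilon_j/2}q^{\varepsilon_i/2}$; $q^{\varepsilon_i/2}q^{-\varepsilon_i/2}=q^{-\varepsilon_i/2}q^{\varepsilon_i/2}=1$;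 $q^{\varepsilon_i/2}\hat e_jq^{-\varepsilon_i/2}=q^{(\delta_{ij}-\delta_{i,j+1})/2}\hat e_j$; $q^{\varepsilon_i/2}\hat f_jq^{-\varepsilon_i/2}=q^{(-\delta_{ij}+\delta_{i,j+1})/2}\hat f_j$; $\hat e_i\hat f_j-\hat f_j\hat e_i=\delta_{ij}\frac{q^{\varepsilon_i-\varepsilon_{i+1}}-q^{-\varepsilon_i+\varepsilon_{i+1}}}{q-q^{-1}}$; $\hat e_i\hat e_j=\hat e_j\hat e_i$ and $\hat f_i\hat f_j=\hat f_j\hat f_i$ for $|i-j|>1$; $\hat e_i^2\hat e_{i\pm1}-(q+q^{-1})\hat e_i\hat e_{i\pm1}\hat e_i+\hat e_{i\pm1}\hat e_i^2=0$; $\hat f_i^2\hat f_{i\pm1}-(q+q^{-1})\hat f_i\hat f_{i\pm1}\hat f_i+\hat f_{i\pm1}\hat f_i^2=0$. Products of powers are abbreviated by adding exponents, e.g. $q^{\varepsilon_i}=(q^{\varepsilon_i/2})^2$, $q^{\varepsilon_i-\varepsilon_{i+1}}=(q^{\varepsilon_i/2})^2(q^{-\varepsilon_{i+1}/2})^2$. Representation $\pi$ on $V^{\otimes p}$: let $k_i^{\pm1/2}:V\to V$, $e_h\mapsto q^{\pm\delta_{ih}/2}e_h$, and $E_{ij}:V\to V$, $e_h\mapsto\delta_{jh}e_i$. Then $$\pi(\hat e_i)=\sum_{r=1}^p (k_i^{1/2}k_{i+1}^{-1/2})^{\otimes(r-1)}\otimes E_{i,i+1}\otimes (k_i^{-1/2}k_{i+1}^{1/2})^{\otimes(p-r)},$$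 $$\pi(\hat f_i)=\sum_{r=1}^p (k_i^{1/2}k_{i+1}^{-1/2})^{\otimes(r-1)}\otimes E_{i+1,i}\otimes (k_i^{-1/2}k_{i+1}^{1/2})^{\otimes(p-r)},$$ and $\pi(q^{\pm\varepsilon_i/2})=(k_i^{\pm1/2})^{\otimes p}$. *)

(* Defs.v *)
From HB Require Import structures.
From mathcomp Require Import all_boot all_order all_algebra perm.
From mathcomp Require Import generic_quotient ring_quotient.
From mathcomp Require Import boolp classical_sets reals.
From mathcomp Require Import complex finmap monalg.
From mathcomp Require Import ring zify.
Set Implicit Arguments.
Unset Strict Implicit.
Unset Printing Implicit Defensive.
Import Order.TTheory GRing.Theory Num.Theory.
Local Open Scope ring_scope.
Local Open Scope quotient_scope.

(* Noncommutative polynomials over K in the variables X. *)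
Notation free_alg K X := {malg K[{fmonom X}]}.

Definition free_gen (K : fieldType) (X : choiceType) (x : X) : free_alg K X :=
  << fmu x >>.

Section PresentedAlgebra.
Variables (K : fieldType) (X : choiceType) (S : set (free_alg K X)).
Implicit Types u v a b : free_alg K X.

Lemma free_scaler_comm (c : K) u v : u * (c *: v) = c *: (u * v).
Proof.
apply/malgP => k; rewrite mcoeffZ.
apply: etrans (mcoeffMlw k (fsubset_refl (msupp u)) (msuppZ_le c v)) _.
apply: etrans (congr1 ( *%R c) (esym (mcoeffMl u v k))).
rewrite mulr_sumr.
apply: eq_bigr => k1 _; rewrite mulr_sumr; apply: eq_bigr => k2 _.
by rewrite mcoeffZ mulrnAr mulrCA.
Qed.

Inductive ideal_gen : free_alg K X -> Prop :=
| ideal_gen0 : ideal_gen 0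
| ideal_gen_in u : S u -> ideal_gen u
| ideal_genD u v : ideal_gen u -> ideal_gen v -> ideal_gen (u + v)
| ideal_genM a u b : ideal_gen u -> ideal_gen (a * u * b).

Definition ideal_pred : {pred free_alg K X} := fun u => `[< ideal_gen u >].

Lemma ideal_predP u : reflect (ideal_gen u) (u \in ideal_pred).
Proof. exact: asboolP. Qed.

Lemma ideal_zmod_closed : zmod_closed ideal_pred.
Proof.
split; first exact/ideal_predP/ideal_gen0.
move=> u v /ideal_predP uI /ideal_predP vI; apply/ideal_predP.
by apply: ideal_genD => //; rewrite -[- v]mulr1 -mulN1r; exact: ideal_genM.
Qed.

HB.instance Definition _ :=
  GRing.isZmodClosed.Build (free_alg K X) ideal_pred ideal_zmod_closed.

Lemma ideal_predM a b u : u \in ideal_pred -> a * u * b \in ideal_pred.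
Proof. by move=> /ideal_predP uI; apply/ideal_predP/ideal_genM. Qed.

(* The algebra with generators X and relations u = 0 for u in S. The MathComp
   algebra structures require 1 != 0, which may fail for arbitrary S, so
   [presented] gets a ring and a module structure, and [pres_scaleAl] and
   [pres_scaleAr] relate the two. *)
Definition presented := Quotient.quot ideal_pred.
HB.instance Definition _ := GRing.Zmodule.on presented.
HB.instance Definition _ := EqQuotient.on presented.

Definition pres_of u : presented := \pi_presented u.

Lemma pres_eq u v : (pres_of u == pres_of v) = (u - v \in ideal_pred).
Proof. by rewrite -Quotient.idealrBE. Qed.

Lemma pres_eqP u v : pres_of u = pres_of v <-> ideal_gen (u - v).
Proof.
split=> [/eqP|uv]; first by rewrite pres_eq => /ideal_predP.
by apply/eqP; rewrite pres_eq; apply/ideal_predP.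
Qed.

Lemma repr_pres (x : presented) : pres_of (repr x) = x.
Proof. exact: reprK. Qed.

Lemma pres_ind (P : presented -> Prop) :
  (forall u, P (pres_of u)) -> forall x, P x.
Proof. by move=> h x; rewrite -(repr_pres x). Qed.

Lemma pres_ofD u v : pres_of (u + v) = pres_of u + pres_of v.
Proof. exact: Quotient.pi_add. Qed.

Lemma pres_of0 : pres_of 0 = 0.
Proof. by apply: (addrI (pres_of 0)); rewrite -pres_ofD !addr0. Qed.

Lemma repr_pres_sub u : repr (pres_of u) - u \in ideal_pred.
Proof. by rewrite -pres_eq repr_pres. Qed.

Definition pres_one : presented := pres_of 1.
Definition pres_mul (x y : presented) := pres_of (repr x * repr y).
Definition pres_scale (c : K) (x : presented) := pres_of (c *: repr x).

Lemma pres_mulE u v : pres_mul (pres_of u) (pres_of v) = pres_of (u * v).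
Proof.
apply/eqP; rewrite pres_eq.
set u' := repr _; set v' := repr _.
have -> : u' * v' - u * v = 1 * (u' - u) * v' + u * (v' - v) * 1.
  by rewrite mul1r mulr1 mulrBl mulrBr addrA subrK.
by rewrite rpredD // ideal_predM // repr_pres_sub.
Qed.

Lemma pres_scaleE c u : pres_scale c (pres_of u) = pres_of (c *: u).
Proof.
apply/eqP; rewrite pres_eq -scalerBr -[_ - _ in X in X \in _]mul1r scalerAl.
by rewrite -[_ * _]mulr1 ideal_predM // repr_pres_sub.
Qed.

Fact pres_mulA : associative pres_mul.
Proof.
elim/pres_ind => u; elim/pres_ind => v; elim/pres_ind => w.
by rewrite !pres_mulE mulrA.
Qed.
Fact pres_mul1l : left_id pres_one pres_mul.
Proof. by elim/pres_ind => u; rewrite pres_mulE mul1r. Qed.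
Fact pres_mul1r : right_id pres_one pres_mul.
Proof. by elim/pres_ind => u; rewrite pres_mulE mulr1. Qed.
Fact pres_mulDl : left_distributive pres_mul +%R.
Proof.
elim/pres_ind => u; elim/pres_ind => v; elim/pres_ind => w.
by rewrite -pres_ofD !pres_mulE -pres_ofD mulrDl.
Qed.
Fact pres_mulDr : right_distributive pres_mul +%R.
Proof.
elim/pres_ind => u; elim/pres_ind => v; elim/pres_ind => w.
by rewrite -pres_ofD !pres_mulE -pres_ofD mulrDr.
Qed.
HB.instance Definition _ := GRing.Zmodule_isPzRing.Build presented
  pres_mulA pres_mul1l pres_mul1r pres_mulDl pres_mulDr.

Fact pres_scaleA (a b : K) x : pres_scale a (pres_scale b x) = pres_scale (a * b) x.
Proof. by elim/pres_ind: x => u; rewrite !pres_scaleE scalerA. Qed.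
Fact pres_scale1 : left_id 1 pres_scale.
Proof. by elim/pres_ind => u; rewrite pres_scaleE scale1r. Qed.
Fact pres_scaleDr : right_distributive pres_scale +%R.
Proof.
move=> c; elim/pres_ind => u; elim/pres_ind => v.
by rewrite -pres_ofD !pres_scaleE -pres_ofD scalerDr.
Qed.
Fact pres_scaleDl x : {morph pres_scale^~ x : c d / c + d}.
Proof.
by move=> c d; elim/pres_ind: x => u; rewrite !pres_scaleE -pres_ofD scalerDl.
Qed.
HB.instance Definition _ := GRing.Zmodule_isLmodule.Build K presented
  pres_scaleA pres_scale1 pres_scaleDr pres_scaleDl.

Lemma pres_ofM u v : pres_of (u * v) = pres_of u * pres_of v.
Proof. by rewrite -pres_mulE. Qed.
Lemma pres_of1 : pres_of 1 = 1. Proof. by []. Qed.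
Lemma pres_ofZ c u : pres_of (c *: u) = c *: pres_of u.
Proof. by rewrite -pres_scaleE. Qed.
Lemma pres_scaleAl c (x y : presented) : c *: (x * y) = (c *: x) * y.
Proof.
elim/pres_ind: x => u; elim/pres_ind: y => v.
by rewrite -pres_ofM -!pres_ofZ -pres_ofM scalerAl.
Qed.
Lemma pres_scaleAr c (x y : presented) : c *: (x * y) = x * (c *: y).
Proof.
elim/pres_ind: x => u; elim/pres_ind: y => v.
by rewrite -pres_ofM -!pres_ofZ -pres_ofM free_scaler_comm.
Qed.
Lemma pres_rel u : S u -> pres_of u = 0.
Proof.
move=> Su; have := (pres_eqP u 0).2; rewrite subr0 pres_of0; apply.
exact: ideal_gen_in.
Qed.
End PresentedAlgebra.

(* 'End(W) as a ring under composition, (f * g) w = f (g w); the ring structure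
   provided by falgebra uses the opposite product. *)
Definition endo (K : fieldType) (W : vectType K) := 'End(W).

Section Endo.
Variables (K : fieldType) (W : vectType K).
HB.instance Definition _ := GRing.Lmodule.on (endo W).
HB.instance Definition _ := GRing.Zmodule_isPzRing.Build (endo W)
  (@comp_lfunA K W W W W) (@comp_lfun1l K W W) (@comp_lfun1r K W W)
  (@comp_lfunDl K W W W) (@comp_lfunDr K W W W).

Lemma endoM (f g : endo W) w : (f * g : 'End(W)) w = (f : 'End(W)) ((g : 'End(W)) w).
Proof. exact: comp_lfunE. Qed.
Lemma endo1 w : (1 : endo W) w = w.
Proof. exact: id_lfunE. Qed.
Lemma endo_scaleAl c (f g : endo W) : c *: (f * g) = (c *: f) * g.
Proof. exact: comp_lfunZl. Qed.
Lemma endo_scaleAr c (f g : endo W) : c *: (f * g) = f * (c *: g).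
Proof. exact: comp_lfunZr. Qed.
End Endo.

Section Lift.
Variables (K : fieldType) (X : choiceType) (W : vectType K) (T : X -> endo W).

Definition eval (u : free_alg K X) : endo W :=
  \sum_(k <- msupp u) u@_k *: \prod_(x <- (k : {fmonom X})) T x.

Lemma evalw (d : {fset {fmonom X}}) u : (msupp u `<=` d)%fset ->
  eval u = \sum_(k <- d) u@_k *: \prod_(x <- (k : {fmonom X})) T x.
Proof.
move=> le; rewrite [LHS](big_fset_incl _ le) => //= x xd /mcoeff_outdom ->.
by rewrite scale0r.
Qed.

Lemma evalD u v : eval (u + v) = eval u + eval v.
Proof.
rewrite (evalw (msuppD_le u v)) (evalw (fsubsetUl _ (msupp v))).
rewrite (evalw (fsubsetUr (msupp u) _)) -big_split /=.
by apply: eq_bigr => k _; rewrite mcoeffD scalerDl.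
Qed.

Lemma evalU c k :
  eval (<< c *g k >>) = c *: \prod_(x <- (k : {fmonom X})) T x.
Proof. by rewrite (evalw msuppU_le) big_seq_fset1 mcoeffUU. Qed.

Lemma evalZ c u : eval (c *: u) = c *: eval u.
Proof.
rewrite (evalw (msuppZ_le c u)) /eval scaler_sumr.
by apply: eq_bigr => k _; rewrite mcoeffZ scalerA.
Qed.

Lemma eval0 : eval 0 = 0.
Proof. by rewrite -(scale0r 0) evalZ scale0r. Qed.

Lemma eval_sum (I : Type) (s : seq I) (F : I -> free_alg K X) :
  eval (\sum_(i <- s) F i) = \sum_(i <- s) eval (F i).
Proof. exact: (big_morph eval evalD eval0). Qed.

Lemma eval1 : eval 1 = 1.
Proof. by rewrite evalU fm1 big_nil scale1r. Qed.

Lemma evalM u v : eval (u * v) = eval u * eval v.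
Proof.
rewrite malgME eval_sum [in RHS]/eval big_distrlr /=; apply: eq_bigr => i _.
rewrite eval_sum; apply: eq_bigr => j _.
rewrite evalU -endo_scaleAl -endo_scaleAr scalerA; congr (_ *: _).
by rewrite -big_cat; congr (bigop _ _ _); rewrite /= fmM.
Qed.

Lemma eval_gen x : eval (free_gen K x) = T x.
Proof. by rewrite evalU scale1r fmuE /= big_seq1. Qed.

Lemma evalB u v : eval (u - v) = eval u - eval v.
Proof. by rewrite evalD -scaleN1r evalZ scaleN1r. Qed.

(* Rewriting with the morphism lemmas above triggers expensive failing
   conversions in the free algebra; these forms are meant for [apply:]. *)
Lemma evalM_to u v f g : eval u = f -> eval v = g -> eval (u * v) = f * g.
Proof. by move=> <- <-; apply: evalM. Qed.
Lemma evalD_to u v f g : eval u = f -> eval v = g -> eval (u + v) = f + g.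
Proof. by move=> <- <-; apply: evalD. Qed.
Lemma evalB_to u v f g : eval u = f -> eval v = g -> eval (u - v) = f - g.
Proof. by move=> <- <-; apply: evalB. Qed.
Lemma evalZ_to c u f : eval u = f -> eval (c *: u) = c *: f.
Proof. by move=> <-; apply: evalZ. Qed.

Variable S : set (free_alg K X).

(* By [hT] the value does not depend on the representative: see [lift_pres]. *)
Definition lift (hT : forall u, S u -> eval u = 0) (a : presented S) : endo W :=
  eval (repr a).

Variable hT : forall u, S u -> eval u = 0.

Lemma eval_ideal u : ideal_gen S u -> eval u = 0.
Proof.
elim=> {u} [|u /hT //|u v _ uI _ vI|a u b _ uI]; first exact: eval0.
  by rewrite evalD uI vI addr0.
by rewrite !evalM uI mulr0 mul0r.
Qed.

Lemma lift_pres u : lift hT (pres_of S u) = eval u.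
Proof.
apply/eqP; rewrite -subr_eq0 -evalB; apply/eqP/eval_ideal.
by apply/ideal_predP/repr_pres_sub.
Qed.

Lemma lift_gen x : lift hT (pres_of S (free_gen K x)) = T x.
Proof. by rewrite lift_pres eval_gen. Qed.

Fact lift_linear : linear (lift hT).
Proof.
move=> c a b; elim/pres_ind: a => u; elim/pres_ind: b => v.
by rewrite -pres_ofZ -pres_ofD !lift_pres evalD evalZ.
Qed.
HB.instance Definition _ :=
  GRing.isLinear.Build K (presented S) (endo W) _ (lift hT) lift_linear.
Fact lift_monoid : monoid_morphism (lift hT).
Proof.
split=> [|a b]; first by rewrite -pres_of1 lift_pres eval1.
elim/pres_ind: a => u; elim/pres_ind: b => v.
by rewrite -pres_ofM !lift_pres evalM.
Qed.
HB.instance Definition _ :=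
  GRing.isMonoidMorphism.Build (presented S) (endo W) (lift hT) lift_monoid.
End Lift.

Ltac eval_to := repeat lazymatch goal with
  | |- eval _ (_ - _) = _ => apply: evalB_to
  | |- eval _ (_ + _) = _ => apply: evalD_to
  | |- eval _ (_ * _) = _ => apply: evalM_to
  | |- eval _ (_ *: _) = _ => apply: evalZ_to
  | |- eval _ 1 = _ => apply: eval1
  | |- _ => apply: eval_gen
  end.

Notation tidx n p := {ffun 'I_p -> 'I_n}.
(* V^{(x) p} with V = K^n, in coordinates: v x is the coefficient in v of
   e_(x 0) (x) ... (x) e_(x (p - 1)), indices being counted from 0. *)
Notation tspace K n p := {ffun tidx n p -> K^o}.

Section TensorSpace.
Variables (K : fieldType) (n p : nat).
Implicit Types (x y : tidx n p) (v : tspace K n p) (f g : endo (tspace K n p)).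

Definition tbasis x : tspace K n p := [ffun y => (x == y)%:R].

Definition lin_ext_fun (F : tidx n p -> tspace K n p) v : tspace K n p :=
  \sum_x v x *: F x.

Fact lin_ext_linear F : linear (lin_ext_fun F).
Proof.
move=> c u v; rewrite /lin_ext_fun scaler_sumr -big_split /=.
by apply: eq_bigr => x _; rewrite !ffunE scalerDl scalerA.
Qed.
HB.instance Definition _ F :=
  GRing.isLinear.Build K (tspace K n p) (tspace K n p) _ (lin_ext_fun F)
    (lin_ext_linear F).

(* The linear endomorphism sending the basis vector of index x to F x. *)
Definition lin_ext (F : tidx n p -> tspace K n p) : endo (tspace K n p) :=
  linfun (lin_ext_fun F).

Lemma lin_extE F v : (lin_ext F : 'End(_)) v = \sum_x v x *: F x.
Proof. by rewrite lfunE. Qed.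

Lemma lin_ext_basis F x : (lin_ext F : 'End(_)) (tbasis x) = F x.
Proof.
rewrite lin_extE (bigD1 x) //= ffunE eqxx scale1r big1 ?addr0 // => y yx.
by rewrite ffunE eq_sym (negPf yx) scale0r.
Qed.

Lemma tspace_sum v : v = \sum_x v x *: tbasis x.
Proof.
apply/ffunP => y; rewrite sum_ffunE (bigD1 y) //= !ffunE eqxx big1.
  by rewrite addr0 /GRing.scale /= mulr1.
by move=> x xy; rewrite !ffunE (negPf xy) scaler0.
Qed.

Lemma endoP f g :
  (forall x, (f : 'End(_)) (tbasis x) = (g : 'End(_)) (tbasis x)) -> f = g.
Proof.
move=> fg; apply/lfunP => v; rewrite [v]tspace_sum !linear_sum /=.
by apply: eq_bigr => x _; rewrite !linearZ /= fg.
Qed.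

Definition coord x y f : K := ((f : 'End(_)) (tbasis x)) y.

Lemma coordP f g : (forall x y, coord x y f = coord x y g) -> f = g.
Proof. by move=> fg; apply: endoP => x; apply/ffunP => y; apply: fg. Qed.

Lemma coordD x y f g : coord x y (f + g) = coord x y f + coord x y g.
Proof. by rewrite /coord add_lfunE ffunE. Qed.
Lemma coordN x y f : coord x y (- f) = - coord x y f.
Proof. by rewrite /coord opp_lfunE ffunE. Qed.
Lemma coordZ x y c f : coord x y (c *: f) = c * coord x y f.
Proof. by rewrite /coord scale_lfunE ffunE. Qed.
Lemma coord0 x y : coord x y 0 = 0.
Proof. by rewrite /coord zero_lfunE ffunE. Qed.
Definition coordE := (coordD, coordN, coordZ, coord0).

(* A 0 (x) ... (x) A (p - 1); a matrix A represents e_j |-> \sum_i A i j e_i. *)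
Definition tens_op (A : 'I_p -> 'M[K]_n) : endo (tspace K n p) :=
  lin_ext (fun x => [ffun y : tidx n p => \prod_s A s (y s) (x s)]).

Lemma coord_tens A x y : coord x y (tens_op A) = \prod_s A s (y s) (x s).
Proof. by rewrite /coord lin_ext_basis ffunE. Qed.

Lemma tens_opM A B : tens_op A * tens_op B = tens_op (fun s => A s *m B s).
Proof.
apply: coordP => x y; rewrite coord_tens /coord endoM lin_ext_basis lin_extE.
rewrite sum_ffunE.
under [RHS]eq_bigr => s _ do rewrite mxE.
rewrite bigA_distr_bigA /=; apply: eq_bigr => z _.
rewrite !ffunE /GRing.scale /= -big_split /=.
by apply: eq_bigr => s _; rewrite mulrC.
Qed.

Lemma eq_tens A B : (forall s, A s = B s) -> tens_op A = tens_op B.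
Proof.
by move=> AB; apply: coordP => x y; rewrite !coord_tens; apply: eq_bigr => s _; rewrite AB.
Qed.

Lemma tens_opZ (c : 'I_p -> K) A B : (forall s, A s = c s *: B s) ->
  tens_op A = (\prod_s c s) *: tens_op B.
Proof.
move=> AB; apply: coordP => x y; rewrite coordZ !coord_tens -big_split /=.
by apply: eq_bigr => s _; rewrite AB mxE.
Qed.

Lemma tens_op0 A r : A r = 0 -> tens_op A = 0.
Proof.
by move=> A0; apply: coordP => x y; rewrite coord0 coord_tens (bigD1 r) //= A0 mxE mul0r.
Qed.

Lemma tens_op1 A : (forall s, A s = 1%:M) -> tens_op A = 1.
Proof.
move=> A1; apply: coordP => x y; rewrite coord_tens /coord endo1 ffunE.
under eq_bigr => s _ do rewrite A1 mxE.
have [->|xy] := eqVneq x y; first by rewrite big1 // => s _; rewrite eqxx.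
have [s xs] : exists s, y s != x s.
  apply/existsP; apply: contraNT xy => /existsPn h; apply/eqP/ffunP => s.
  by apply/esym/eqP; have := h s; rewrite negbK.
by rewrite (bigD1 s) //= (negPf xs) mul0r.
Qed.

Lemma tens_opB A B C r :
    (forall s, s != r -> A s = B s /\ A s = C s) -> A r = B r - C r ->
  tens_op A = tens_op B - tens_op C.
Proof.
move=> h hr; apply: coordP => x y; rewrite !coordE !coord_tens.
rewrite !(bigD1 (P := predT) r) //= hr !mxE mulrDl mulNr.
congr (_ * _ - _ * _); apply: eq_bigr => s /h []; first by move=> ->.
by move=> _ ->.
Qed.

(* site A M B r has A in the factors left of r, M in factor r, B right of r. *)
Definition site (A M B : 'M[K]_n) (r : 'I_p) : 'I_p -> 'M[K]_n :=
  fun s => if (s < r)%N then A else if s == r then M else B.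
End TensorSpace.

(* r : 'I_m.-1 indexes the pairs of consecutive elements (lo r, hi r) of 'I_m. *)
Section NearestNeighbours.
Variable m : nat.
Definition lo (r : 'I_m.-1) : 'I_m := widen_ord (leq_pred m) r.
Fact hi_subproof (r : 'I_m.-1) : (r.+1 < m)%N.
Proof. by case: m r => [[]|k r] //; rewrite ltnS ltn_ord. Qed.
Definition hi (r : 'I_m.-1) : 'I_m := Ordinal (hi_subproof r).
End NearestNeighbours.

Section Hecke.
Variables (K : fieldType) (q : K) (p : nat).
Implicit Types r s : 'I_p.-1.
Let t r := free_gen K r.

Inductive hecke_rel : free_alg K 'I_p.-1 -> Prop :=
| hecke_quad r : hecke_rel ((t r - q *: 1) * (t r + q^-1 *: 1))
| hecke_braid r s : s = r.+1 :> nat ->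
    hecke_rel (t r * t s * t r - t s * t r * t s)
| hecke_far r s : (r.+1 < s)%N || (s.+1 < r)%N ->
    hecke_rel (t r * t s - t s * t r).

Definition hecke := presented hecke_rel.

Lemma eval_hecke_rel (W : vectType K) (T : 'I_p.-1 -> endo W) (I : endo W := 1) :
    (forall r, (T r - q *: I) * (T r + q^-1 *: I) = 0) ->
    (forall r s, s = r.+1 :> nat -> T r * T s * T r - T s * T r * T s = 0) ->
    (forall r s, (r.+1 < s)%N || (s.+1 < r)%N -> T r * T s - T s * T r = 0) ->
  forall u, hecke_rel u -> eval T u = 0.
Proof.
move=> quad braid far u [r|r s rs|r s rs].
- by apply: etrans (quad r); eval_to.
- by apply: etrans (braid r s rs); eval_to.
- by apply: etrans (far r s rs); eval_to.
Qed.
End Hecke.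

Section HeckeAction.
Variables (K : fieldType) (q : K) (n p : nat).
Implicit Types (x y : tidx n p) (r s : 'I_p.-1).

Definition swap r x : tidx n p := [ffun s => x (tperm (lo r) (hi r) s)].

(* id (x) t (x) id with t acting on the factors lo r and hi r, where
   t e_i e_j is q e_i e_i if i = j, e_j e_i if i > j, and
   e_j e_i + (q - q^-1) e_i e_j if i < j. *)
Definition hecke_op r : endo (tspace K n p) :=
  lin_ext (fun x =>
    if x (lo r) == x (hi r) then q *: tbasis K x
    else if (x (hi r) < x (lo r))%N then tbasis K (swap r x)
    else tbasis K (swap r x) + (q - q^-1) *: tbasis K x).

Lemma coord_hecke_op r x y f : coord x y (f * hecke_op r) =
  if x (lo r) == x (hi r) then q * coord x y f
  else if (x (hi r) < x (lo r))%N then coord (swap r x) y f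
  else coord (swap r x) y f + (q - q^-1) * coord x y f.
Proof.
rewrite /coord endoM lin_ext_basis; case: ifP => _; last case: ifP => _ //.
  by rewrite linearZ /= ffunE.
by rewrite linearD linearZ /= !ffunE.
Qed.

Lemma swap_lo r x : swap r x (lo r) = x (hi r).
Proof. by rewrite ffunE tpermL. Qed.
Lemma swap_hi r x : swap r x (hi r) = x (lo r).
Proof. by rewrite ffunE tpermR. Qed.
Lemma swapK r : involutive (swap r).
Proof. by move=> x; apply/ffunP => s; rewrite !ffunE tpermK. Qed.
Lemma swapD r x (s : 'I_p) : s != lo r -> s != hi r -> swap r x s = x s.
Proof. by move=> h1 h2; rewrite ffunE tpermD // eq_sym. Qed.

Lemma hecke_op_quad r : q != 0 -> let I : endo (tspace K n p) := 1 in
  (hecke_op r - q *: I) * (hecke_op r + q^-1 *: I) = 0.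
Proof.
move=> q0 I; move: (hecke_op r) (coord_hecke_op r) => T ET.
have -> : (T - q *: I) * (T + q^-1 *: I) = T * T - (q - q^-1) *: T - I.
  rewrite mulrDr mulrDl -endo_scaleAr mulr1 mulNr -endo_scaleAl mul1r.
  rewrite scalerDr scalerN scalerA mulVf // scale1r scalerBl.
  by rewrite addrA opprB addrA [in RHS]addrAC -!addrA; congr (_ + _); rewrite addrCA.
suff E x y f : coord x y (f * T * T) = (q - q^-1) * coord x y (f * T) + coord x y f.
  by apply: coordP => x y; rewrite !coordE -[T * T]mul1r mulrA E mul1r; ring.
rewrite !ET swapK swap_lo swap_hi.
rewrite -!val_eqE /=; case: (ltngtP (x (lo r)) (x (hi r))) => h; field => //.
Qed.

Lemma swap_id r x : x (lo r) = x (hi r) -> swap r x = x.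
Proof.
move=> xE; apply/ffunP => s; rewrite ffunE.
by case: tpermP => [->|->|//]; rewrite xE.
Qed.

Lemma hecke_op_braid r s : q != 0 -> s = r.+1 :> nat ->
  hecke_op r * hecke_op s * hecke_op r - hecke_op s * hecke_op r * hecke_op s = 0.
Proof.
move=> q0 rs.
have hl : hi r = lo s by apply/val_inj; rewrite /= rs.
have ab : lo r != lo s by rewrite -val_eqE /= rs; lia.
have ac : lo r != hi s by rewrite -val_eqE /= rs; lia.
have bc : lo s != hi s by rewrite -val_eqE /=; lia.
have ra z : swap r z (lo r) = z (lo s) by rewrite swap_lo hl.
have rb z : swap r z (lo s) = z (lo r) by rewrite -hl swap_hi.
have rc z : swap r z (hi s) = z (hi s) by rewrite swapD // 1?hl eq_sym.
have sa z : swap s z (lo r) = z (lo r) by rewrite swapD.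
have sb z : swap s z (lo s) = z (hi s) by rewrite swap_lo.
have sc z : swap s z (hi s) = z (lo s) by rewrite swap_hi.
have braid z : swap s (swap r (swap s z)) = swap r (swap s (swap r z)).
  apply/ffunP => i.
  have [->|ia] := eqVneq i (lo r); first by rewrite sa ra sb ra sb rc.
  have [->|ib] := eqVneq i (lo s); first by rewrite sb rc sc rb sa ra.
  have [->|ic] := eqVneq i (hi s); first by rewrite sc rb sa rc sc rb.
  by rewrite !swapD // hl.
apply/eqP; rewrite subr_eq0; apply/eqP; rewrite -[LHS]mul1r -[RHS]mul1r !mulrA.
apply: coordP => x y; rewrite !(coord_hecke_op, mul1r) hl.
rewrite !(ra, rb, rc, sa, sb, sc) !swapK !braid -!val_eqE /=.
have Er := @swap_id r x; have Es := @swap_id s x.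
have Et : x (lo r) = x (hi s) -> swap s (swap r x) = swap r x.
  by move=> xE; apply: swap_id; rewrite rb rc.
have Eu : x (lo r) = x (hi s) -> swap r (swap s x) = swap s x.
  by move=> xE; apply: swap_id; rewrite sa hl sb.
rewrite hl in Er.
case: (ltngtP (x (lo r)) (x (lo s))) => h1;
 case: (ltngtP (x (lo s)) (x (hi s))) => h2;
 case: (ltngtP (x (lo r)) (x (hi s))) => h3; try lia;
 try (move/val_inj: h1 => h1; rewrite !(Er h1));
 try (move/val_inj: h2 => h2; rewrite !(Es h2));
 try (move/val_inj: h3 => h3; rewrite !(Et h3) !(Eu h3) ?swapK); try by field.
Qed.

Lemma hecke_op_far r s : (r.+1 < s)%N || (s.+1 < r)%N ->
  hecke_op r * hecke_op s - hecke_op s * hecke_op r = 0.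
Proof.
move=> rs.
have d1 : lo r != lo s by rewrite -val_eqE /=; lia.
have d2 : lo r != hi s by rewrite -val_eqE /=; lia.
have d3 : hi r != lo s by rewrite -val_eqE /=; lia.
have d4 : hi r != hi s by rewrite -val_eqE /=; lia.
have ra z : swap r z (lo s) = z (lo s) by rewrite swapD // eq_sym.
have rb z : swap r z (hi s) = z (hi s) by rewrite swapD // eq_sym.
have sa z : swap s z (lo r) = z (lo r) by rewrite swapD.
have sb z : swap s z (hi r) = z (hi r) by rewrite swapD.
have far z : swap s (swap r z) = swap r (swap s z).
  apply/ffunP => i.
  have [->|i1] := eqVneq i (lo r); first by rewrite sa !swap_lo sb.
  have [->|i2] := eqVneq i (hi r); first by rewrite sb !swap_hi sa.
  have [->|i3] := eqVneq i (lo s); first by rewrite ra !swap_lo rb.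
  have [->|i4] := eqVneq i (hi s); first by rewrite rb !swap_hi ra.
  by rewrite !swapD.
apply/eqP; rewrite subr_eq0; apply/eqP; rewrite -[LHS]mul1r -[RHS]mul1r !mulrA.
apply: coordP => x y; rewrite !(coord_hecke_op, mul1r).
rewrite !(ra, rb, sa, sb) far.
by case: ifP => _; case: ifP => _; do ?case: ifP => _; ring.
Qed.

Fact hecke_op_rel : q != 0 -> forall u, hecke_rel q u -> eval hecke_op u = 0.
Proof.
move=> q0; apply: eval_hecke_rel => [r|r s|r s].
- exact: hecke_op_quad.
- exact: hecke_op_braid.
- exact: hecke_op_far.
Qed.

Definition hecke_rep (q0 : q != 0) : hecke q p -> endo (tspace K n p) :=
  lift (hecke_op_rel q0).
End HeckeAction.

Section QuantumGroup.
Variables (K : fieldType) (q qh : K) (n : nat).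
Implicit Types (i j : 'I_n) (a b : 'I_n.-1).

(* qh stands for q^{1/2}; uqk, uqkV, uqe, uqf are the generators q^{eps_i/2},
   q^{-eps_i/2}, e_i, f_i. *)
Definition uq_gen := (('I_n + 'I_n) + ('I_n.-1 + 'I_n.-1))%type.
Definition uqk i : free_alg K uq_gen := free_gen K (inl (inl i)).
Definition uqkV i : free_alg K uq_gen := free_gen K (inl (inr i)).
Definition uqe a : free_alg K uq_gen := free_gen K (inr (inl a)).
Definition uqf a : free_alg K uq_gen := free_gen K (inr (inr a)).

Definition neighbours a b := (b == a.+1 :> nat) || (a == b.+1 :> nat).
Definition distant a b := (a.+1 < b)%N || (b.+1 < a)%N.

Inductive uq_rel : free_alg K uq_gen -> Prop :=
| uq_kk i j : uq_rel (uqk i * uqk j - uqk j * uqk i)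
| uq_kV i : uq_rel (uqk i * uqkV i - 1)
| uq_Vk i : uq_rel (uqkV i * uqk i - 1)
| uq_ke i b : uq_rel (uqk i * uqe b * uqkV i
    - qh ^ ((i == lo b)%:Z - (i == hi b)%:Z) *: uqe b)
| uq_kf i b : uq_rel (uqk i * uqf b * uqkV i
    - qh ^ (- (i == lo b)%:Z + (i == hi b)%:Z) *: uqf b)
| uq_ef a b : uq_rel (uqe a * uqf b - uqf b * uqe a
    - ((a == b)%:R / (q - q^-1)) *:
      (uqk (lo a) ^+ 2 * uqkV (hi a) ^+ 2 - uqkV (lo a) ^+ 2 * uqk (hi a) ^+ 2))
| uq_ee a b : distant a b -> uq_rel (uqe a * uqe b - uqe b * uqe a)
| uq_ff a b : distant a b -> uq_rel (uqf a * uqf b - uqf b * uqf a)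
| uq_eee a b : neighbours a b ->
    uq_rel (uqe a ^+ 2 * uqe b - (q + q^-1) *: (uqe a * uqe b * uqe a)
            + uqe b * uqe a ^+ 2)
| uq_fff a b : neighbours a b ->
    uq_rel (uqf a ^+ 2 * uqf b - (q + q^-1) *: (uqf a * uqf b * uqf a)
            + uqf b * uqf a ^+ 2).

Definition uq_gl := presented uq_rel.

Section Eval.
Variables (W : vectType K) (k kV : 'I_n -> endo W) (e f : 'I_n.-1 -> endo W).
Definition uq_asg (g : uq_gen) : endo W :=
  match g with
  | inl (inl i) => k i
  | inl (inr i) => kV i
  | inr (inl a) => e a
  | inr (inr a) => f a
  end.

Lemma eval_uq_rel :
    (forall i j, k i * k j - k j * k i = 0) ->
    (forall i, k i * kV i - 1 = 0) -> (forall i, kV i * k i - 1 = 0) ->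
    (forall i b, k i * e b * kV i
       - qh ^ ((i == lo b)%:Z - (i == hi b)%:Z) *: e b = 0) ->
    (forall i b, k i * f b * kV i
       - qh ^ (- (i == lo b)%:Z + (i == hi b)%:Z) *: f b = 0) ->
    (forall a b, e a * f b - f b * e a - ((a == b)%:R / (q - q^-1)) *:
       (k (lo a) * k (lo a) * (kV (hi a) * kV (hi a))
        - kV (lo a) * kV (lo a) * (k (hi a) * k (hi a))) = 0) ->
    (forall a b, distant a b -> e a * e b - e b * e a = 0) ->
    (forall a b, distant a b -> f a * f b - f b * f a = 0) ->
    (forall a b, neighbours a b ->
       e a * e a * e b - (q + q^-1) *: (e a * e b * e a) + e b * (e a * e a) = 0) ->
    (forall a b, neighbours a b ->
       f a * f a * f b - (q + q^-1) *: (f a * f b * f a) + f b * (f a * f a) = 0) ->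
  forall u, uq_rel u -> eval uq_asg u = 0.
Proof.
move=> h1 h2 h3 h4 h5 h6 h7 h8 h9 h10 _ [i j|i|i|i b|i b|a b|a b ab|a b ab|a b ab|a b ab].
- by apply: etrans (h1 i j); eval_to.
- by apply: etrans (h2 i); eval_to.
- by apply: etrans (h3 i); eval_to.
- by apply: etrans (h4 i b); eval_to.
- by apply: etrans (h5 i b); eval_to.
- by apply: etrans (h6 a b); rewrite !expr2; eval_to.
- by apply: etrans (h7 a b ab); eval_to.
- by apply: etrans (h8 a b ab); eval_to.
- by apply: etrans (h9 a b ab); rewrite !expr2; eval_to.
- by apply: etrans (h10 a b ab); rewrite !expr2; eval_to.
Qed.
End Eval.
End QuantumGroup.

Section QuantumAction.
Variables (K : fieldType) (q qh : K) (n p : nat).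
Implicit Types (x y : tidx n p) (i j h : 'I_n) (a b : 'I_n.-1) (r s : 'I_p).
Local Notation E := (endo (tspace K n p)).

(* k_i^{1/2} and k_i^{-1/2}. *)
Definition khalf i : 'M[K]_n := diag_mx (\row_h qh ^+ (i == h)).
Definition khalfV i : 'M[K]_n := diag_mx (\row_h qh ^- (i == h)).

Definition k_op i : E := tens_op (fun=> khalf i).
Definition kV_op i : E := tens_op (fun=> khalfV i).
Definition e_op a : E := \sum_(r < p) tens_op
  (site (khalf (lo a) *m khalfV (hi a)) (delta_mx (lo a) (hi a))
        (khalfV (lo a) *m khalf (hi a)) r).
Definition f_op a : E := \sum_(r < p) tens_op
  (site (khalf (lo a) *m khalfV (hi a)) (delta_mx (hi a) (lo a))
        (khalfV (lo a) *m khalf (hi a)) r).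

Hypotheses (qhE : qh ^+ 2 = q) (q0 : q != 0) (q2 : q ^+ 2 != 1).

Let qh0 : qh != 0.
Proof. by apply: contraNneq q0 => qh0; rewrite -qhE qh0 expr0n. Qed.

Let dg (d : 'I_n -> K) : 'M[K]_n := diag_mx (\row_h d h).

Lemma dgM d d' : dg d *m dg d' = dg (fun h => d h * d' h).
Proof. by rewrite mulmx_diag; congr diag_mx; apply/rowP => h; rewrite !mxE. Qed.
Lemma eq_dg d d' : d =1 d' -> dg d = dg d'.
Proof. by move=> dd; congr diag_mx; apply/rowP => h; rewrite !mxE dd. Qed.
Lemma dgC d d' : dg d *m dg d' = dg d' *m dg d.
Proof. by rewrite !dgM; apply: eq_dg => h; rewrite mulrC. Qed.
Lemma dg_delta d i j : dg d *m delta_mx i j = d i *: delta_mx i j.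
Proof.
apply/matrixP => u v; rewrite mul_diag_mx !mxE.
by have [->|_] := eqVneq u i; rewrite ?mulr0.
Qed.
Lemma delta_dg d i j : delta_mx i j *m dg d = d j *: delta_mx i j.
Proof.
apply/matrixP => u v; rewrite mul_mx_diag !mxE.
by have [->|_] := eqVneq v j; rewrite ?andbF ?mul0r ?mulr0 // mulrC.
Qed.

Let w a h : K := qh ^+ (lo a == h) / qh ^+ (hi a == h).
Let iw a h : K := (w a h)^-1.

Lemma w0 a h : w a h != 0.
Proof. by rewrite mulf_neq0 ?invr_eq0 ?expf_neq0. Qed.

Let X a u v r : E := tens_op (site (dg (w a)) (delta_mx u v) (dg (iw a)) r).

Lemma kap a : khalf (lo a) *m khalfV (hi a) = dg (w a).
Proof. by rewrite dgM. Qed.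
Lemma kapV a : khalfV (lo a) *m khalf (hi a) = dg (iw a).
Proof. by rewrite dgM; apply: eq_dg => h; rewrite /iw /w invf_div mulrC. Qed.

Lemma e_opE a : e_op a = \sum_(r < p) X a (lo a) (hi a) r.
Proof.
by apply: eq_bigr => r _; rewrite kap kapV.
Qed.
Lemma f_opE a : f_op a = \sum_(r < p) X a (hi a) (lo a) r.
Proof.
by apply: eq_bigr => r _; rewrite kap kapV.
Qed.

Lemma X_comm a u v r a' u' v' r' : (r < r')%N ->
  X a' u' v' r' * X a u v r =
  (w a' u / w a' v * (w a u' / w a v')) *: (X a u v r * X a' u' v' r').
Proof.
move=> rr'; rewrite !tens_opM.
pose c s := if s == r then w a' u / w a' v
            else if s == r' then w a u' / w a v' else 1.
have r'r : r' != r by rewrite -val_eqE /= gtn_eqF.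
have -> : w a' u / w a' v * (w a u' / w a v') = \prod_s c s.
  rewrite (bigD1 r) //= (bigD1 r') //= big1 ?mulr1 => [|s /andP[sr sr']].
    by rewrite /c (negPf r'r) !eqxx.
  by rewrite /c (negPf sr) (negPf sr').
apply: tens_opZ => s; rewrite /site /c.
have [->|sr] := eqVneq s r.
  rewrite rr' ltnn dg_delta delta_dg scalerA; congr (_ *: _).
  by rewrite divfK // w0.
have [->|sr'] := eqVneq s r'.
  rewrite ltnn ltnNge (ltnW rr') /= delta_dg dg_delta scalerA.
  by congr (_ *: _); rewrite /iw mulrAC divff ?w0 // mul1r.
by rewrite scale1r; case: ifP => _; case: ifP => _; rewrite dgC.
Qed.

Lemma X_same0 a u v a' u' v' r : v != u' -> X a u v r * X a' u' v' r = 0.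
Proof.
move=> vu; rewrite tens_opM; apply: (tens_op0 (r := r)).
by rewrite /site ltnn eqxx mul_delta_mx_cond (negPf vu) mulr0n.
Qed.

Let cart a b := w a (lo b) / w a (hi b).

Lemma lohi a : lo a == hi a = false.
Proof. by rewrite -val_eqE /=; lia. Qed.
Lemma hilo a : hi a == lo a = false.
Proof. by rewrite eq_sym lohi. Qed.
Lemma lo_eq a b : (lo a == lo b) = (a == b).
Proof. by rewrite -!val_eqE. Qed.
Lemma hi_eq a b : (hi a == hi b) = (a == b).
Proof. by rewrite -!val_eqE /= eqSS. Qed.

Lemma cart_same a : cart a a = q.
Proof. by rewrite /cart /w !eqxx lohi hilo /= !expr1 !expr0 -qhE; field; rewrite qh0 oner_eq0. Qed.

Lemma neq_neighbours a b : neighbours a b -> (a == b) = false.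
Proof. by rewrite /neighbours -val_eqE /=; lia. Qed.

Lemma cart_neighbours a b : neighbours a b -> cart a b = qh^-1.
Proof.
move=> ab; have abF := neq_neighbours ab; rewrite /cart /w lo_eq hi_eq abF.
rewrite -!val_eqE /=; move: ab; rewrite /neighbours => /orP[] /eqP ->.
  rewrite eqxx (_ : (_ == _.+2)%N = false) ?expr1 ?expr0; last lia.
  by rewrite !(invr1, mulr1, div1r).
rewrite eqxx (_ : (_.+2 == _)%N = false) ?expr1 ?expr0; last lia.
by rewrite !(invr1, mulr1, div1r).
Qed.

Lemma cart_distant a b : distant a b -> cart a b = 1.
Proof.
rewrite /distant => ab; rewrite /cart /w.
have -> : (lo a == lo b) = false by rewrite -val_eqE /=; lia.
have -> : (lo a == hi b) = false by rewrite -val_eqE /=; lia.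
have -> : (hi a == lo b) = false by rewrite -val_eqE /=; lia.
have -> : (hi a == hi b) = false by rewrite -val_eqE /=; lia.
by rewrite expr0 !divr1.
Qed.

Lemma neighboursC a b : neighbours a b -> neighbours b a.
Proof. by rewrite /neighbours orbC. Qed.
Lemma distantC a b : distant a b -> distant b a.
Proof. by rewrite /distant orbC. Qed.

Lemma cart_sym a b : cart a b = cart b a.
Proof.
have [->//|ab] := eqVneq a b.
have [nab|] := boolP (neighbours a b).
  by rewrite !cart_neighbours // neighboursC.
rewrite /neighbours => nab.
have dab : distant a b by move: ab nab; rewrite /distant -val_eqE /=; lia.
by rewrite !cart_distant // distantC.
Qed.

Lemma neighbours_factor a b : neighbours a b -> cart a b * cart b a = q^-1.
Proof.
move=> ab; have ba := neighboursC ab.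
by rewrite !cart_neighbours // -qhE expr2 invfM.
Qed.

Section Sums.
Variable z : K.
Hypothesis z0 : z != 0.
Implicit Types A B C D : E.
Let ser A C := A * A * C - (z + z^-1) *: (A * C * A) + C * A * A.

Lemma ser_step A B C D :
    B * A = z ^+ 2 *: (A * B) -> B * C = z^-1 *: (C * B) ->
    D * A = z^-1 *: (A * D) ->
    B * B = 0 -> B * D * B = 0 -> ser A C = 0 ->
  ser (A + B) (C + D) = 0.
Proof.
move=> BA BC DA BB BDB serA.
have E1 : A * B * C = z^-1 *: (A * C * B).
  by rewrite -mulrA BC -endo_scaleAr mulrA.
have E2 : B * A * C = z *: (A * C * B).
  by rewrite BA -endo_scaleAl E1 scalerA; congr (_ *: _); field.
have E3 : C * B * A = z ^+ 2 *: (C * A * B).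
  by rewrite -mulrA BA -endo_scaleAr mulrA.
have E4 : B * C * A = z *: (C * A * B).
  by rewrite BC -endo_scaleAl E3 scalerA; congr (_ *: _); field.
have E5 : A * D * A = z^-1 *: (A * A * D).
  by rewrite -mulrA DA -endo_scaleAr mulrA.
have E6 : D * A * A = z ^- 2 *: (A * A * D).
  by rewrite DA -endo_scaleAl E5 scalerA; congr (_ *: _); field.
have E7 : B * A * D = z ^+ 2 *: (A * B * D) by rewrite BA -endo_scaleAl.
have E8 : B * D * A = z *: (A * B * D).
  by rewrite -mulrA DA -endo_scaleAr mulrA E7 scalerA; congr (_ *: _); field.
have E9 : D * A * B = z^-1 *: (A * D * B) by rewrite DA -endo_scaleAl.
have E10 : D * B * A = z *: (A * D * B).
  by rewrite -mulrA BA -endo_scaleAr mulrA E9 scalerA; congr (_ *: _); field.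
have F1 : B * B * C = 0 by rewrite BB mul0r.
have F2 : B * C * B = 0 by rewrite BC -endo_scaleAl -mulrA BB mulr0 scaler0.
have F3 : C * B * B = 0 by rewrite -mulrA BB mulr0.
have F4 : B * B * D = 0 by rewrite BB mul0r.
have F5 : D * B * B = 0 by rewrite -mulrA BB mulr0.
apply: coordP => x y; move/(congr1 (coord x y)): serA; rewrite /ser !coordE => serA.
rewrite !(mulrDl, mulrDr) !coordE.
rewrite E1 E2 E3 E4 E5 E6 E7 E8 E9 E10 F1 F2 F3 F4 F5 BDB !coordE.
move: (coord _ _ _) (coord _ _ _) (coord _ _ _) serA.
move=> c1 c2 c3 serA.
rewrite (_ : c1 = (z + z^-1) * c2 - c3); first by field.
by apply/eqP; rewrite -subr_eq0 -serA; apply/eqP; ring.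
Qed.

Lemma ser_sum (P Q : 'I_p -> E) :
    (forall r s, (r < s)%N -> P s * P r = z ^+ 2 *: (P r * P s)) ->
    (forall r s, (r < s)%N -> P s * Q r = z^-1 *: (Q r * P s)) ->
    (forall r s, (r < s)%N -> Q s * P r = z^-1 *: (P r * Q s)) ->
    (forall r, P r * P r = 0) -> (forall r, P r * Q r * P r = 0) ->
  ser (\sum_r P r) (\sum_r Q r) = 0.
Proof.
move=> PP PQ QP P0 PQP.
pose part (F : 'I_p -> E) (m : nat) : E := \sum_(r : 'I_p | (r < m)%N) F r.
have partS F (m : nat) (mp : (m < p)%N) : part F m.+1 = part F m + F (Ordinal mp).
  rewrite /part (bigD1 (Ordinal mp)) //= addrC; congr (_ + _).
  by apply: eq_bigl => r; rewrite -val_eqE /=; lia.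
have partp F : \sum_r F r = part F p.
  by apply: eq_bigl => r; rewrite ltn_ord.
have comm (F G : 'I_p -> E) (c : K) (s : 'I_p) : (forall r, (r < s)%N -> G s * F r = c *: (F r * G s)) ->
    G s * part F s = c *: (part F s * G s).
  move=> h; rewrite /part mulr_sumr mulr_suml scaler_sumr.
  by apply: eq_bigr => r; apply: h.
rewrite !partp; suff: forall m, (m <= p)%N -> ser (part P m) (part Q m) = 0 by apply.
elim=> [_|m IH mp].
  by rewrite /ser /part !big_pred0 // !(mul0r, mulr0, scaler0) subr0 addr0.
rewrite !partS; apply: ser_step; last exact: IH (ltnW mp).
- by apply: (comm P P) => r rm; apply: PP.
- by apply: (comm Q P) => r rm; apply: PQ.
- by apply: (comm P Q) => r rm; apply: QP.
- exact: P0.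
- exact: PQP.
Qed.

Lemma commutator_sum (P Q : 'I_p -> E) :
    (forall r s, r != s -> P r * Q s = Q s * P r) ->
  (\sum_r P r) * (\sum_r Q r) - (\sum_r Q r) * (\sum_r P r) =
  \sum_r (P r * Q r - Q r * P r).
Proof.
move=> PQ; rewrite !big_distrlr /= [X in _ - X]exchange_big /= -sumrB.
apply: eq_bigr => r _; rewrite -sumrB (bigD1 r) //= big1 ?addr0 // => s sr.
by rewrite PQ ?subrr // eq_sym.
Qed.
End Sums.

Lemma uqa_kk i j : k_op i * k_op j - k_op j * k_op i = 0.
Proof. by rewrite !tens_opM (eq_tens (B := fun=> khalf j *m khalf i)) ?subrr // => s; rewrite dgC. Qed.

Lemma uqa_kV i : k_op i * kV_op i - 1 = 0.
Proof.
rewrite tens_opM tens_op1 ?subrr // => s; rewrite dgM -diag_const_mx.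
by congr diag_mx; apply/rowP => h; rewrite !mxE divff // expf_neq0.
Qed.

Lemma uqa_Vk i : kV_op i * k_op i - 1 = 0.
Proof.
rewrite tens_opM tens_op1 ?subrr // => s; rewrite dgM -diag_const_mx.
by congr diag_mx; apply/rowP => h; rewrite !mxE mulVf // expf_neq0.
Qed.

Lemma conj_k_X i a u v r : k_op i * X a u v r * kV_op i =
  qh ^ ((i == u)%:Z - (i == v)%:Z) *: X a u v r.
Proof.
rewrite !tens_opM.
pose c s := if s == r then qh ^ ((i == u)%:Z - (i == v)%:Z) else 1.
have -> : qh ^ ((i == u)%:Z - (i == v)%:Z) = \prod_s c s.
  rewrite (bigD1 r) //= big1 ?mulr1 => [|s sr]; first by rewrite /c eqxx.
  by rewrite /c (negPf sr).
apply: tens_opZ => s; rewrite /site /c.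
have VE d : dg (fun h => qh ^+ (i == h)) *m dg d *m dg (fun h => qh ^- (i == h)) = dg d.
  rewrite !dgM; apply: eq_dg => h; rewrite mulrAC divff ?mul1r //.
  exact: expf_neq0.
have [->|sr] := eqVneq s r; last by rewrite scale1r; case: ifP => _; exact: VE.
rewrite ltnn dg_delta -scalemxAl delta_dg scalerA; congr (_ *: _).
by rewrite expfzDr ?qh0 // -invr_expz mulrC.
Qed.

Lemma uqa_ke i b : k_op i * e_op b * kV_op i
  - qh ^ ((i == lo b)%:Z - (i == hi b)%:Z) *: e_op b = 0.
Proof.
rewrite e_opE mulr_sumr mulr_suml scaler_sumr -sumrB big1 // => r _.
by rewrite conj_k_X subrr.
Qed.

Lemma uqa_kf i b : k_op i * f_op b * kV_op i
  - qh ^ (- (i == lo b)%:Z + (i == hi b)%:Z) *: f_op b = 0.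
Proof.
rewrite f_opE mulr_sumr mulr_suml scaler_sumr -sumrB big1 // => r _.
by rewrite conj_k_X [(- _ + _ : int)]addrC subrr.
Qed.

Lemma X_ef_comm a b r s : r != s ->
  X a (lo a) (hi a) r * X b (hi b) (lo b) s =
  X b (hi b) (lo b) s * X a (lo a) (hi a) r.
Proof.
have ab1 : w b (lo a) / w b (hi a) * (w a (hi b) / w a (lo b)) = 1.
  by rewrite -[w a _ / _]invf_div -/(cart b a) -/(cart a b) cart_sym divff // mulf_neq0 ?invr_eq0 ?w0.
rewrite neq_ltn => /orP[] rs; last by rewrite [LHS]X_comm // mulrC ab1 scale1r.
by rewrite [RHS]X_comm // ab1 scale1r.
Qed.

Lemma uqa_ef a b : e_op a * f_op b - f_op b * e_op a - ((a == b)%:R / (q - q^-1)) *: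
   (k_op (lo a) * k_op (lo a) * (kV_op (hi a) * kV_op (hi a))
    - kV_op (lo a) * kV_op (lo a) * (k_op (hi a) * k_op (hi a))) = 0.
Proof.
rewrite e_opE f_opE commutator_sum; last by move=> r s; apply: X_ef_comm.
have [ab|ab] := eqVneq a b; last first.
  rewrite mul0r scale0r subr0 big1 // => r _.
  by rewrite !X_same0 ?subrr ?lo_eq ?hi_eq // eq_sym.
rewrite -{b}ab mul1r.
pose D (m : nat) : E := tens_op (fun s : 'I_p =>
  if (s < m)%N then dg (fun h => w a h ^+ 2) else dg (fun h => w a h ^- 2)).
have -> : k_op (lo a) * k_op (lo a) * (kV_op (hi a) * kV_op (hi a)) = D p.
  rewrite !tens_opM; apply: eq_tens => s; rewrite ltn_ord !dgM.
  by apply: eq_dg => h; rewrite /w; field; rewrite expf_neq0.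
have -> : kV_op (lo a) * kV_op (lo a) * (k_op (hi a) * k_op (hi a)) = D 0%N.
  rewrite !tens_opM; apply: eq_tens => s; rewrite ltn0 !dgM.
  by apply: eq_dg => h; rewrite /w; field; rewrite !expf_neq0.
have qq : q - q^-1 != 0.
  apply: contraNneq q2 => /eqP; rewrite subr_eq0 => /eqP qE.
  by rewrite expr2 {2}qE divff.
have -> : D p - D 0%N = \sum_(r < p) (D r.+1 - D r).
  by rewrite -(big_mkord xpredT (fun r : nat => D r.+1 - D r)) telescope_sumr.
rewrite scaler_sumr -sumrB big1 // => r _; apply/eqP; rewrite subr_eq0; apply/eqP.
pose P x y := \prod_(s | s != r)
  (if (s < r)%N then dg (fun h => w a h ^+ 2) else dg (fun h => w a h ^- 2)) (y s) (x s).
have PE u v x y : coord x y (X a u v r * X a v u r) = delta_mx u u (y r) (x r) * P x y.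
  rewrite tens_opM coord_tens (bigD1 r) //=; congr (_ * _).
    by rewrite /site ltnn eqxx mul_delta_mx.
  apply: eq_bigr => s sr; rewrite /site (negPf sr).
  by case: ifP => _; rewrite dgM; congr ((_ : 'M_n) _ _); apply: eq_dg => h; rewrite -?invfM -expr2.
have DE (m : nat) x y : (m == r :> nat) || (m == r.+1) -> coord x y (D m) =
    (if m == r.+1 then dg (fun h => w a h ^+ 2) else dg (fun h => w a h ^- 2)) (y r) (x r) * P x y.
  move=> mr; rewrite coord_tens (bigD1 r) //=; congr (_ * _).
    by congr ((_ : 'M_n) _ _); case/orP: mr => /eqP ->; rewrite ?ltnn ?ltnSn ?eqxx // (ltn_eqF (ltnSn r)).
  apply: eq_bigr => s sr; congr ((_ : 'M_n) _ _).
  rewrite (_ : (s < m)%N = (s < r)%N) //; move: sr; rewrite -val_eqE /= => sr.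
  by case/orP: mr => /eqP -> //; lia.
apply: coordP => x y; rewrite !coordE !PE !DE ?eqxx ?orbT // (ltn_eqF (ltnSn r)) !mxE.
have [->|xy] := eqVneq (y r) (x r); last first.
  have dE h : (y r == h) && (x r == h) = false.
    by apply/negP => /andP[/eqP <- /eqP hx]; rewrite hx eqxx in xy.
  by rewrite !dE !mulr0n; ring.
rewrite !andbb !mulr1n -!(eq_sym (_ a) (x r)) /w.
move: (P x y) => c; case: (eqVneq (lo a) (x r)) => [<-|_].
  rewrite hilo !expr1 !expr0 divr1 qhE /=; field.
  by rewrite q0 -expr2 subr_eq0 q2.
case: (eqVneq (hi a) (x r)) => _; last by rewrite !expr0 divr1 expr1n invr1 /=; ring.
rewrite !expr1 !expr0 div1r exprVn qhE /=; field.
by rewrite q0 oner_eq0 -expr2 subr_eq0 q2.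
Qed.

Lemma uqa_ee a b : distant a b -> e_op a * e_op b - e_op b * e_op a = 0.
Proof.
move=> ab; have h1 := cart_distant ab; have h2 := cart_distant (distantC ab).
rewrite /cart in h1 h2.
rewrite !e_opE commutator_sum.
  by rewrite big1 // => r _; rewrite !X_same0 ?subrr // -val_eqE /=;
     move: ab; rewrite /distant; lia.
move=> r s; rewrite neq_ltn => /orP[] rs.
  by rewrite [RHS]X_comm // h1 h2 mulr1 scale1r.
by rewrite [LHS]X_comm // h1 h2 mulr1 scale1r.
Qed.

Lemma cartV a b : w a (hi b) / w a (lo b) = (cart a b)^-1.
Proof. by rewrite /cart invf_div. Qed.

Lemma uqa_ff a b : distant a b -> f_op a * f_op b - f_op b * f_op a = 0.
Proof.
move=> ab; have h1 := cart_distant ab; have h2 := cart_distant (distantC ab).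
rewrite !f_opE commutator_sum.
  by rewrite big1 // => r _; rewrite !X_same0 ?subrr // -val_eqE /=;
     move: ab; rewrite /distant; lia.
move=> r s; rewrite neq_ltn => /orP[] rs.
  by rewrite [RHS]X_comm // !cartV h1 h2 invr1 mulr1 scale1r.
by rewrite [LHS]X_comm // !cartV h1 h2 invr1 mulr1 scale1r.
Qed.

Lemma uqa_eee a b : neighbours a b ->
  e_op a * e_op a * e_op b - (q + q^-1) *: (e_op a * e_op b * e_op a)
  + e_op b * (e_op a * e_op a) = 0.
Proof.
move=> ab; have nf := neighbours_factor ab; rewrite mulrA !e_opE.
apply: (ser_sum q0) => [r s rs|r s rs|r s rs|r|r].
- by rewrite X_comm // -!/(cart _ _) !cart_same -expr2.
- by rewrite X_comm // -!/(cart _ _) nf.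
- by rewrite X_comm // -!/(cart _ _) mulrC nf.
- by rewrite X_same0 // hilo.
- move: ab; rewrite /neighbours => /orP[] /eqP abE.
    by rewrite -mulrA [X in _ * X]X_same0 ?mulr0 // -val_eqE /= abE; lia.
  by rewrite X_same0 ?mul0r // -val_eqE /= abE; lia.
Qed.

Lemma uqa_fff a b : neighbours a b ->
  f_op a * f_op a * f_op b - (q + q^-1) *: (f_op a * f_op b * f_op a)
  + f_op b * (f_op a * f_op a) = 0.
Proof.
move=> ab; have nf := neighbours_factor ab.
rewrite mulrA !f_opE (_ : q + q^-1 = q^-1 + q^-1^-1); last by rewrite invrK addrC.
apply: (ser_sum (z := q^-1)) => [|r s rs|r s rs|r s rs|r|r].
- by rewrite invr_eq0.
- by rewrite X_comm // !cartV !cart_same -invfM exprVn expr2.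
- by rewrite X_comm // !cartV -invfM nf.
- by rewrite X_comm // !cartV -invfM mulrC nf.
- by rewrite X_same0 // lohi.
- move: ab; rewrite /neighbours => /orP[] /eqP abE.
    by rewrite X_same0 ?mul0r // -val_eqE /= abE; lia.
  by rewrite -mulrA [X in _ * X]X_same0 ?mulr0 // -val_eqE /= abE; lia.
Qed.

Fact uq_op_rel u : uq_rel q qh u -> eval (uq_asg k_op kV_op e_op f_op) u = 0.
Proof.
move: u; apply: eval_uq_rel.
- exact: uqa_kk.
- exact: uqa_kV.
- exact: uqa_Vk.
- exact: uqa_ke.
- exact: uqa_kf.
- exact: uqa_ef.
- exact: uqa_ee.
- exact: uqa_ff.
- exact: uqa_eee.
- exact: uqa_fff.
Qed.

Definition uq_rep : uq_gl q qh n -> E := lift uq_op_rel.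
End QuantumAction.

Definition commutant (K : fieldType) (W : vectType K) (A : set (endo W)) :
    set (endo W) :=
  [set f | forall g, A g -> f * g = g * f].

Definition qint (K : fieldType) (q : K) (k : nat) : K :=
  (q ^+ k - q ^- k) / (q - q^-1).

Definition qfact (K : fieldType) (q : K) (p : nat) : K :=
  \prod_(1 <= k < p.+1) qint q k.

Arguments hecke_rep {K q} n p q0 _.
Arguments uq_rep {K q qh} n p qhE q0 q2 _.

(* Main.v *)
Require Import Defs.
From HB Require Import structures.
From mathcomp Require Import all_boot all_order all_algebra perm.
From mathcomp Require Import classical_sets boolp reals complex finmap monalg.
From mathcomp Require Import spectral ring zify.
Import Defs.
Import Order.TTheory GRing.Theory Num.Theory.
Local Open Scope ring_scope.

Set Implicit Arguments.
Unset Strict Implicit.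
Unset Printing Implicit Defensive.

(** Both images are the algebras generated by the operators of the generators
    ([range_lift]); write H and U for them. That they commute is a computation
    on two neighbouring tensor factors ([move2_hecke2], [uq_hecke_comm]). The
    hypothesis [p]! != 0 is used in the form that none of the first p powers of
    q^2 is equal to 1.

    The commutant of H is U ([hecke_commutant]). As an H-module, each weight
    space of V^(x)p is generated by the basis vector e_b with descending letters,
    so an f commuting with H is known from the vectors v = f e_b. Such a v
    inherits the equations t_r v = q v of e_b for those r at which b has two
    equal letters, i.e. it lies in a product of q-symmetric powers of V, one for
    each run of equal letters of b. The main point is that U e_b contains this
    whole product ([symmetric_generated]). Its monomials are indexed by the
    rearrangements of words within the runs. If a monomial y differs from b,
    let j be the outermost run (the largest one containing a letter smaller than
    j, or else the smallest one containing a letter larger than j), move such a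
    letter one step towards j, and apply the generator e_i or f_i that moves it
    back: one gets y with a coefficient q^m [a], where 0 < a <= p, plus monomials
    which are nearer to b in the sense of the sum of the squared differences of
    letters. Hence induction on that sum reaches every monomial
    ([symm_basis_step]). The elements of U obtained for the various weights are
    glued by weight projections, which are polynomials in the q^(eps_i/2) because
    the powers of q^(1/2) up to the p-th are distinct ([weight_projection]).

    The commutant of U is H. If n >= p, a vector e_x with p distinct letters
    generates V^(x)p under U, and f e_x = h e_x for some h in H by weight
    considerations, so f = h ([uq_commutant_distinct]). If n < p, then f lies in
    the bicommutant of H by the first half, and it remains to see that H is
    separable ([separable_bicommutant]). Separability passes from p letters to
    n <= p letters ([hecke_separable_restrict]), so let n = p. Here h |-> the
    coefficient of e_x in h e_x, with e_x = e_p ... e_1, is the standard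
    symmetrizing trace of the Hecke algebra. It is a weighted sum of the diagonal
    coefficients of h over all basis vectors ([twisted_trace_coord]), that is, a
    combination of characters of H, the normalization being essentially [p]!
    ([trace_weight_total]). Such a form is symmetric and vanishes on nilpotents;
    as it is also nondegenerate, the algebra is separable in characteristic zero
    ([symmetric_separable]). *)

(** * Generated algebras *)

Section GeneratedAlgebra.
Variables (K : fieldType) (W : vectType K).
Implicit Types (G P : endo W -> Prop) (f g h : endo W).

Inductive gen_alg G : endo W -> Prop :=
| gen_alg1 : gen_alg G 1
| gen_alg_in g : G g -> gen_alg G g
| gen_algD f g : gen_alg G f -> gen_alg G g -> gen_alg G (f + g)
| gen_algZ c f : gen_alg G f -> gen_alg G (c *: f)
| gen_algM f g : gen_alg G f -> gen_alg G g -> gen_alg G (f * g).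

Lemma gen_alg0 G : gen_alg G 0.
Proof. by rewrite -(scale0r (1 : endo W)); apply/gen_algZ/gen_alg1. Qed.

Lemma gen_alg_sum G I (s : seq I) (Q : pred I) (F : I -> endo W) :
  (forall i, Q i -> gen_alg G (F i)) -> gen_alg G (\sum_(i <- s | Q i) F i).
Proof.
by move=> GF; elim/big_ind: _ => //; [exact: gen_alg0 | exact: gen_algD].
Qed.

Lemma gen_alg_prod G I (s : seq I) (Q : pred I) (F : I -> endo W) :
  (forall i, Q i -> gen_alg G (F i)) -> gen_alg G (\prod_(i <- s | Q i) F i).
Proof.
by move=> GF; elim/big_ind: _ => //; [exact: gen_alg1 | exact: gen_algM].
Qed.

Lemma gen_alg_sub G G' f : (forall g, G g -> gen_alg G' g) ->
  gen_alg G f -> gen_alg G' f.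
Proof.
move=> GG'; elim=> // {f}; first exact: gen_alg1.
- by move=> f g _ Gf _ Gg; apply: gen_algD.
- by move=> c f _; apply: gen_algZ.
- by move=> f g _ Gf _ Gg; apply: gen_algM.
Qed.

Lemma gen_alg_comm G f h : (forall g, G g -> h * g = g * h) ->
  gen_alg G f -> h * f = f * h.
Proof.
move=> hG; elim=> {f} [|g /hG //|f g _ hf _ hg|c f _ hf|f g _ hf _ hg].
- by rewrite mulr1 mul1r.
- by rewrite mulrDr mulrDl hf hg.
- by rewrite -endo_scaleAl -endo_scaleAr hf.
- by rewrite mulrA hf -mulrA hg mulrA.
Qed.

(** Every element of a generated algebra is a combination of words, so that it
    suffices to close up under multiplication by a single generator. *)
Lemma gen_alg_word G P :
    P 1 -> (forall f g, P f -> P g -> P (f + g)) ->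
    (forall c f, P f -> P (c *: f)) ->
    (forall f g, P f -> G g -> P (f * g)) ->
  forall f, gen_alg G f -> P f.
Proof.
move=> P1 PD PZ PM f Gf; rewrite -[f]mul1r.
elim: Gf 1 P1 => {f} [|g Gg|f g _ Pf _ Pg|c f _ Pf|f g _ Pf _ Pg] h Ph.
- by rewrite mulr1.
- exact: PM.
- by rewrite mulrDr; apply: PD; [exact: Pf | exact: Pg].
- by rewrite -endo_scaleAr; apply/PZ/Pf.
- by rewrite mulrA; apply/Pg/Pf.
Qed.

End GeneratedAlgebra.

(** A presentation enters the image of an action only through the values at the
    generators. *)
Lemma range_lift (K : fieldType) (X : choiceType) (W : vectType K)
    (T : X -> endo W) (S : set (free_alg K X))
    (hT : forall u, S u -> eval T u = 0) :
  range (lift hT) = [set f | gen_alg (fun g => exists x, g = T x) f]%classic.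
Proof.
rewrite eqEsubset; split=> [_ [a _ <-]|f /=].
  elim/pres_ind: a => u; rewrite lift_pres; apply: gen_alg_sum => k _.
  by apply/gen_algZ/gen_alg_prod => x _; apply: gen_alg_in; exists x.
elim=> {f} [|_ [x ->]|f g _ [a _ <-] _ [b _ <-]|c f _ [a _ <-]|f g _ [a _ <-] _ [b _ <-]].
- by exists 1 => //; rewrite rmorph1.
- by exists (pres_of S (free_gen K x)) => //; rewrite lift_gen.
- by exists (a + b) => //; rewrite raddfD.
- by exists (c *: a) => //; rewrite linearZ.
- by exists (a * b) => //; rewrite rmorphM.
Qed.

(** * Coordinates on tensor space *)

Section TensorCoordinates.
Variables (K : fieldType) (n p : nat).
Implicit Types (x y z : tidx n p) (v w : tspace K n p) (f g : endo (tspace K n p)).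

Lemma appE f v y : (f : 'End(_)) v y = \sum_x v x * coord x y f.
Proof.
rewrite [v in LHS]tspace_sum linear_sum sum_ffunE; apply: eq_bigr => x _.
by rewrite linearZ /= ffunE.
Qed.

Lemma coordM x y f g :
  coord x y (f * g) = \sum_z coord x z g * coord z y f.
Proof. by rewrite /coord endoM appE. Qed.

Lemma coord1 x y : coord x y (1 : endo (tspace K n p)) = (x == y)%:R.
Proof. by rewrite /coord endo1 ffunE. Qed.

Lemma app_basis f x y : (f : 'End(_)) (tbasis K x) y = coord x y f.
Proof. by []. Qed.

Lemma coord_sum I (s : seq I) (Q : pred I) (F : I -> endo (tspace K n p)) x y :
  coord x y (\sum_(i <- s | Q i) F i) = \sum_(i <- s | Q i) coord x y (F i).
Proof.
apply: (big_morph (coord x y)); [exact: coordD | exact: coord0].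
Qed.

Definition upd y (r : 'I_p) (j : 'I_n) : tidx n p :=
  [ffun s => if s == r then j else y s].

Lemma updE y r j s : upd y r j s = if s == r then j else y s.
Proof. by rewrite ffunE. Qed.
Lemma upd_same y r j : upd y r j r = j.
Proof. by rewrite updE eqxx. Qed.
Lemma upd_diff y r j s : s != r -> upd y r j s = y s.
Proof. by rewrite updE => /negPf ->. Qed.
Lemma upd_id y r : upd y r (y r) = y.
Proof. by apply/ffunP => s; rewrite updE; case: eqP => [->|]. Qed.
Lemma upd_upd y r i j : upd (upd y r i) r j = upd y r j.
Proof. by apply/ffunP => s; rewrite !updE; case: eqP. Qed.

Definition transp f : endo (tspace K n p) :=
  lin_ext (fun x => [ffun y => coord y x f]).

Lemma coord_transp x y f : coord x y (transp f) = coord y x f.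
Proof. by rewrite /coord lin_ext_basis ffunE. Qed.

Lemma transpM f g : transp (f * g) = transp g * transp f.
Proof.
apply: coordP => x y; rewrite coord_transp !coordM; apply: eq_bigr => z _.
by rewrite !coord_transp mulrC.
Qed.

Lemma transpD f g : transp (f + g) = transp f + transp g.
Proof. by apply: coordP => x y; rewrite !(coord_transp, coordD). Qed.
Lemma transpZ c f : transp (c *: f) = c *: transp f.
Proof. by apply: coordP => x y; rewrite !(coord_transp, coordZ). Qed.
Lemma transp1 : transp 1 = 1.
Proof. by apply: coordP => x y; rewrite coord_transp !coord1 eq_sym. Qed.

Lemma gen_alg_transp (G : endo (tspace K n p) -> Prop) f :
  (forall g, G g -> G (transp g)) -> gen_alg G f -> gen_alg G (transp f).
Proof.
move=> GT; elim=> {f} [|g /GT|f g _ Gf _ Gg|c f _ Gf|f g _ Gf _ Gg].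
- by rewrite transp1; apply: gen_alg1.
- exact: gen_alg_in.
- by rewrite transpD; apply: gen_algD.
- by rewrite transpZ; apply: gen_algZ.
- by rewrite transpM; apply: gen_algM.
Qed.

End TensorCoordinates.

(** * The Hecke generators in coordinates *)

Section HeckeCoordinates.
Variables (K : fieldType) (q : K) (n p : nat).
Implicit Types (x y z : tidx n p) (v w : tspace K n p) (f g : endo (tspace K n p)).
Implicit Types (r s : 'I_p.-1).
Local Notation t r := (hecke_op q n r).

Lemma lo_neq_hi r : lo r != hi r.
Proof. by rewrite -val_eqE /=; lia. Qed.

Lemma coord_hecke r x y : coord x y (t r) =
  if x (lo r) == x (hi r) then q * (x == y)%:R
  else if (x (hi r) < x (lo r))%N then (swap r x == y)%:R
  else (swap r x == y)%:R + (q - q^-1) * (x == y)%:R.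
Proof. by rewrite -[t r]mul1r coord_hecke_op !coord1. Qed.

(** The matrix of t in the standard basis is symmetric. So transposition
    preserves the Hecke algebra, and every statement about the raising operators
    has a transpose about the lowering ones. *)
Lemma transp_hecke r : transp (t r) = t r.
Proof.
apply: coordP => x y; rewrite coord_transp !coord_hecke.
have [->//|xy] := eqVneq x y.
have -> : (swap r y == x) = (swap r x == y).
  by rewrite (can2_eq (@swapK n p r) (@swapK n p r)) eq_sym.
rewrite !mulr0 !addr0; have [<-|_] := eqVneq (swap r x) y; last first.
  by do !case: ifP.
rewrite swap_lo swap_hi eq_sym; case: eqP => // _.
by case: ifP; case: ifP.
Qed.

Lemma app_hecke r v y : (t r : 'End(_)) v y =
  if y (lo r) == y (hi r) then q * v y
  else if (y (hi r) < y (lo r))%N then v (swap r y)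
  else v (swap r y) + (q - q^-1) * v y.
Proof.
rewrite appE -transp_hecke.
under eq_bigr => x _ do rewrite coord_transp coord_hecke.
have S1 z : \sum_x v x * (z == x)%:R = v z.
  rewrite (bigD1 z) //= eqxx mulr1 big1 ?addr0 // => x xz.
  by rewrite eq_sym (negPf xz) mulr0.
case: ifP => _.
  by under eq_bigr => x _ do rewrite mulrCA; rewrite -mulr_sumr S1.
case: ifP => _; first by rewrite S1.
under eq_bigr => x _ do rewrite mulrDr mulrCA.
by rewrite big_split /= -mulr_sumr !S1.
Qed.

Lemma hecke_basis_desc r x : (x (hi r) < x (lo r))%N ->
  (t r : 'End(_)) (tbasis K x) = tbasis K (swap r x).
Proof.
move=> h; rewrite lin_ext_basis h; case: eqP => // E.
by rewrite E ltnn in h.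
Qed.

End HeckeCoordinates.

(** * Nilpotent matrices and traces of powers *)

Section TracesOfPowers.
Variables (C : numClosedFieldType) (n : nat).
Implicit Types (A T : 'M[C]_n.+1) (p : {poly C}).

Lemma horner_trig T p : is_trig_mx T ->
  is_trig_mx (horner_mx T p) /\ forall i, horner_mx T p i i = p.[T i i].
Proof.
move=> /is_trig_mxP Tt; elim/poly_ind: p => [|p c [/is_trig_mxP pt pd]].
  rewrite rmorph0; split=> [|i]; first exact: mx0_is_trig.
  by rewrite mxE horner0.
rewrite rmorphD rmorphM /= horner_mx_X horner_mx_C.
split=> [|i]; first apply/is_trig_mxP => i j ij.
  rewrite mxE -mulmxE mxE big1 ?add0r => [|k _].
    by rewrite mxE -val_eqE /= (ltn_eqF ij).
  have [ik|ki] := ltnP i k; first by rewrite pt ?mul0r.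
  by rewrite Tt ?mulr0 // (leq_ltn_trans ki).
rewrite !hornerE !mxE eqxx mulr1n -pd (bigD1 i) //= big1 ?addr0 // => k ki.
have [ik|ki'] := ltnP i k; first by rewrite pt ?mul0r.
by rewrite Tt ?mulr0 // ltn_neqAle ki' andbT.
Qed.

(** Schur triangularization; the eigenvalues become visible on the diagonal. *)
Lemma horner_similar_trig A : exists2 T, is_trig_mx T & exists2 P, P \in unitmx &
  forall p, horner_mx A p = invmx P *m horner_mx T p *m P.
Proof.
have [P /unitarymx_unit Pu PA] := Schur A (ltn0Sn n).
exists (P *m A *m invmx P); first by rewrite -conjumx.
exists P => //.
elim/poly_ind => [|p c IH]; first by rewrite !rmorph0 mulmx0 mul0mx.
rewrite !rmorphD !rmorphM /= !horner_mx_X !horner_mx_C IH mulmxDr mulmxDl.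
rewrite -!mulmxE !mulmxA; congr (_ + _); first by rewrite !mulmxKV.
by rewrite mul_mx_scalar -scalemxAl mulVmx // scalemx1.
Qed.

Lemma trace_nilpotent_pos A m : A ^+ m = 0 -> \tr A = 0.
Proof.
move=> Am0; have [T Tt [P Pu AE]] := horner_similar_trig A.
have := AE 'X; rewrite !horner_mx_X => ->.
rewrite mxtrace_mulC mulmxA mulmxV // mul1mx; apply: big1 => i _.
have := AE 'X^m; rewrite !rmorphXn /= !horner_mx_X Am0 => /(congr1 (mulmx P)).
move/(congr1 (mulmx^~ (invmx P))); rewrite !mulmxA mulmxV // mul1mx mulmxK //.
rewrite mulmx0 mul0mx => Tm0; have [_ /(_ i)] := horner_trig 'X^m Tt.
rewrite rmorphXn /= horner_mx_X -Tm0 mxE !hornerE => /esym/eqP.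
by rewrite expf_eq0 => /andP[_ /eqP].
Qed.

(** A polynomial without constant term has trace zero at [A]. If some eigenvalue
    is nonzero, choosing one that vanishes at the other eigenvalues isolates a
    nonzero multiple of its multiplicity, which is impossible in characteristic
    zero. *)
Lemma nilpotent_traces_pos A :
  (forall k, (0 < k)%N -> \tr (A ^+ k) = 0) -> exists m, A ^+ m = 0.
Proof.
move=> trA; have [T Tt [P Pu AE]] := horner_similar_trig A.
have trE p : \tr (horner_mx A p) = \sum_i p.[T i i].
  rewrite AE mxtrace_mulC mulmxA mulmxV // mul1mx.
  by apply: eq_bigr => i _; have [_ ->] := horner_trig p Tt.
have tr0 p : \sum_i ('X * p).[T i i] = 0.
  rewrite -trE rmorphM /= horner_mx_X -[p]coefK poly_def.
  rewrite raddf_sum /= mulr_sumr raddf_sum /= big1 // => k _.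
  rewrite linearZ /= rmorphXn /= horner_mx_X -scalerAr -exprS.
  by rewrite linearZ /= trA // mulr0.
have T0 i : T i i = 0.
  apply/eqP/negPn/negP => Ti0.
  (* with the factor 'X below, this vanishes at all other eigenvalues *)
  pose p := \prod_(j | T j j != T i i) ('X - (T j j)%:P).
  have pi0 : p.[T i i] != 0.
    rewrite horner_prod; apply/prodf_neq0 => j ji.
    by rewrite !hornerE subr_eq0 eq_sym.
  have := tr0 p; rewrite (bigID (fun j => T j j == T i i)) /=.
  rewrite [X in _ + X]big1 ?addr0 => [|j ji]; last first.
    by rewrite !hornerE horner_prod (bigD1 j) //= !hornerE /= subrr mulr0 mul0r.
  rewrite (eq_bigr (fun=> T i i * p.[T i i])) => [|j /eqP ->]; last first.
    by rewrite !hornerE.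
  move/eqP; rewrite sumr_const mulrn_eq0 !mulf_eq0 (negPf Ti0) (negPf pi0).
  by rewrite !orbF => /pred0P/(_ i)/negbT/negP; apply; apply: eqxx.
exists n.+1; have := AE ('X ^+ n.+1); rewrite !rmorphXn /= !horner_mx_X => ->.
have := Cayley_Hamilton T; rewrite char_poly_trig //.
rewrite (eq_bigr (fun=> 'X)) => [|i _]; last by rewrite T0 subr0.
rewrite prodr_const card_ord rmorphXn /= horner_mx_X => ->.
by rewrite mulmx0 mul0mx.
Qed.

End TracesOfPowers.

Lemma nilpotent_traces (C : numClosedFieldType) n (A : 'M[C]_n) :
  (forall k, (0 < k)%N -> \tr (A ^+ k) = 0) -> exists m, A ^+ m = 0.
Proof.
case: n => [|n] in A *; last exact: nilpotent_traces_pos.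
by exists 0%N; rewrite flatmx0 [RHS]flatmx0.
Qed.

Lemma trace_nilpotent (C : numClosedFieldType) n (A : 'M[C]_n) m :
  A ^+ m = 0 -> \tr A = 0.
Proof.
case: n => [|n] in A *; last exact: trace_nilpotent_pos.
by move=> _; rewrite /mxtrace big_ord0.
Qed.

(** * Symmetric algebras in characteristic zero *)

Section SymmetricAlgebra.
Variables (C : numClosedFieldType) (W : vectType C).
Local Notation E := (endo W).
Implicit Types (f g h : E).

(** The elements [a i] and [b i] form a separability idempotent
    [\sum_i a i (x) b i]. That the two products with [h] agree in the tensor
    square is expressed by a common matrix [c], a form which is visibly
    preserved by homomorphisms. *)
Definition separable (A : E -> Prop) := exists (d : nat) (a b : 'I_d -> E),
  [/\ forall i, A (a i), forall i, A (b i), \sum_i a i * b i = 1 &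
   forall h, A h -> exists c : 'M[C]_d,
     (forall i, h * a i = \sum_j c i j *: a j) /\
     (forall j, b j * h = \sum_i c i j *: b i)].

Variables (U : {vspace 'End(W)}) (t : {scalar E}).
Hypothesis U1 : (1 : E) \in U.
Hypothesis UM : forall f g, f \in U -> g \in U -> (f * g : E) \in U.
Hypothesis tC : forall f g, f \in U -> g \in U -> t (f * g) = t (g * f).
Hypothesis t_nondeg :
  forall f, f \in U -> (forall g, g \in U -> t (f * g) = 0) -> f = 0.
Hypothesis t_nil : forall f m, f \in U -> f ^+ m = 0 -> t f = 0.

Let d := \dim U.
Let a (i : 'I_d) : E := (vbasis U)`_i.
Let aU i : a i \in U. Proof. by apply/vbasis_mem/mem_nth; rewrite size_tuple. Qed.

Let gram : 'M[C]_d := \matrix_(i, j) t (a i * a j).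

Let rowE_free (u : 'rV[C]_d) : \sum_i u 0 i *: a i = 0 -> u = 0.
Proof.
move=> ua0; apply/rowP => i; rewrite mxE.
have /freeP := basis_free (vbasisP U); apply.
by move: ua0; under eq_bigr => j _ do rewrite -/(a j).
Qed.

Let expand f : f \in U -> exists u : 'rV[C]_d, f = \sum_i u 0 i *: a i.
Proof.
move=> /coord_vbasis fE; exists (\row_i vector.coord (vbasis U) i f).
by rewrite {1}fE; apply: eq_bigr => i _; rewrite mxE.
Qed.

Let spanU (u : 'I_d -> C) : (\sum_i u i *: a i : E) \in U.
Proof. by apply: memv_suml => i _; apply: memvZ. Qed.

Let nondeg_basis f : f \in U -> (forall i, t (f * a i) = 0) -> f = 0.
Proof.
move=> fU fa; apply: t_nondeg => // _ /expand[u ->].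
rewrite mulr_sumr linear_sum big1 // => i _.
by rewrite -endo_scaleAr linearZ /= fa mulr0.
Qed.

Let unit_of_inj (M : 'M[C]_d) : (forall u : 'rV_d, u *m M = 0 -> u = 0) ->
  M \in unitmx.
Proof.
move=> Minj; rewrite -row_free_unit -kermx_eq0; apply/rowV0P => u /sub_kermxP.
exact: Minj.
Qed.

Let gram_unit : gram \in unitmx.
Proof.
apply: unit_of_inj => u /rowP uG; apply: rowE_free.
apply: nondeg_basis => [|j]; first exact: spanU.
have := uG j; rewrite !mxE => uGj; rewrite -[RHS]uGj mulr_suml linear_sum.
by apply: eq_bigr => i _; rewrite -endo_scaleAl linearZ mxE.
Qed.

(* the basis dual to [a] for the form t (f * g) *)
Let b (j : 'I_d) : E := \sum_k invmx gram k j *: a k.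
Let bU j : b j \in U. Proof. exact: spanU. Qed.

Let dual i j : t (a i * b j) = (i == j)%:R.
Proof.
rewrite mulr_sumr linear_sum; have /matrixP/(_ i j) := mulmxV gram_unit.
rewrite !mxE => <-; apply: eq_bigr => k _.
by rewrite -endo_scaleAr linearZ /= mxE mulrC.
Qed.

Let expand_a f : f \in U -> f = \sum_i t (f * b i) *: a i.
Proof.
move=> /expand[u ->]; apply: eq_bigr => j _; congr (_ *: _).
rewrite mulr_suml linear_sum (bigD1 j) //= -endo_scaleAl linearZ /= dual eqxx.
rewrite mulr1 big1 ?addr0 // => i ij.
by rewrite -endo_scaleAl linearZ /= dual (negPf ij) mulr0.
Qed.

Let expand_b f : f \in U -> f = \sum_i t (a i * f) *: b i.
Proof.
move=> fU; apply/eqP; rewrite -subr_eq0; apply/eqP/nondeg_basis => [|j].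
  by apply: memvB => //; apply: memv_suml => i _; apply: memvZ.
rewrite mulrBl linearB mulr_suml linear_sum /= (bigD1 j) //=.
rewrite -endo_scaleAl linearZ /= [t (b j * _)]tC // dual eqxx mulr1 [t (f * _)]tC //.
rewrite big1 ?addr0 ?subrr // => i ij.
by rewrite -endo_scaleAl linearZ /= [t (b i * _)]tC // dual eq_sym (negPf ij) mulr0.
Qed.

(* Left multiplication on U, with the images of the basis in the rows: this
   reverses products, see [regM]. *)
Let reg f : 'M[C]_d := \matrix_(i, j) t (f * a i * b j).

Let regE f i : f \in U -> f * a i = \sum_j reg f i j *: a j.
Proof.
move=> fU; rewrite {1}[f * a i]expand_a; last exact: UM.
by apply: eq_bigr => j _; rewrite mxE.
Qed.

Let casimir_b f j : f \in U -> b j * f = \sum_i reg f i j *: b i.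
Proof.
move=> fU; rewrite {1}[b j * f]expand_b; last exact: UM.
by apply: eq_bigr => i _; rewrite mxE mulrA tC ?mulrA //; apply: UM.
Qed.

Let regM f g : f \in U -> g \in U -> reg (f * g) = reg g *m reg f.
Proof.
move=> fU gU; apply/matrixP => i k; rewrite !mxE -[f * g * _]mulrA regE //.
rewrite [f * _]mulr_sumr mulr_suml linear_sum; apply: eq_bigr => j _.
by rewrite -endo_scaleAr -endo_scaleAl linearZ /=; congr (_ * _); rewrite mxE.
Qed.

Let regX f k : f \in U -> f ^+ k.+1 \in U /\ reg (f ^+ k.+1) = reg f ^+ k.+1.
Proof.
move=> fU; elim: k => [|k [IHU IH]]; first by rewrite !expr1.
by rewrite exprS; split; [exact: UM | rewrite regM // IH [RHS]exprSr].
Qed.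

(* the Casimir element of the form; [t] and the regular trace differ by it *)
Let z : E := \sum_i a i * b i.
Let zU : z \in U. Proof. by apply: memv_suml => i _; apply: UM. Qed.

Let z_central f : f \in U -> f * z = z * f.
Proof.
move=> fU; rewrite mulr_sumr mulr_suml.
under eq_bigr => i _ do rewrite mulrA regE // mulr_suml.
under [RHS]eq_bigr => j _ do rewrite -mulrA casimir_b // mulr_sumr.
rewrite exchange_big; apply: eq_bigr => j _; apply: eq_bigr => i _.
by rewrite -endo_scaleAl -endo_scaleAr.
Qed.

Let trace_reg f : \tr (reg f) = t (f * z).
Proof.
rewrite mulr_sumr linear_sum; apply: eq_bigr => i _.
by rewrite mxE mulrA.
Qed.

(* If z f = 0, the regular trace vanishes on all powers of f g, so f g is
   nilpotent and t (f g) = 0, for every g. *)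
Let z_regular f : f \in U -> z * f = 0 -> f = 0.
Proof.
move=> fU zf0; apply: t_nondeg => // g gU.
have xU := UM fU gU; set x := f * g in xU *.
have zx0 : x * z = 0 by rewrite z_central // mulrA zf0 mul0r.
have [|m regm0] := @nilpotent_traces _ _ (reg x).
  move=> [//|k] _; have [xkU <-] := regX k xU.
  by rewrite trace_reg exprSr -mulrA zx0 mulr0 linear0.
apply: (t_nil (m := m.+1)) => //; have [xmU regE'] := regX m xU.
rewrite [reg x ^+ _]exprS regm0 mulr0 in regE'.
have xa i : x ^+ m.+1 * a i = 0.
  by rewrite regE // regE' big1 // => j _; rewrite mxE scale0r.
have [u uE] := expand U1; rewrite -[LHS]mulr1 uE mulr_sumr big1 // => i _.
by rewrite -endo_scaleAr xa scaler0.
Qed.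

(** As the Casimir element is not a zero divisor it is invertible, and dividing
    the Casimir tensor by it gives a separability idempotent. *)
Lemma symmetric_separable : separable (fun f => f \in U).
Proof.
have regz : reg z \in unitmx.
  apply: unit_of_inj => u uz0; apply: rowE_free; apply: z_regular => //.
  rewrite mulr_sumr; under eq_bigr => i _ do rewrite -endo_scaleAr regE // scaler_sumr.
  rewrite exchange_big big1 // => j _.
  move/rowP/(_ j): uz0; rewrite !mxE => uz0.
  by under eq_bigr => i _ do rewrite scalerA; rewrite -scaler_suml uz0 scale0r.
have [u uE] := expand U1; pose v := u *m invmx (reg z).
pose y : E := \sum_i v 0 i *: a i.
have yU : y \in U by exact: spanU.
have zy : z * y = 1.
  rewrite mulr_sumr; under eq_bigr => i _ do rewrite -endo_scaleAr regE // scaler_sumr.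
  rewrite exchange_big uE; apply: eq_bigr => j _.
  under eq_bigr => i _ do rewrite scalerA.
  rewrite -scaler_suml; congr (_ *: _).
  by have := congr1 (fun w : 'rV_d => w 0 j) (mulmxKV regz u); rewrite mxE.
have yz : y * z = 1 by rewrite z_central.
have yC h : h \in U -> h * y = y * h.
  move=> hU; rewrite -[LHS]mul1r -yz -mulrA [z * (h * y)]mulrA -z_central //.
  by rewrite -!mulrA zy mulr1.
exists d, (fun i => y * a i), b; split=> //.
- by move=> i; apply: UM.
- by rewrite -yz mulr_sumr; apply: eq_bigr => i _; rewrite mulrA.
move=> h hU; exists (reg h); split=> [i|j]; last exact: casimir_b.
rewrite mulrA yC // -mulrA regE // mulr_sumr; apply: eq_bigr => j _.
by rewrite -endo_scaleAr.
Qed.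

End SymmetricAlgebra.

(** * The double centralizer of a separable algebra *)

(** A subspace of maximal dimension among those inside [P] is all of [P]. *)
Lemma vspace_of_pred (K : fieldType) (V : vectType K) (P : V -> Prop) :
  P 0 -> (forall c u v, P u -> P v -> P (c *: u + v)) ->
  exists U : {vspace V}, forall v, v \in U <-> P v.
Proof.
move=> P0 PL.
have [m] := ubnP (\dim {:V} - \dim (0%VS : {vspace V})).
have : forall v, v \in (0%VS : {vspace V}) -> P v by move=> v /[!memv0] /eqP ->.
move: 0%VS; elim: m => // m IH U UP dU.
have [[v [Pv vU]]|/forallNP h] := pselect (exists v, P v /\ v \notin U); last first.
  exists U => v; split; first exact: UP.
  by move=> Pv; apply/negPn/negP => vU; apply: (h v).
apply: (IH (U + <[v]>)%VS) => [_ /memv_addP[u uU [_ /vlineP[c ->] ->]]|].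
  by rewrite addrC; apply: PL => //; apply: UP.
have dlt : (\dim U < \dim (U + <[v]>))%N.
  rewrite ltn_neqAle dimvS ?addvSl // andbT; apply: contraNneq vU => dE.
  have /eqP -> : U == (U + <[v]>)%VS by rewrite eqEdim addvSl dE leqnn.
  by rewrite memvE addvSr.
have dle : (\dim (U + <[v]>) <= \dim {:V})%N by rewrite dimvS ?subvf.
by move: dU dlt dle; set x := \dim _; set y := \dim _; set z := \dim _; lia.
Qed.

Lemma separable_quotient (C : numClosedFieldType) (W W' : vectType C)
    (A : endo W -> Prop) (A' : endo W' -> Prop) (res : {linear endo W -> endo W'}) :
    res 1 = 1 -> (forall f g, A f -> A g -> res (f * g) = res f * res g) ->
    (forall f, A f -> A' (res f)) -> (forall g, A' g -> exists2 f, A f & res f = g) ->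
  separable A -> separable A'.
Proof.
move=> res1 resM resA resS [d [a [b [Aa Ab ab1 cas]]]].
exists d, (res \o a), (res \o b); split=> [i|i||_ /resS[h Ah <-]].
- exact: resA.
- exact: resA.
- by rewrite -res1 -ab1 raddf_sum; apply: eq_bigr => i _; rewrite /= resM.
have [c [ca cb]] := cas h Ah; exists c; split=> [i|j] /=.
  rewrite -resM // ca linear_sum; apply: eq_bigr => j _.
  by rewrite linearZ.
rewrite -resM // cb linear_sum; apply: eq_bigr => i _.
by rewrite linearZ.
Qed.

Section Bicommutant.
Variables (C : numClosedFieldType) (n p : nat).
Local Notation V := (tspace C n p).
Local Notation E := (endo V).
Variable A : E -> Prop.
Hypothesis A1 : A 1.
Hypothesis AL : forall c f g, A f -> A g -> A (c *: f + g).
Hypothesis AM : forall f g, A f -> A g -> A (f * g).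
Hypothesis A_sep : separable A.

Let A0 : A 0.
Proof. by have := AL (-1) A1 A1; rewrite scaleN1r addNr. Qed.

(* the rank one endomorphism v (x) y^* *)
Let rank1 (v : V) (y : tidx n p) : E := lin_ext (fun x => (x == y)%:R *: v).

Let rank1_basis v y x : (rank1 v y : 'End(_)) (tbasis C x) = (x == y)%:R *: v.
Proof. exact: lin_ext_basis. Qed.

Let rank1M f v y : f * rank1 v y = rank1 ((f : 'End(_)) v) y.
Proof. by apply: endoP => x; rewrite endoM !rank1_basis linearZ. Qed.

Let rank1_linear y : linear (rank1^~ y).
Proof.
move=> c u v; apply: endoP => x.
by rewrite add_lfunE scale_lfunE !rank1_basis scalerDr !scalerA mulrC.
Qed.

Let sum_rank1 f : f = \sum_y rank1 ((f : 'End(_)) (tbasis C y)) y.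
Proof.
apply: endoP => x; rewrite sum_lfunE (bigD1 x) //= rank1_basis eqxx scale1r.
by rewrite big1 ?addr0 // => y yx; rewrite rank1_basis eq_sym (negPf yx) scale0r.
Qed.

(** Double centralizer theorem. The separability idempotent averages a linear
    projection onto [A] into one commuting with left multiplication by [A];
    as [End V] is a sum of copies of [V], it then commutes with left
    multiplication by any [f] of the bicommutant, and [f = f * 1] lies in [A]. *)
Lemma separable_bicommutant f :
    (forall g, (forall h, A h -> g * h = h * g) -> f * g = g * f) -> A f.
Proof.
have [U UA] := @vspace_of_pred _ 'End(V) A A0 AL.
move=> fA; have [d [a [b [Aa Ab ab1 cas]]]] := A_sep.
pose P (X : E) : E := \sum_i a i * (projv U (b i * X : E) : E).
have PA X : A (P X).
  apply/UA/memv_suml => i _; apply/UA/AM => //.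
  exact/UA/memv_proj.
have P1 : P 1 = 1.
  rewrite -[RHS]ab1; apply: eq_bigr => i _.
  by rewrite mulr1 projv_id //; apply/UA.
have PL c X Y : P (c *: X + Y) = c *: P X + P Y.
  rewrite /P scaler_sumr -big_split /=; apply: eq_bigr => i _.
  by rewrite mulrDr -endo_scaleAr linearP /= mulrDr -endo_scaleAr.
have PM h X : A h -> P (h * X) = h * P X.
  move=> /cas[c [ca cb]]; rewrite /P mulr_sumr.
  under eq_bigr => j _ do rewrite mulrA cb mulr_suml linear_sum mulr_sumr.
  under [RHS]eq_bigr => i _ do rewrite mulrA ca mulr_suml.
  rewrite exchange_big; apply: eq_bigr => i _; apply: eq_bigr => j _.
  by rewrite -endo_scaleAl linearZ /= -endo_scaleAr -endo_scaleAl.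
suff <- : P f = f by [].
rewrite -[RHS]mulr1 -P1; apply: endoP => z.
have Psum (F : tidx n p -> E) : P (\sum_y F y) = \sum_y P (F y).
  apply: (big_morph P) => [X Y|]; first by have := PL 1 X Y; rewrite !scale1r.
  by apply: (addrI (P 0)); have := PL 1 0 0; rewrite !scale1r !addr0.
have PE g : P g = \sum_y P (rank1 ((g : 'End(_)) (tbasis C y)) y).
  by rewrite -Psum -sum_rank1.
rewrite (PE f) (PE 1) mulr_sumr !sum_lfunE; apply: eq_bigr => y _.
rewrite endo1.
pose phi_fun (v : V) : V := (P (rank1 v y) : 'End(_)) (tbasis C z).
have phi_lin : linear phi_fun.
  by move=> c u v; rewrite /phi_fun rank1_linear PL add_lfunE scale_lfunE.
pose phi : E := lin_ext (fun x => phi_fun (tbasis C x)).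
have phiE v : (phi : 'End(_)) v = phi_fun v.
  have phiD : {morph phi_fun : u v / u + v}.
    by move=> u w; have := phi_lin 1 u w; rewrite !scale1r.
  have phi0 : phi_fun 0 = 0 by apply: (addrI (phi_fun 0)); rewrite -phiD !addr0.
  rewrite lin_extE [in RHS](tspace_sum v) (big_morph phi_fun phiD phi0).
  by apply: eq_bigr => x _; have := phi_lin (v x) (tbasis C x) 0; rewrite phi0 !addr0.
have phiA : forall h, A h -> phi * h = h * phi.
  move=> h Ah; apply: endoP => x.
  by rewrite !endoM !phiE /phi_fun -rank1M PM // endoM.
have := congr1 (fun g : E => (g : 'End(_)) (tbasis C y)) (fA phi phiA).
by rewrite !endoM !phiE.
Qed.

End Bicommutant.

(** * The quantum group commutes with the Hecke algebra *)

Section DiagonalOperators.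
Variables (K : fieldType) (q : K) (n p : nat).
Implicit Types (x y z : tidx n p) (v : tspace K n p) (f g : endo (tspace K n p)).

Definition diag_op (c : tidx n p -> K) : endo (tspace K n p) :=
  lin_ext (fun x => c x *: tbasis K x).

Lemma app_diag c v y : (diag_op c : 'End(_)) v y = c y * v y.
Proof.
rewrite lin_extE sum_ffunE (bigD1 y) //= big1 ?addr0 => [|x xy].
  by rewrite !ffunE eqxx /GRing.scale /= mulr1 mulrC.
by rewrite !ffunE (negPf xy) !scaler0.
Qed.

Lemma coord_diag c x y : coord x y (diag_op c) = c y * (x == y)%:R.
Proof. by rewrite -app_basis app_diag ffunE. Qed.

Lemma diag_hecke c r : (forall x, c (swap r x) = c x) ->
  diag_op c * hecke_op q n r = hecke_op q n r * diag_op c.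
Proof.
move=> cr; apply: coordP => x y; rewrite /coord !endoM app_diag !app_hecke.
by rewrite !app_diag cr; case: ifP => _; [ring|case: ifP => _ //; ring].
Qed.

Lemma app_endo_ext f g : 
  (forall v y, (f : 'End(_)) v y = (g : 'End(_)) v y) -> f = g.
Proof. by move=> fg; apply: coordP => x y; apply: fg. Qed.

End DiagonalOperators.

Section QuantumOperators.
Variables (K : fieldType) (q qh : K) (n p : nat).
Implicit Types (x y z : tidx n p) (v : tspace K n p) (f : endo (tspace K n p)).
Implicit Types (i j : 'I_n) (a : 'I_n.-1) (r : 'I_p.-1) (s : 'I_p).
Hypotheses (qhE : qh ^+ 2 = q) (q0 : q != 0).

Let qh0 : qh != 0.
Proof. by apply: contraNneq q0 => qh0; rewrite -qhE qh0 expr0n. Qed.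

(* the eigenvalue of q^((eps_a - eps_(a+1))/2) on e_i *)
Definition rt_wt a i : K := qh ^+ (lo a == i) / qh ^+ (hi a == i).

Lemma rt_wt_neq0 a i : rt_wt a i != 0.
Proof. by rewrite mulf_neq0 ?invr_eq0 ?expf_neq0. Qed.

(* The scalar by which the group-like factors on both sides of s act, in the
   s-th summand of the coproduct of a raising or lowering generator. *)
Definition site_wt a s y : K :=
  (\prod_(t < p | (t < s)%N) rt_wt a (y t)) /
  (\prod_(t < p | (s < t)%N) rt_wt a (y t)).

(** Both the raising and the lowering generators have this form, which moves a
    letter from j to i in one tensor factor. *)
Definition move_op a i j : endo (tspace K n p) := \sum_(s < p) tens_op
  (site (khalf qh (lo a) *m khalfV qh (hi a)) (delta_mx i j)
        (khalfV qh (lo a) *m khalf qh (hi a)) s).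

Lemma e_op_move a : e_op qh p a = move_op a (lo a) (hi a). Proof. by []. Qed.
Lemma f_op_move a : f_op qh p a = move_op a (hi a) (lo a). Proof. by []. Qed.

Let dgE a i j : (khalf qh (lo a) *m khalfV qh (hi a)) i j = rt_wt a i *+ (i == j).
Proof. by rewrite mulmx_diag !mxE. Qed.
Let dgVE a i j : (khalfV qh (lo a) *m khalf qh (hi a)) i j = (rt_wt a i)^-1 *+ (i == j).
Proof. by rewrite mulmx_diag !mxE invf_div mulrC. Qed.

Lemma app_move a i j v y : (move_op a i j : 'End(_)) v y =
  \sum_s (y s == i)%:R * site_wt a s y * v (upd y s j).
Proof.
rewrite sum_lfunE sum_ffunE; apply: eq_bigr => s _.
rewrite appE (bigD1 (upd y s j)) //= big1 ?addr0 => [|x xu]; last first.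
  rewrite coord_tens.
  have [t xt] : exists t, x t != upd y s j t.
    apply/existsP; apply: contraNT xu => /existsPn h; apply/eqP/ffunP => t.
    by apply/eqP; have := h t; rewrite negbK.
  rewrite (bigD1 t) //= {1}/site; move: xt; rewrite updE /=.
  case: (eqVneq t s) => [->|ts] xt.
    by rewrite ltnn mxE [x s == j]negbTE // andbF !(mul0r, mulr0).
  have yx : (y t == x t) = false by rewrite eq_sym (negPf xt).
  by case: ifP => _; rewrite ?dgE ?dgVE yx mulr0n !(mul0r, mulr0).
rewrite mulrC; congr (_ * _); rewrite coord_tens (bigD1 s) //=.
rewrite /site ltnn eqxx mxE upd_same eqxx andbT; congr (_ * _).
rewrite (bigID (fun t : 'I_p => (t < s)%N)) /=; congr (_ * _).
  apply: eq_big => [t|t /andP[ts tls]].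
    by rewrite -val_eqE /=; case: ltngtP.
  by rewrite tls dgE upd_diff // eqxx.
rewrite -prodfV; apply: eq_big => [t|t /andP[ts tls]].
  by rewrite -val_eqE /=; case: ltngtP.
by rewrite (negPf tls) (negPf ts) dgVE upd_diff // eqxx.
Qed.

Lemma transp_move a i j : transp (move_op a i j) = move_op a j i.
Proof.
apply: coordP => x y; rewrite coord_transp !coord_sum; apply: eq_bigr => s _.
rewrite !coord_tens; apply: eq_bigr => t _; rewrite /site.
case: ifP => _; last case: ifP => _.
- by rewrite !dgE eq_sym; case: eqP => // ->.
- by rewrite !mxE andbC.
- by rewrite !dgVE eq_sym; case: eqP => // ->.
Qed.

Lemma k_op_diag i : k_op qh p i = diag_op (fun x => qh ^+ #|[pred s | x s == i]|).
Proof.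
apply: coordP => x y; rewrite coord_diag coord_tens.
under eq_bigr => s _ do rewrite !mxE.
have [->|xy] := eqVneq x y.
  under eq_bigr => s _ do rewrite eqxx mulr1n eq_sym.
  by rewrite mulr1 prodrXr -big_mkcond sum1_card.
have [s xs] : exists s, y s != x s.
  apply/existsP; apply: contraNT xy => /existsPn h; apply/eqP/ffunP => s.
  by apply/esym/eqP; have := h s; rewrite negbK.
by rewrite (bigD1 s) //= (negPf xs) mulr0n mul0r mulr0.
Qed.

Lemma kV_op_diag i : kV_op qh p i = diag_op (fun x => qh ^- #|[pred s | x s == i]|).
Proof.
apply: coordP => x y; rewrite coord_diag coord_tens.
under eq_bigr => s _ do rewrite !mxE.
have [->|xy] := eqVneq x y.
  under eq_bigr => s _ do rewrite eqxx mulr1n eq_sym.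
  by rewrite mulr1 prodfV prodrXr -big_mkcond sum1_card.
have [s xs] : exists s, y s != x s.
  apply/existsP; apply: contraNT xy => /existsPn h; apply/eqP/ffunP => s.
  by apply/esym/eqP; have := h s; rewrite negbK.
by rewrite (bigD1 s) //= (negPf xs) mulr0n mul0r mulr0.
Qed.

Lemma card_swap r x i : #|[pred s | swap r x s == i]| = #|[pred s | x s == i]|.
Proof.
rewrite -!sum1_card (reindex_inj (@perm_inj _ (tperm (lo r) (hi r)))) /=.
by apply: eq_bigl => s; rewrite !inE ffunE tpermK.
Qed.

Lemma k_op_hecke i r :
  k_op qh p i * hecke_op q n r = hecke_op q n r * k_op qh p i.
Proof. by rewrite k_op_diag diag_hecke // => x; rewrite card_swap. Qed.

Lemma kV_op_hecke i r :
  kV_op qh p i * hecke_op q n r = hecke_op q n r * kV_op qh p i.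
Proof. by rewrite kV_op_diag diag_hecke // => x; rewrite card_swap. Qed.

(* t on V (x) V, where F gives the coefficients of a tensor; similarly for the
   raising generator in [move2]. *)
Definition hecke2 (F : 'I_n -> 'I_n -> K) (c d : 'I_n) : K :=
  if c == d then q * F c d
  else if (d < c)%N then F d c else F d c + (q - q^-1) * F c d.

Definition move2 a (F : 'I_n -> 'I_n -> K) (c d : 'I_n) : K :=
  (c == lo a)%:R * (rt_wt a d)^-1 * F (hi a) d
  + (d == lo a)%:R * rt_wt a c * F c (hi a).

(** The commutation of t with the coproduct of e_a, i.e. the case of two tensor
    factors. Letters other than a and a+1 compare in the same way with both. *)
Lemma move2_hecke2 a F c d : move2 a (hecke2 F) c d = hecke2 (move2 a F) c d.
Proof.
pose w := rt_wt a.
have ij : (lo a == hi a) = false by apply/negbTE/lo_neq_hi.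
have ji : (hi a == lo a) = false by rewrite eq_sym.
have lt_ij : (lo a < hi a)%N by [].
have lt_ji : (hi a < lo a)%N = false by rewrite ltnNge ltnW.
have wE e : e != lo a -> w e = if e == hi a then qh^-1 else 1.
  move=> ei; rewrite /w /rt_wt eq_sym (negPf ei) eq_sym.
  by case: eqP => _; rewrite ?expr1 ?expr0 ?div1r ?invr1.
have wi : w (lo a) = qh by rewrite /w /rt_wt eqxx ji expr0 expr1 divr1.
have far e : e != lo a -> e != hi a ->
    ((lo a < e)%N = (hi a < e)%N) * ((e < lo a)%N = (e < hi a)%N).
  by move=> e1 e2; rewrite -!val_eqE /= in e1 e2 *; split; lia.
rewrite /move2 /hecke2 -/w -!qhE.
have [->|ci] := eqVneq c (lo a); have [->|di] := eqVneq d (lo a).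
- by rewrite ?eqxx ij ji lt_ij lt_ji wi /=; field; rewrite ?qh0 ?oner_eq0.
- rewrite (wE d di) wi; have [->|dj] := eqVneq d (hi a).
    by rewrite ?eqxx lt_ji /=; field; rewrite ?qh0 ?oner_eq0.
  by rewrite (far d di dj).2; rewrite /=; case: ifP => _; field; rewrite ?qh0 ?oner_eq0.
- rewrite (negPf ci) (wE c ci) wi; have [->|cj] := eqVneq c (hi a).
    by rewrite ?eqxx lt_ij /=; field; rewrite ?qh0 ?oner_eq0.
  by rewrite (far c ci cj).1 /=; case: (_ < c)%N; field; rewrite ?qh0 ?oner_eq0. 
- by rewrite /= !(mul0r, addr0, mulr0); case: ifP => _ //; case: ifP.
Qed.

Section OnePair.
Variables (r : 'I_p.-1).
Let l := lo r.
Let h := hi r.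

Definition pair_upd y (c d : 'I_n) : tidx n p := upd (upd y (lo r) c) (hi r) d.

Let lh : l != h. Proof. exact: lo_neq_hi. Qed.
Let hl : h != l. Proof. by rewrite eq_sym. Qed.

Let pair_id y : pair_upd y (y l) (y h) = y.
Proof.
by apply/ffunP => s; rewrite !updE; case: eqP => [->//|_]; case: eqP => [->|].
Qed.
Let pair_lo y c d : pair_upd y c d l = c.
Proof. by rewrite upd_diff // upd_same. Qed.
Let pair_hi y c d : pair_upd y c d h = d.
Proof. exact: upd_same. Qed.
Let pair_swap y c d : swap r (pair_upd y c d) = pair_upd y d c.
Proof.
apply/ffunP => s; have [->|sl] := eqVneq s l.
  by rewrite swap_lo pair_hi pair_lo.
have [->|sh] := eqVneq s h; first by rewrite swap_hi pair_hi pair_lo.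
by rewrite swapD // !upd_diff.
Qed.
Let upd_lo y c : upd y l c = pair_upd y c (y h).
Proof.
rewrite -{1}[y]pair_id /pair_upd; apply/ffunP => s; rewrite !updE.
by case: eqP => // ->; rewrite (negPf lh).
Qed.
Let upd_hi y c : upd y h c = pair_upd y (y l) c.
Proof. by rewrite -{1}[y]pair_id /pair_upd upd_upd. Qed.

Let Lc a y : K := \prod_(t < p | (t < l)%N) rt_wt a (y t).
Let Rc a y : K := \prod_(t < p | (h < t)%N) rt_wt a (y t).

Let site_wt_lo a y : site_wt a l y = Lc a y / Rc a y * (rt_wt a (y h))^-1.
Proof.
rewrite /site_wt -/(Lc a y) (bigD1 h) //=.
rewrite (eq_bigl (fun t : 'I_p => (h < t)%N)) ?invfM => [|t].
  by rewrite mulrA mulrAC.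
by rewrite -val_eqE /=; lia.
Qed.

Let site_wt_hi a y : site_wt a h y = Lc a y / Rc a y * rt_wt a (y l).
Proof.
rewrite /site_wt -/(Rc a y) (bigD1 l) /= ?ltnSn //.
rewrite (eq_bigl (fun t : 'I_p => (t < l)%N)) => [|t].
  by rewrite -/(Lc a y) [RHS]mulrC mulrA.
by rewrite -val_eqE /=; lia.
Qed.

Let move_split a y (g : tidx n p -> K) :
  \sum_s (y s == lo a)%:R * site_wt a s y * g (upd y s (hi a)) =
  \sum_(s | (s != l) && (s != h))
     (y s == lo a)%:R * site_wt a s y * g (upd y s (hi a))
  + Lc a y / Rc a y * move2 a (fun c d => g (pair_upd y c d)) (y l) (y h).
Proof.
rewrite (bigD1 l) //= (bigD1 h) //= addrA [LHS]addrC; congr (_ + _).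
rewrite site_wt_lo site_wt_hi upd_lo upd_hi /move2; ring.
Qed.

Let swap_prod a y (P : pred 'I_p) : ~~ P l -> ~~ P h ->
  \prod_(t | P t) rt_wt a (swap r y t) = \prod_(t | P t) rt_wt a (y t).
Proof.
move=> Pl Ph; apply: eq_bigr => t Pt; rewrite swapD //.
  by apply: contraNneq Pl; rewrite -/l => <-.
by apply: contraNneq Ph; rewrite -/h => <-.
Qed.

Let site_wt_swap a s y : s != l -> s != h ->
  site_wt a s (swap r y) = site_wt a s y.
Proof.
move=> sl sh; rewrite /site_wt; congr (_ / _).
  have [lt_sl|le_ls] := ltnP s h.
    by apply: swap_prod; move: sl sh lt_sl; rewrite -!val_eqE /=; lia.
  rewrite (reindex_inj (@perm_inj _ (tperm l h))) /=.
  apply: eq_big => [t|t _]; last by rewrite ffunE tpermK.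
  by case: tpermP => // ->; move: sl sh le_ls; rewrite -!val_eqE /=; lia.
have [lt_sl|le_ls] := ltnP h s.
  by apply: swap_prod; move: sl sh lt_sl; rewrite -!val_eqE /=; lia.
rewrite (reindex_inj (@perm_inj _ (tperm l h))) /=.
apply: eq_big => [t|t _]; last by rewrite ffunE tpermK.
by case: tpermP => // ->; move: sl sh le_ls; rewrite -!val_eqE /=; lia.
Qed.

(** In the summands of e_a that act away from the two sites of t_r, these sites
    carry equal group-like factors; the other two summands form, up to a common
    scalar, the operator e_a on two tensor factors. *)
Lemma move_hecke a :
  move_op a (lo a) (hi a) * hecke_op q n r = hecke_op q n r * move_op a (lo a) (hi a).
Proof.
apply: app_endo_ext => v y; rewrite !endoM app_hecke !app_move.
have LRs : Lc a (swap r y) / Rc a (swap r y) = Lc a y / Rc a y.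
  by congr (_ / _); apply: swap_prod => /=; lia.
rewrite (move_split a y ((hecke_op q n r : 'End(_)) v)) (move_split a y v).
rewrite (move_split a (swap r y) v) LRs swap_lo swap_hi.
have -> : move2 a (fun c d => (hecke_op q n r : 'End(_)) v (pair_upd y c d)) (y l) (y h) =
    hecke2 (move2 a (fun c d => v (pair_upd y c d))) (y l) (y h).
  rewrite -move2_hecke2; congr (_ + _); congr (_ * _).
    by rewrite app_hecke pair_lo pair_hi pair_swap.
  by rewrite app_hecke pair_lo pair_hi pair_swap.
have -> : move2 a (fun c d => v (pair_upd (swap r y) c d)) (y h) (y l) =
    move2 a (fun c d => v (pair_upd y c d)) (y h) (y l).
  have pu c d : pair_upd (swap r y) c d = pair_upd y c d.
    apply/ffunP => s; rewrite !updE; case: eqP => // /eqP sh.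
    by case: eqP => // /eqP sl; rewrite swapD.
  by rewrite /move2 !pu.
set M := move2 a _.
pose N (u : tidx n p) : K := \sum_(s | (s != l) && (s != h))
     (u s == lo a)%:R * site_wt a s u * v (upd u s (hi a)).
rewrite -/(N y) -/(N (swap r y)).
have Nswap : N (swap r y) = \sum_(s | (s != l) && (s != h))
     (y s == lo a)%:R * site_wt a s y * v (swap r (upd y s (hi a))).
  apply: eq_bigr => s /andP[sl sh]; rewrite swapD // site_wt_swap //.
  congr (_ * v _); apply/ffunP => t; rewrite !(ffunE, updE).
  case: tpermP => [->|->|//]; rewrite ?(negPf lh) ?(negPf hl).
    by rewrite [l == s]eq_sym [h == s]eq_sym (negPf sl) (negPf sh).
  by rewrite [l == s]eq_sym [h == s]eq_sym (negPf sl) (negPf sh).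
rewrite (eq_bigr (fun s => (y s == lo a)%:R * site_wt a s y *
    (if y l == y h then q * v (upd y s (hi a))
     else if (y h < y l)%N then v (swap r (upd y s (hi a)))
     else v (swap r (upd y s (hi a))) + (q - q^-1) * v (upd y s (hi a)))));
  last first.
  move=> s /andP[sl sh]; rewrite app_hecke !upd_diff //.
    by rewrite eq_sym.
  by rewrite eq_sym.
rewrite /hecke2 -/l -/h; move: (M (y l) (y h)) (M (y h) (y l)) => M1 M2.
case: ifP => _; last case: ifP => _.
- rewrite [RHS]mulrDr /N mulr_sumr; congr (_ + _); last by rewrite mulrCA.
  by apply: eq_bigr => s _; rewrite mulrCA.
- by rewrite Nswap.
- rewrite Nswap [_ * (M2 + _)]mulrDr [(q - q^-1) * (N y + _)]mulrDr [RHS]addrACA.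
  congr (_ + _); last by rewrite mulrCA.
  rewrite /N mulr_sumr -big_split; apply: eq_bigr => s _ /=.
  by rewrite [LHS]mulrDr; congr (_ + _); rewrite mulrCA.
Qed.

End OnePair.

Lemma e_op_hecke a r :
  e_op qh p a * hecke_op q n r = hecke_op q n r * e_op qh p a.
Proof. by rewrite e_op_move move_hecke. Qed.

Lemma f_op_hecke a r :
  f_op qh p a * hecke_op q n r = hecke_op q n r * f_op qh p a.
Proof.
rewrite f_op_move -(transp_move a (lo a)) -[hecke_op _ _ _](transp_hecke q).
by rewrite -!transpM move_hecke.
Qed.

End QuantumOperators.

(** * Positions and ranks *)

Section Positions.
Variable p : nat.

Lemma antitone_adjacent (f : 'I_p -> nat) :
  (forall r : 'I_p.-1, (f (hi r) <= f (lo r))%N) ->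
  forall s t : 'I_p, (s <= t)%N -> (f t <= f s)%N.
Proof.
move=> fadj s t; have [m tE] : exists m, t = m :> nat by exists t.
elim: m t tE => [|m IH] t tE st.
  by have -> : t = s by apply/val_inj; move: st; rewrite tE /=; lia.
have [E|ts] := eqVneq t s; first by rewrite E.
have mp : (m < p.-1)%N by have := ltn_ord t; lia.
pose r := Ordinal mp; have tr : t = hi r by apply/val_inj; rewrite /= tE.
rewrite tr (leq_trans (fadj r)) //; apply: IH => //=.
by move: st ts; rewrite -val_eqE tE /=; lia.
Qed.

(** An injection into the initial segment of the right size is a bijection. *)
Lemma sum_rank (R : nmodType) (A : pred 'I_p) (f : 'I_p -> nat) (F : nat -> R) :
  {in A &, injective f} -> (forall s, A s -> (f s < #|A|)%N) ->
  \sum_(s | A s) F (f s) = \sum_(m < #|A|) F m.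
Proof.
move=> finj fA; have [A0|/card_gt0P[s0 As0]] := posnP #|A|.
  rewrite A0 big_ord0 big1 // => s As.
  by move/card0_eq/(_ s): A0; rewrite /in_mem /= As.
have A0 : (0 < #|A|)%N by apply/card_gt0P; exists s0.
pose g s : 'I_#|A| := insubd (Ordinal A0) (f s).
have gE s : A s -> g s = f s :> nat by move=> As; rewrite val_insubd fA.
rewrite (eq_bigr (fun s => F (g s))) => [|s As]; last by rewrite gE.
have ginj : {in A &, injective g}.
  move=> s t As At /(congr1 val); rewrite /= !gE //; exact: finj.
rewrite -(big_imset (fun m : 'I_#|A| => F m) ginj) /=; apply: eq_bigl => m.
suff -> : g @: A = [set: 'I_#|A|] by rewrite inE.
by apply/eqP; rewrite eqEcard finset.subsetT cardsT card_ord (card_in_imset ginj) leqnn.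
Qed.

Definition rank_below (A : pred 'I_p) (s : 'I_p) := #|[pred t | A t && (t < s)%N]|.
Definition rank_above (A : pred 'I_p) (s : 'I_p) := #|[pred t | A t && (s < t)%N]|.

Lemma rank_below_above (A : pred 'I_p) s : A s ->
  (rank_below A s + rank_above A s).+1 = #|A|.
Proof.
move=> As; have As' : s \in A by [].
rewrite (cardD1 s) As' add1n; congr _.+1.
rewrite -(cardID (fun t : 'I_p => (t < s)%N)); congr (_ + _)%N; apply: eq_card => t.
  by rewrite /in_mem /= /in_mem /= -val_eqE /=; case: ltngtP => //=; rewrite ?andbT ?andbF.
by rewrite /in_mem /= /in_mem /= -val_eqE /=; case: ltngtP => //=; rewrite ?andbT ?andbF.
Qed.

Lemma rank_below_inj (A : pred 'I_p) : {in A &, injective (rank_below A)}.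
Proof.
have lt (s t : 'I_p) : A s -> (s < t)%N -> (rank_below A s < rank_below A t)%N.
  move=> As st; apply/proper_card/properP; split.
    by apply/fintype.subsetP => u; rewrite !inE => /andP[-> us]; rewrite (ltn_trans us).
  by exists s; rewrite !inE As ?st ?ltnn.
move=> s t As At E; apply/val_inj; have [h|h|//] := ltngtP s t.
  by have := lt s t As h; rewrite E ltnn.
by have := lt t s At h; rewrite E ltnn.
Qed.

Lemma rank_above_inj (A : pred 'I_p) : {in A &, injective (rank_above A)}.
Proof.
move=> s t As At E; apply: (rank_below_inj As At).
have := rank_below_above As; rewrite -(rank_below_above At) E => /eqP.
by rewrite eqSS eqn_add2r => /eqP.
Qed.

Lemma rank_below_lt (A : pred 'I_p) s : A s -> (rank_below A s < #|A|)%N.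
Proof. by move/rank_below_above => <-; rewrite ltnS leq_addr. Qed.
Lemma rank_above_lt (A : pred 'I_p) s : A s -> (rank_above A s < #|A|)%N.
Proof. by move/rank_below_above => <-; rewrite ltnS leq_addl. Qed.

End Positions.

(** * Sorting letters within blocks *)

Section BlockSorting.
Variables (n p : nat) (b : 'I_p -> nat).
Implicit Types (x y z : tidx n p) (r : 'I_p.-1) (s t : 'I_p).

Definition block_sorted y :=
  forall r, b (lo r) = b (hi r) -> (y (hi r) <= y (lo r))%N.

(** Bubble sort: exchanging an ascending neighbouring pair decreases the sum of
    the letters multiplied by their positions. *)
Lemma block_sort_ind (P : tidx n p -> Prop) :
    (forall y, block_sorted y -> P y) ->
    (forall r y, b (lo r) = b (hi r) -> (y (lo r) < y (hi r))%N ->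
       P (swap r y) -> P y) ->
  forall y, P y.
Proof.
move=> Psorted Pswap y.
have [m] := ubnP (\sum_(s < p) s * y s)%N; elim: m y => // m IH y ym.
have [/existsP[r /andP[/eqP br yr]]|/existsPn h] :=
    boolP [exists r : 'I_p.-1, (b (lo r) == b (hi r)) && (y (lo r) < y (hi r))%N].
  apply: (Pswap r) => //; apply: IH; rewrite ltnS in ym; apply: leq_trans ym.
  have lh := lo_neq_hi r; have hl : hi r != lo r by rewrite eq_sym.
  rewrite (bigD1 (lo r)) // (bigD1 (hi r)) // [in leqRHS](bigD1 (lo r)) //.
  rewrite [in leqRHS](bigD1 (hi r)) // swap_lo swap_hi.
  rewrite [X in (X < _)%N]addnA [X in (_ < X)%N]addnA -addSn leq_add //.
    by have -> : hi r = (lo r).+1 :> nat by []; move: yr; rewrite !mulSn; lia.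
  by apply: leq_sum => s /andP[sl sh]; rewrite swapD.
apply: Psorted => r /eqP br; have := h r.
by rewrite br /= -leqNgt.
Qed.

(** Words are equivalent under permutations within the blocks iff they have the
    same multiset of pairs (block, letter). Encoding such a pair as one integer,
    with the block as leading digit, makes sorting within descending blocks the
    same as sorting the codes. *)
Definition code y s := (b s * n + y s)%N.
Definition codes y := [seq code y s | s <- enum 'I_p].
Definition same_codes y z := perm_eq (codes y) (codes z).

Lemma same_codes_refl y : same_codes y y. Proof. exact: perm_refl. Qed.
Lemma same_codesC y z : same_codes y z = same_codes z y.
Proof. exact: perm_sym. Qed.
Lemma same_codes_trans x y z :
  same_codes x y -> same_codes y z -> same_codes x z.
Proof. exact: perm_trans. Qed.
Lemma same_codes_eql x y z : same_codes x y -> same_codes x z = same_codes y z.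
Proof. by move=> /permPl xy; rewrite /same_codes xy. Qed.

Lemma swap_codes r y : b (lo r) = b (hi r) -> same_codes (swap r y) y.
Proof.
move=> br; rewrite /same_codes /codes.
have -> : [seq code (swap r y) s | s <- enum 'I_p] =
    [seq code y s | s <- [seq tperm (lo r) (hi r) s | s <- enum 'I_p]].
  rewrite -[RHS]map_comp; apply: seq.eq_map => s; rewrite /code ffunE /=.
  by congr (_ * _ + _)%N; case: tpermP => [->|->|].
apply: perm_map; apply: uniq_perm.
- by rewrite map_inj_uniq ?enum_uniq //; apply: perm_inj.
- exact: enum_uniq.
move=> s; rewrite mem_enum; apply/mapP; exists (tperm (lo r) (hi r) s).
  by rewrite mem_enum.
by rewrite tpermK.
Qed.

Lemma same_codes_sum y z (g : nat -> nat) : same_codes y z ->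
  (\sum_s g (code y s) = \sum_s g (code z s))%N.
Proof.
move=> yz; have E u : (\sum_s g (code u s) = \sum_(c <- codes u) g c)%N.
  by rewrite big_map big_enum.
by rewrite !E; apply: perm_big.
Qed.

Lemma same_codes_of_sums y z :
  (forall c, (\sum_s (code y s == c) = \sum_s (code z s == c))%N) ->
  same_codes y z.
Proof.
move=> yz; have E u c : (count_mem c (codes u) = \sum_s (code u s == c))%N.
  by rewrite -sum1_count big_map big_enum_cond /= big_mkcond.
by apply/allP => c _; rewrite /= !E yz.
Qed.

Lemma upd_sum y s j (g : nat -> nat) :
  (\sum_t g (code (upd y s j) t) + g (code y s) =
   \sum_t g (code y t) + g (b s * n + j))%N.
Proof.
rewrite (bigD1 s) // [in RHS](bigD1 s) //= {1}/code upd_same addnAC [RHS]addnAC.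
congr (_ + _)%N; first by rewrite addnC.
by apply: eq_bigr => t ts; rewrite /code upd_diff.
Qed.

Lemma code_inj s i j : (b s * n + i)%N = (b s * n + j)%N -> i = j.
Proof. exact: addnI. Qed.

Lemma code_eq s t (i j : 'I_n) :
  ((b s * n + i)%N == (b t * n + j)%N) = (b s == b t) && (i == j).
Proof.
apply/eqP/andP => [E|[/eqP -> /eqP -> //]].
have n0 : (0 < n)%N by apply: leq_ltn_trans (ltn_ord i).
have := congr1 (divn^~ n) E; rewrite !divnMDl // !divn_small // !addn0 => ->.
have := congr1 (modn^~ n) E; rewrite !modnMDl !modn_small // => /val_inj ->.
by rewrite !eqxx.
Qed.

Lemma same_codes_upd y z s t (i j : 'I_n) : b s = b t -> y s = i -> z t = i ->
  same_codes (upd y s j) (upd z t j) = same_codes y z.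
Proof.
move=> bst ys zt; have E c := upd_sum y s j (fun c' => nat_of_bool (c' == c)).
have E' c := upd_sum z t j (fun c' => nat_of_bool (c' == c)).
have cst : code y s = code z t by rewrite /code bst ys zt.
apply/idP/idP => h; apply: same_codes_of_sums => c;
  have := same_codes_sum (fun c' => nat_of_bool (c' == c)) h;
  move: (E c) (E' c); rewrite -cst bst; lia.
Qed.

Lemma same_codes_upd_neq y s t (i j : 'I_n) : b s <> b t -> i != j ->
  y s = i -> y t = i -> same_codes (upd y s j) (upd y t j) = false.
Proof.
move=> bst ij ys yt; apply/negP => h.
pose g c := nat_of_bool (c == b t * n + j)%N.
have gt : g (code y t) = 0%N by rewrite /g /code code_eq yt (negPf ij) andbF.
have gs : g (code y s) = 0%N by rewrite /g /code code_eq (introF eqP bst).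
have gtj : g (b t * n + j)%N = 1%N by rewrite /g eqxx.
have gsj : g (b s * n + j)%N = 0%N by rewrite /g code_eq (introF eqP bst).
have := same_codes_sum g h; have := upd_sum y s j g; have := upd_sum y t j g.
by rewrite gt gs gtj gsj; lia.
Qed.

Hypothesis b_anti : forall r, (b (hi r) <= b (lo r))%N.

Lemma code_antitone y : block_sorted y ->
  forall s t, (s <= t)%N -> (code y t <= code y s)%N.
Proof.
move=> ysort; apply: (antitone_adjacent (f := code y)) => r; rewrite /code.
have := b_anti r; rewrite leq_eqVlt => /orP[/eqP E|lt].
  by rewrite E leq_add2l; apply: ysort.
have := ltn_ord (y (hi r)); have := leq_mul lt (leqnn n); rewrite mulSn; lia.
Qed.

Lemma block_sorted_anti y s t : block_sorted y -> (s <= t)%N -> b s = b t ->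
  (y t <= y s)%N.
Proof.
move=> ysort st bst; have := code_antitone ysort st.
by rewrite /code bst leq_add2l.
Qed.

Lemma block_sorted_unique y z : block_sorted y -> block_sorted z ->
  same_codes y z -> y = z.
Proof.
move=> ysort zsort yz.
have sortedc u : block_sorted u -> sorted geq (codes u).
  move=> us; have := iota_sorted 0 p; rewrite -val_enum_ord sorted_map.
  by apply: homo_sorted => s t; apply: code_antitone.
have E : codes y = codes z.
  apply: (sorted_eq (leT := geq)) => //; try exact: sortedc.
    by move=> u v w vu wv; apply: leq_trans wv vu.
  by move=> u v; rewrite andbC -eqn_leq => /eqP.
apply/ffunP => s; apply/val_inj; apply: (@code_inj s).
have := congr1 (fun l => nth 0%N l s) E.
by rewrite [LHS](nth_map s) ?[RHS](nth_map s) ?size_enum_ord // !nth_ord_enum.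
Qed.

(** The exponent of q in the coefficients of a q-symmetric tensor. *)
Definition block_inv y : nat :=
  \sum_(s < p) \sum_(t < p) [&& (s < t)%N, b s == b t & (y s < y t)%N].

(** An adjacent exchange preserves the order of every other pair of positions. *)
Lemma block_inv_swap r y : b (lo r) = b (hi r) -> (y (lo r) < y (hi r))%N ->
  block_inv y = (block_inv (swap r y)).+1.
Proof.
move=> br yr; pose g s := tperm (lo r) (hi r) s.
have gK s : g (g s) = s by exact: tpermK.
have bg s : b (g s) = b s by rewrite /g; case: tpermP => [->|->|].
have lh := lo_neq_hi r.
have -> : block_inv (swap r y) =
    (\sum_s \sum_t [&& (g s < g t)%N, b s == b t & (y s < y t)%N])%N.
  rewrite /block_inv (reindex_inj (@perm_inj _ (tperm (lo r) (hi r)))) /=.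
  apply: eq_bigr => s _.
  rewrite (reindex_inj (@perm_inj _ (tperm (lo r) (hi r)))) /=.
  by apply: eq_bigr => t _; rewrite -!/(g _) !bg !ffunE -!/(g _) !gK.
rewrite /block_inv !pair_big /= (bigD1 (lo r, hi r)) //= [in RHS](bigD1 (lo r, hi r)) //=.
rewrite /g tpermL tpermR br eqxx yr ltnSn /= ltnNge leqnSn /= add0n add1n.
congr _.+1; apply: eq_bigr => -[s t] /= st; congr nat_of_bool.
case: tpermP => [sE|sE|sl sh]; case: tpermP => [tE|tE|tl th];
  rewrite ?sE ?tE ?ltnn //.
- by rewrite sE tE eqxx in st.
- congr (_ && _); move: tl th => /eqP tl /eqP th; move: tl th.
  by rewrite -!val_eqE /=; lia.
- by rewrite [(y _ < y _)%N]ltnNge (ltnW yr) !andbF.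
- congr (_ && _); move: tl th => /eqP tl /eqP th; move: tl th.
  by rewrite -!val_eqE /=; lia.
- congr (_ && _); move: sl sh => /eqP sl /eqP sh; move: sl sh.
  by rewrite -!val_eqE /=; lia.
- congr (_ && _); move: sl sh => /eqP sl /eqP sh; move: sl sh.
  by rewrite -!val_eqE /=; lia.
Qed.

Lemma block_inv_sorted y : block_sorted y -> block_inv y = 0%N.
Proof.
move=> ysort; apply: big1 => s _; apply: big1 => t _.
case: (ltnP s t) => //= st; case: eqP => //= bst.
by rewrite ltnNge (block_sorted_anti ysort (ltnW st) bst).
Qed.

End BlockSorting.

(** * Tensors that are q-symmetric within blocks *)

Section SymmetricTensors.
Variables (C : numClosedFieldType) (q : C) (n p : nat) (b : 'I_p -> nat).
Hypothesis q0 : q != 0.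
Hypothesis b_anti : forall r : 'I_p.-1, (b (hi r) <= b (lo r))%N.
Local Notation V := (tspace C n p).
Implicit Types (y z : tidx n p) (v : V) (r : 'I_p.-1) (s t : 'I_p).

(** The product of the q-symmetric powers of V whose degrees are the sizes of the
    blocks. *)
Definition block_symmetric v := forall r, b (lo r) = b (hi r) ->
  (hecke_op q n r : 'End(_)) v = q *: v.

Lemma block_symmetric_lin c v w :
  block_symmetric v -> block_symmetric w -> block_symmetric (c *: v + w).
Proof.
by move=> vs ws r br; rewrite linearP /= vs // ws // scalerDr !scalerA mulrC.
Qed.

Lemma block_symmetric_app (X : endo V) v :
  (forall r, X * hecke_op q n r = hecke_op q n r * X) ->
  block_symmetric v -> block_symmetric ((X : 'End(_)) v).
Proof. by move=> XT vs r br; rewrite -endoM -XT endoM vs // linearZ. Qed.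

(** In coordinates, t_r v = q v says that v takes on a word that ascends at r q
    times its value on the word with these two letters exchanged. *)
Lemma block_symmetric_swap v r y : block_symmetric v -> b (lo r) = b (hi r) ->
  (y (lo r) < y (hi r))%N -> v y = q * v (swap r y).
Proof.
move=> vs br yr; have := congr1 (fun v : V => v (swap r y)) (vs r br).
rewrite app_hecke swap_lo swap_hi yr swapK ffunE.
by case: eqP => [E|_ //]; rewrite E ltnn in yr.
Qed.

Lemma block_symmetric_sorted v y : block_symmetric v -> exists z,
  [/\ block_sorted b z, same_codes b y z & v y = q ^+ block_inv b y * v z].
Proof.
move=> vs; elim/(@block_sort_ind n p b): y => [y ysort|r y br yr [z [zs yz E]]].
  by exists y; split=> //; [exact: same_codes_refl
    | rewrite block_inv_sorted // mul1r].
exists z; split=> //; first by rewrite (same_codes_eql z (swap_codes y br)) in yz.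
by rewrite (block_symmetric_swap vs br yr) E (block_inv_swap br yr) exprS mulrA.
Qed.

Lemma block_symmetric_same v y z : block_symmetric v -> same_codes b y z ->
  v y * q ^+ block_inv b z = v z * q ^+ block_inv b y.
Proof.
move=> vs yz; have [y' [ys yy' ->]] := block_symmetric_sorted y vs.
have [z' [zs zz' ->]] := block_symmetric_sorted z vs.
have -> : y' = z'.
  apply: (block_sorted_unique b_anti ys zs).
  rewrite same_codesC in yy'; apply: same_codes_trans yy' _.
  exact: same_codes_trans yz zz'.
by rewrite mulrAC [RHS]mulrAC mulrC [RHS]mulrC [X in _ * X = _]mulrC.
Qed.

(** The q-symmetrization of a basis vector within the blocks: the monomials of
    a product of q-symmetric powers. *)
Definition symm_basis y : V :=
  [ffun z => (same_codes b y z)%:R * q ^+ block_inv b z].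

Lemma symm_basis_symmetric y : block_symmetric (symm_basis y).
Proof.
move=> r br; apply/ffunP => z; rewrite app_hecke ![in RHS]ffunE.
have E : same_codes b y (swap r z) = same_codes b y z.
  by rewrite ![same_codes b y _]same_codesC (same_codes_eql y (swap_codes z br)).
have [zr|zr|zr] := ltngtP (z (lo r)) (z (hi r)).
- case: eqP => [e|_]; first by rewrite e ltnn in zr.
  rewrite !ffunE E (block_inv_swap br zr) exprS /GRing.scale /=; field.
  exact: q0.
- case: eqP => [e|_]; first by rewrite e ltnn in zr.
  have zr' : (swap r z (lo r) < swap r z (hi r))%N by rewrite swap_lo swap_hi.
  have br' : b (lo r) = b (hi r) by [].
  rewrite !ffunE E (block_inv_swap br' zr') swapK exprS /GRing.scale /=; ring.
- by rewrite (val_inj zr) eqxx !ffunE.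
Qed.

Lemma symm_basis_same y z : same_codes b y z -> symm_basis y = symm_basis z.
Proof. by move=> yz; apply/ffunP => u; rewrite !ffunE (same_codes_eql u yz). Qed.

(** A q-symmetric tensor is a combination of the monomials in its support. Taking
    all rearrangements of a word, each divided by their number, avoids a choice
    of representatives. *)
Lemma block_symmetric_span (W : V -> Prop) v :
    (forall c u w, W u -> W w -> W (c *: u + w)) -> W 0 ->
    (forall y, v y != 0 -> W (symm_basis y)) ->
  block_symmetric v -> W v.
Proof.
move=> WL W0 Wv vs; pose N y := #|[pred z | same_codes b y z]|.
have -> : v = \sum_y (v y * q ^- block_inv b y / (N y)%:R) *: symm_basis y.
  apply/ffunP => z; rewrite sum_ffunE.
  rewrite (eq_bigr (fun y => if same_codes b z y then v z / (N z)%:R else 0)).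
    rewrite -big_mkcond sumr_const -[#|_|]/(N z) -[RHS]mulr_natr divfK //.
    rewrite pnatr_eq0 -lt0n.
    by apply/card_gt0P; exists z; rewrite inE same_codes_refl.
  move=> y _; rewrite !ffunE /GRing.scale /= same_codesC; case: ifP => zy; last first.
    by rewrite mul0r mulr0.
  have -> : N y = N z by apply: eq_card => u; rewrite !inE (same_codes_eql u zy).
  rewrite mul1r mulrAC; congr (_ / _).
  apply: (mulIf (expf_neq0 (block_inv b y) q0)).
  by rewrite (block_symmetric_same vs zy) mulrAC mulfVK ?expf_neq0.
elim/big_rec: _ => // y w _ Ww; have [vy|vy] := eqVneq (v y) 0.
  by rewrite vy !mul0r scale0r add0r.
by apply: WL => //; apply: Wv.
Qed.

End SymmetricTensors.

(** * Generation of q-symmetric tensors by the quantum group *)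

Definition gap (c x : nat) : nat := ((c - x) + (x - c)) ^ 2.
Lemma gapE c x : Posz (gap c x) = ((c%:Z - x%:Z) ^+ 2)%R.
Proof.
have [cx|xc] := leqP c x; rewrite /gap.
  by rewrite (eqP cx) add0n -[RHS]sqrrN opprB subzn // -PoszM mulnn.
by rewrite (eqP (ltnW xc)) addn0 subzn 1?ltnW // -PoszM mulnn.
Qed.
(** Convexity of the square: when x grows by one, the gap to the larger number
    decreases by more, or increases by less. *)
Lemma gap_move c c' x : (c < c')%N ->
  (gap c x + gap c' x.+1 < gap c x.+1 + gap c' x)%N.
Proof.
move=> cc'; rewrite -ltz_nat !PoszD !gapE !intS -subr_gt0.
set D := (X in (0 < X)%R); have -> : D = ((c'%:Z - c%:Z) * 2)%R by rewrite /D; ring.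
lia.
Qed.
Lemma gap_closer c x : (x < c)%N -> (gap c x.+1 < gap c x)%N.
Proof.
move=> xc; have xc' := ltnW xc.
by rewrite /gap (eqP xc) (eqP xc') !addn0 ltn_exp2r //; lia.
Qed.
Lemma gap_farther c x : (c <= x)%N -> (gap c x < gap c x.+1)%N.
Proof.
move=> xc; have xc' := leqW xc.
by rewrite /gap (eqP xc) (eqP xc') !add0n ltn_exp2r // subSn.
Qed.

Section Generation.
Variables (C : numClosedFieldType) (q qh : C) (n p : nat).
Hypotheses (qhE : qh ^+ 2 = q) (q0 : q != 0).
Hypothesis q_order : forall k, (0 < k <= p)%N -> (q ^+ 2) ^+ k != 1.
Local Notation V := (tspace C n p).
Local Notation E := (endo V).
Implicit Types (y z : tidx n p) (v : V) (r : 'I_p.-1) (s t : 'I_p).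

Let qh0 : qh != 0.
Proof. by apply: contraNneq q0 => qh0; rewrite -qhE qh0 expr0n. Qed.

Definition uq_ops (g : E) : Prop :=
  exists x, g = uq_asg (k_op qh p) (kV_op qh p) (e_op qh p) (f_op qh p) x.

Variable b : tidx n p.
Hypothesis b_anti : forall r, (b (hi r) <= b (lo r))%N.
Local Notation bn := (fun s : 'I_p => nat_of_ord (b s)).

Definition reachable v :=
  exists2 u : E, gen_alg uq_ops u & (u : 'End(_)) (tbasis C b) = v.
Local Notation W := reachable.

Let W0 : W 0.
Proof. by exists 0; [apply: gen_alg0 | rewrite zero_lfunE]. Qed.

Let WL c v w : W v -> W w -> W (c *: v + w).
Proof.
move=> [f Uf <-] [g Ug <-]; exists (c *: f + g).
  by apply: gen_algD => //; apply: gen_algZ.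
by rewrite add_lfunE scale_lfunE.
Qed.

Let W_app (f : E) v : gen_alg uq_ops f -> W v -> W ((f : 'End(_)) v).
Proof.
move=> Uf [g Ug <-]; exists (f * g); first exact: gen_algM.
by rewrite endoM.
Qed.

Let geom_neq0 m : (0 < m <= p)%N -> \sum_(k < m) (q ^+ 2) ^+ k != 0.
Proof.
move=> mp; apply: contraNneq (q_order mp) => s0.
by rewrite -subr_eq0 subrX1 s0 mulr0.
Qed.

Definition letter_run y (r : 'I_p) : pred 'I_p := fun s => (b s == b r) && (y s == y r).

Section Row.
Variables (y : tidx n p) (r : 'I_p).
Hypothesis y_sorted : block_sorted bn y.

Local Notation R := (letter_run y r).

Let Rr : R r. Proof. by rewrite /letter_run !eqxx. Qed.

Let R_code s : R s = (code bn y s == code bn y r).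
Proof. by rewrite /code code_eq. Qed.

(* a run is an interval, since codes decrease along the positions *)
Let R_interval s t : R s -> ~~ R t -> ((t < s)%N = (t < r)%N) * ((s < t)%N = (r < t)%N).
Proof.
rewrite !R_code => /eqP sr tr.
have anti := code_antitone b_anti y_sorted.
have contra (u v : 'I_p) : (u <= t)%N -> (t <= v)%N -> code bn y u = code bn y r ->
    code bn y v = code bn y r -> False.
  move=> /anti ut /anti tv ur vr; case/negP: tr.
  by move: ut tv; rewrite eqn_leq ur vr => -> ->.
split; apply/idP/idP => h; rewrite ltnNge; apply/negP => h'.
- exact: contra h' (ltnW h) _ sr.
- exact: contra h' (ltnW h) sr _.
- exact: contra (ltnW h) h' sr _.
- exact: contra (ltnW h) h' _ sr.
Qed.

(** Outside the run, the factors on the left of s and those on the right of s do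
    not depend on the choice of s in the run. *)
Lemma site_wt_run a : exists2 c, c != 0 & forall s, R s ->
  site_wt qh a s y = c * (rt_wt qh a (y r) ^+ rank_below R s
                          / rt_wt qh a (y r) ^+ rank_above R s).
Proof.
pose w t := rt_wt qh a (y t).
have w0 t : w t != 0 by exact: rt_wt_neq0 qhE q0 _ _.
exists ((\prod_(t < p | (t < r)%N && ~~ R t) w t) /
        (\prod_(t < p | (r < t)%N && ~~ R t) w t)).
  by rewrite mulf_neq0 ?invr_eq0 //; apply/prodf_neq0 => t _.
move=> s Rs; rewrite /site_wt (bigID R) /= [X in _ / X](bigID R) /=.
have run (P : pred 'I_p) : \prod_(t < p | P t && R t) rt_wt qh a (y t) =
    w r ^+ #|[pred t | R t && P t]|.
  rewrite -prodr_const; apply: eq_big => [t|t /andP[_ /andP[_ /eqP ->]] //].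
  by rewrite inE andbC.
rewrite !run -/(w r) -/(rank_below R s) -/(rank_above R s).
rewrite (eq_bigl (fun t : 'I_p => (t < r)%N && ~~ R t)) => [|t]; last first.
  by case: (boolP (R t)) => //= Rt; rewrite ?andbF // (R_interval Rs Rt).1.
rewrite [in X in _ / X](eq_bigl (fun t : 'I_p => (r < t)%N && ~~ R t)) => [|t]; last first.
  by case: (boolP (R t)) => //= Rt; rewrite ?andbF // (R_interval Rs Rt).2.
by rewrite invfM mulrACA mulrC.
Qed.

Let y_anti s t : (s <= t)%N -> b s = b t -> (y t <= y s)%N.
Proof. by move=> st bst; apply: block_sorted_anti y_sorted st _ => //; rewrite /bn bst. Qed.

Let inv_sum s j (P : 'I_p -> 'I_p -> bool) : 
  (forall t u : 'I_p, (t < u)%N -> bn t = bn u -> (upd y s j t < upd y s j u)%N = P t u) ->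
  (forall t u : 'I_p, P t u -> (t < u)%N /\ bn t = bn u) ->
  block_inv bn (upd y s j) = (\sum_t \sum_u P t u)%N.
Proof.
move=> updP PP; apply: eq_bigr => t _; apply: eq_bigr => u _; congr nat_of_bool.
case: (ltnP t u) => /= [tu|ut]; last by apply/esym/negP => /PP[]; rewrite ltnNge ut.
by case: eqP => /= [/updP -> //|btu]; apply/esym/negP => /PP[].
Qed.

Lemma block_inv_raise s (j : 'I_n) : R s -> j = (y r).+1 :> nat ->
  block_inv bn (upd y s j) = rank_below R s.
Proof.
move=> Rs jE; have /andP[/eqP bs /eqP ys] := Rs.
rewrite (@inv_sum s j (fun t u => (u == s) && (R t && (t < u)%N))).
- rewrite exchange_big (bigD1 s) //= [X in (_ + X)%N]big1 ?addn0 => [|u us].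
    rewrite /rank_below -sum1_card [RHS]big_mkcond; apply: eq_bigr => t _.
    by rewrite eqxx inE /=; case: (R t && _).
  by rewrite (negPf us) big1.
- move=> t u tu btu; rewrite !updE.
  have [us|us] := eqVneq u s; have [ts|ts] := eqVneq t s.
  + by rewrite us ts ltnn in tu.
  + rewrite jE tu andbT /letter_run -bs -ys -us (val_inj btu) eqxx -val_eqE /=.
    by have := y_anti (ltnW tu) (val_inj btu); lia.
  + apply/negbTE; rewrite -leqNgt jE -ys -ts ltnW // ltnS.
    exact: y_anti (ltnW tu) (val_inj btu).
  + by apply/negbTE; rewrite -leqNgt; apply: y_anti (ltnW tu) (val_inj btu).
- by move=> t u /and3P[/eqP -> /andP[/eqP tr _] ts]; split=> //; rewrite /bn tr bs.
Qed.

Lemma block_inv_lower s (j : 'I_n) : R s -> j.+1 = y r :> nat ->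
  block_inv bn (upd y s j) = rank_above R s.
Proof.
move=> Rs jE; have /andP[/eqP bs /eqP ys] := Rs.
rewrite (@inv_sum s j (fun t u => (t == s) && (R u && (t < u)%N))).
- rewrite (bigD1 s) //= [X in (_ + X)%N]big1 ?addn0 => [|t ts].
    rewrite /rank_above -sum1_card [RHS]big_mkcond; apply: eq_bigr => u _.
    by rewrite eqxx inE /=; case: (R u && _).
  by rewrite (negPf ts) big1.
- move=> t u tu btu; rewrite !updE.
  have [ts|ts] := eqVneq t s; have [us|us] := eqVneq u s.
  + by rewrite us ts ltnn in tu.
  + rewrite tu andbT /letter_run -bs -ys -ts (val_inj btu) eqxx -val_eqE /=.
    by have := y_anti (ltnW tu) (val_inj btu); rewrite -ys -ts in jE; lia.
  + apply/negbTE; rewrite -leqNgt -ltnS jE -ys -us ltnW // ltnS.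
    exact: y_anti (ltnW tu) (val_inj btu).
  + by apply/negbTE; rewrite -leqNgt; apply: y_anti (ltnW tu) (val_inj btu).
- move=> t u /andP[/eqP -> /andP[/andP[/eqP ur _] su]].
  by split=> //; rewrite /bn bs ur.
Qed.

End Row.

Let wt_lo (a : 'I_n.-1) : rt_wt qh a (lo a) = qh.
Proof. by rewrite /rt_wt eqxx eq_sym (negPf (lo_neq_hi a)) expr1 expr0 divr1. Qed.
Let wt_hi (a : 'I_n.-1) : rt_wt qh a (hi a) = qh^-1.
Proof. by rewrite /rt_wt eqxx (negPf (lo_neq_hi a)) expr1 expr0 div1r. Qed.

(** The terms of the coefficient of a monomial under a raising or lowering
    operator form a progression of ratio q^2 along a run of equal letters, whence
    a quantum integer. The exponent [f] is the rank in the run, counted from the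
    left for the raising and from the right for the lowering operators. *)
Definition geometric_run y (r : 'I_p) (F : 'I_p -> C) := exists c (f : 'I_p -> nat),
  [/\ c != 0, {in letter_run y r &, injective f},
      forall s, letter_run y r s -> (f s < #|letter_run y r|)%N &
      forall s, letter_run y r s -> F s = c * (q ^+ 2) ^+ f s].

Lemma raise_geometric y (r : 'I_p) (a : 'I_n.-1) : block_sorted bn y -> y r = lo a ->
  geometric_run y r
    (fun s => site_wt qh a s y * q ^+ block_inv bn (upd y s (hi a))).
Proof.
move=> ys yr; have [c c0 wE] := site_wt_run r ys a.
exists (c / qh ^+ #|letter_run y r|.-1), (rank_below (letter_run y r)); split.
- by rewrite mulf_neq0 ?invr_eq0 ?expf_neq0.
- exact: rank_below_inj.
- by move=> s; apply: rank_below_lt.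
move=> s Rs; rewrite wE // (block_inv_raise ys Rs) ?yr // wt_lo.
rewrite -(rank_below_above Rs) /= -qhE exprD.
rewrite [_ ^+ 2 ^+ 2 ^+ _]exprAC ![_ ^+ 2 ^+ rank_below _ _]exprAC.
by field; rewrite !expf_neq0.
Qed.

Lemma lower_geometric y (r : 'I_p) (a : 'I_n.-1) : block_sorted bn y -> y r = hi a ->
  geometric_run y r
    (fun s => site_wt qh a s y * q ^+ block_inv bn (upd y s (lo a))).
Proof.
move=> ys yr; have [c c0 wE] := site_wt_run r ys a.
exists (c / qh ^+ #|letter_run y r|.-1), (rank_above (letter_run y r)); split.
- by rewrite mulf_neq0 ?invr_eq0 ?expf_neq0.
- exact: rank_above_inj.
- by move=> s; apply: rank_above_lt.
move=> s Rs; rewrite wE // (block_inv_lower ys Rs) ?yr // wt_hi.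
rewrite -(rank_below_above Rs) /= -qhE !exprVn exprD.
rewrite [_ ^+ 2 ^+ 2 ^+ _]exprAC ![_ ^+ 2 ^+ rank_above _ _]exprAC.
by field; rewrite !expf_neq0.
Qed.

(** Put y1 for y with the letter at r moved from i to j, and let the generator
    that moves letters from j to i act on the monomial of y1. The result is
    q-symmetric; its coefficient at y is a nonzero quantum integer up to a factor,
    and its other monomials z arise by moving back a letter of another block. *)
Lemma symm_basis_step a i j y (r : 'I_p) (X := move_op qh p a i j) :
    block_sorted bn y -> y r = i -> i != j ->
    gen_alg uq_ops X ->
    (forall k : 'I_p.-1, X * hecke_op q n k = hecke_op q n k * X) ->
    geometric_run y r (fun s => site_wt qh a s y * q ^+ block_inv bn (upd y s j)) ->
    W (symm_basis q bn (upd y r j)) ->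
    (forall z s, z s = i -> same_codes bn (upd z s j) (upd y r j) ->
       b s <> b r -> W (symm_basis q bn z)) ->
  W (symm_basis q bn y).
Proof.
move=> ysort yr ij UX XT [c [f [c0 finj flt fE]]] Wy1 Wz.
set y1 := upd y r j in Wy1 Wz; pose w := (X : 'End(_)) (symm_basis q bn y1).
have Ww : W w by apply: W_app.
have ws : block_symmetric q bn w.
  apply: block_symmetric_app => //; exact: symm_basis_symmetric.
have wy : w y != 0.
  have -> : w y = c * \sum_(m < #|letter_run y r|) (q ^+ 2) ^+ m.
    rewrite /w app_move -(sum_rank (fun m => (q ^+ 2) ^+ m) finj flt) mulr_sumr.
    rewrite [RHS]big_mkcond; apply: eq_bigr => s _; rewrite ffunE.
    have [ys|ys] := eqVneq (y s) i; last first.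
      by rewrite !mul0r /letter_run yr (negPf ys) andbF.
    rewrite mul1r /letter_run ys yr eqxx andbT.
    have [bsr|bsr] := eqVneq (b s) (b r); last first.
      have bsr' : bn s <> bn r by move/val_inj/eqP; rewrite (negPf bsr).
      by rewrite same_codesC (same_codes_upd_neq (b := bn) bsr' ij ys yr) mul0r mulr0.
    rewrite (_ : same_codes _ _ _) ?mul1r; last first.
      by rewrite same_codesC (same_codes_upd _ (i := i)) ?same_codes_refl // /bn bsr.
    by rewrite -fE // /letter_run bsr ys yr !eqxx.
  have Rr : (0 < #|letter_run y r|)%N.
    by apply/card_gt0P; exists r; rewrite /in_mem /= /letter_run !eqxx.
  rewrite mulf_neq0 // geom_neq0 // Rr /=.
  by rewrite -[p in (_ <= p)%N](card_ord p) max_card.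
have yy : symm_basis q bn y y = 1.
  by rewrite ffunE same_codes_refl block_inv_sorted // mul1r.
pose w' := - w y *: symm_basis q bn y + w.
have w's : block_symmetric q bn w'.
  apply: block_symmetric_lin => //; exact: symm_basis_symmetric.
have Ww' : W w'.
  apply: (block_symmetric_span q0 b_anti WL W0 _ w's) => z w'z.
  have yz : ~~ same_codes bn y z.
    apply: contraNN w'z => yz.
    have w'y : w' y = 0 by rewrite ffunE [(_ *: _ : V) y]ffunE yy /GRing.scale /= mulr1 addNr.
    have := block_symmetric_same b_anti w's yz; rewrite w'y mul0r => /esym/eqP.
    by rewrite mulf_eq0 (negPf (expf_neq0 _ q0)) orbF.
  have wz : w z != 0.
    move: w'z; rewrite ffunE [(_ *: _ : V) z]ffunE [symm_basis _ _ _ _]ffunE.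
    by rewrite (negPf yz) mul0r scaler0 add0r.
  have [s zs h] : exists2 s, z s = i & same_codes bn y1 (upd z s j).
    apply: contrapT => h; case/eqP: wz.
    rewrite /w app_move; apply: big1 => s _; rewrite ffunE.
    have [zs|] := eqVneq (z s) i; last by rewrite !mul0r.
    case same: (same_codes _ _ _); last by rewrite mul0r mulr0.
    by case: h; exists s.
  rewrite same_codesC in h; apply: (Wz z s zs h) => bsr.
  case/negP: yz; rewrite same_codesC.
  by rewrite -(same_codes_upd (i := i) (s := s) (t := r) j) // /bn bsr.
have -> : symm_basis q bn y = (w y)^-1 *: (w + (- 1) *: w').
  rewrite scaleN1r opprD addrCA subrr addr0 -scaleNr opprK scalerA.
  by rewrite mulVf // scale1r.
rewrite -[_ *: _]addr0; apply: WL => //; rewrite addrC; exact: WL.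
Qed.

Let deviation y : nat := \sum_s gap (b s) (y s).

Let deviation_same y z : same_codes bn y z -> deviation y = deviation z.
Proof.
move=> yz; pose g c := gap (c %/ n) (c %% n).
have codeE u : deviation u = (\sum_s g (code bn u s))%N.
  apply: eq_bigr => s _; have n0 : (0 < n)%N by apply: leq_ltn_trans (ltn_ord (u s)).
  by rewrite /g /code divnMDl // divn_small // addn0 modnMDl modn_small.
by rewrite !codeE; apply: (same_codes_sum g yz).
Qed.

Let deviation_upd y s j :
  (deviation (upd y s j) + gap (b s) (y s) = deviation y + gap (b s) j)%N.
Proof.
rewrite /deviation (bigD1 s) // [in RHS](bigD1 s) //= upd_same addnAC [RHS]addnAC.
congr (_ + _)%N; first by rewrite addnC.
by apply: eq_bigr => t ts; rewrite upd_diff.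
Qed.

Let deviation0 y : deviation y = 0%N -> y = b.
Proof.
move=> y0; apply/ffunP => s; apply/val_inj/eqP; rewrite /= eqn_leq.
have /eqP := y0; rewrite sum_nat_eq0 => /forallP/(_ s)/=.
by rewrite /gap expn_eq0 andbT addn_eq0 !subn_eq0 andbC.
Qed.

Let symm_basis_start : symm_basis q bn b = tbasis C b.
Proof.
have b0 : deviation b = 0%N by apply: big1 => s _; rewrite /gap subnn.
apply/ffunP => z; rewrite !ffunE; have [<-|bz] := eqVneq b z.
  by rewrite same_codes_refl block_inv_sorted //= mul1r.
rewrite -/bn; case zb: (same_codes bn b z); last by rewrite mul0r.
by case/eqP: bz; apply/esym/deviation0; rewrite -(deviation_same zb).
Qed.

Let uq_e a : gen_alg uq_ops (e_op qh p a).
Proof. by apply: gen_alg_in; exists (inr (inl a)). Qed.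
Let uq_f a : gen_alg uq_ops (f_op qh p a).
Proof. by apply: gen_alg_in; exists (inr (inr a)). Qed.

Let symm_basis_generated y : W (symm_basis q bn y).
Proof.
have [m] := ubnP (deviation y); elim: m y => // m IH y ym.
have [z [zs yz _]] := block_symmetric_sorted b_anti y (symm_basis_symmetric q0 (b := bn) y).
rewrite (symm_basis_same q yz); rewrite (deviation_same yz) in ym.
move: z zs ym {y yz} => y ys ym.
have IHy z : (deviation z < deviation y)%N -> W (symm_basis q bn z).
  by move=> zy; apply: IH; apply: leq_trans zy _.
have [->|yb] := eqVneq y b.
  by rewrite symm_basis_start; exists 1; [apply: gen_alg1 | rewrite endo1].
have moved z s (r : 'I_p) (j : 'I_n) : z s = y r ->
    same_codes bn (upd z s j) (upd y r j) ->
    (deviation z + gap (b s) j + gap (b r) (y r) =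
     deviation y + gap (b r) j + gap (b s) (y r))%N.
  move=> zsr /deviation_same; have := deviation_upd z s j; have := deviation_upd y r j.
  by rewrite zsr; lia.
have letter z s (r : 'I_p) (j : 'I_n) : same_codes bn (upd z s j) (upd y r j) ->
    b s <> b r -> exists2 t : 'I_p, b t = b s & y t = j.
  move=> same bsr; have : code bn (upd z s j) s \in codes bn (upd y r j).
    by rewrite -(perm_mem same) map_f ?mem_enum.
  case/mapP => t _; rewrite /code upd_same => /eqP; rewrite code_eq.
  case/andP => /eqP/val_inj bst; rewrite updE; case: (t =P r) => [tr|_ /eqP yt].
    by case: bsr; rewrite bst tr.
  by exists t.
have [/existsP[s0 s0P]|] := boolP [exists s, (y s < b s)%N].
  (* In the largest block with a letter below it, replace such a letter by its
     successor and let e_a lower it again. Another term of the result lowers a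
     letter of a smaller block, as the successors in larger blocks would be below
     their block; [gap_move] compares the deviations. *)
  case: (@arg_maxnP _ s0 (fun s => y s < b s)%N (fun s => b s) s0P) => r yr rmax.
  have an : (y r < n.-1)%N by have := ltn_ord (b r); lia.
  pose a := Ordinal an; have ya : y r = lo a by apply: val_inj.
  have haE : hi a = (y r).+1 :> nat by [].
  apply: (@symm_basis_step a (lo a) (hi a) y r) => //.
  - exact: lo_neq_hi.
  - by rewrite -e_op_move.
  - by move=> k; rewrite -e_op_move (e_op_hecke qhE).
  - exact: raise_geometric.
  - apply: IHy; have := deviation_upd y r (hi a); rewrite haE.
    by have := gap_closer yr; lia.
  - move=> z s zs same bsr; apply: IHy; have [t bt yt] := letter _ _ _ _ same bsr.
    rewrite -ya in zs; have := moved _ _ _ _ zs same.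
    have bs : (b s < b r)%N.
      rewrite ltn_neqAle; apply/andP; split.
        by apply/negP => /eqP/val_inj.
      rewrite leqNgt; apply/negP => lt_rs.
      have : (b t <= b r)%N by apply: rmax; rewrite bt yt haE (leq_ltn_trans yr).
      by rewrite bt leqNgt lt_rs.
    by rewrite haE; have := gap_move (y r) bs; lia.
(* The same with smallest and largest exchanged. *)
rewrite negb_exists => /forallP ge.
have [s0 s0P] : exists s, (b s < y s)%N.
  apply/existsP; apply: contraNT yb => /existsPn h; apply/eqP/ffunP => s.
  by apply/val_inj/eqP; rewrite eqn_leq /= leqNgt (h s) leqNgt (ge s).
case: (@arg_minnP _ s0 (fun s => b s < y s)%N (fun s => b s) s0P) => r yr rmin.
have an : ((y r).-1 < n.-1)%N by have := ltn_ord (y r); lia.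
pose a := Ordinal an; have ya : y r = hi a by apply: val_inj; rewrite /=; lia.
have laE : (lo a).+1 = y r :> nat by rewrite /=; lia.
apply: (@symm_basis_step a (hi a) (lo a) y r) => //.
- by rewrite eq_sym lo_neq_hi.
- by rewrite -f_op_move.
- by move=> k; rewrite -f_op_move (f_op_hecke qhE).
- exact: lower_geometric.
- apply: IHy; have := deviation_upd y r (lo a); rewrite -laE.
  by rewrite -laE ltnS in yr; have := gap_farther yr; lia.
- move=> z s zs same bsr; apply: IHy; have [t bt yt] := letter _ _ _ _ same bsr.
  rewrite -ya in zs; have := moved _ _ _ _ zs same.
  have bs : (b r < b s)%N.
    rewrite ltn_neqAle; apply/andP; split.
      by apply/negP => /eqP/val_inj/esym.
    rewrite leqNgt; apply/negP => lt_sr.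
    have : (b r <= b t)%N.
      by apply: rmin; rewrite bt yt (leq_trans lt_sr) // -ltnS laE.
    by rewrite bt leqNgt lt_sr.
  by rewrite -laE; have := gap_move (lo a) bs; lia.
Qed.

(** In particular any f commuting with the Hecke algebra agrees at e_b with an
    element of the quantum group. *)
Lemma symmetric_generated v : block_symmetric q bn v ->
  exists2 u : E, gen_alg uq_ops u & (u : 'End(_)) (tbasis C b) = v.
Proof.
move=> vs; apply: (block_symmetric_span q0 b_anti WL W0 _ vs) => y _.
exact: symm_basis_generated.
Qed.

End Generation.

(** * The commutant of the Hecke algebra *)

Section HeckeCommutant.
Variables (C : numClosedFieldType) (q qh : C) (n p : nat).
Hypotheses (qhE : qh ^+ 2 = q) (q0 : q != 0).
Hypothesis q_order : forall k, (0 < k <= p)%N -> (q ^+ 2) ^+ k != 1.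
Local Notation V := (tspace C n p).
Local Notation E := (endo V).
Local Notation uq_ops := (@uq_ops C qh n p).
Implicit Types (y z : tidx n p) (v : V) (r : 'I_p.-1) (s t : 'I_p).

Definition hecke_ops (g : E) : Prop := exists r, g = hecke_op q n r.

Lemma uq_hecke_comm f h : gen_alg uq_ops f -> gen_alg hecke_ops h -> f * h = h * f.
Proof.
move=> Uf; apply: gen_alg_comm => _ [r ->].
rewrite -(@gen_alg_comm _ _ uq_ops f (hecke_op q n r)) // => _ [[[i|i]|[a|a]] ->] /=.
- exact/esym/k_op_hecke.
- exact/esym/kV_op_hecke.
- exact/esym/(e_op_hecke qhE).
- exact/esym/(f_op_hecke qhE).
Qed.

Definition descending y := [forall r : 'I_p.-1, y (hi r) <= y (lo r)]%N.
Definition same_weight y z := same_codes (fun=> 0%N) y z.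

Lemma descendingP y : reflect (block_sorted (fun=> 0%N) y) (descending y).
Proof. by apply: (iffP forallP) => h r; [move=> _; apply: h | apply: h]. Qed.

Lemma descending_unique y z :
  descending y -> descending z -> same_weight y z -> y = z.
Proof. by move=> /descendingP ys /descendingP zs; apply: block_sorted_unique. Qed.

(** On a pair i > j, t sends e_i e_j to e_j e_i, so sorting is undone by t's. *)
Lemma hecke_sorted y : exists z h,
  [/\ descending z, same_weight y z, gen_alg hecke_ops h &
      (h : 'End(_)) (tbasis C z) = tbasis C y].
Proof.
elim/(@block_sort_ind n p (fun=> 0%N)): y => [y ys|r y _ yr [z [h [zs yz Hh hz]]]].
  exists y, 1; split; [exact/descendingP | exact: same_codes_refl
    | exact: gen_alg1 | exact: endo1].
exists z, (hecke_op q n r * h); split=> //.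
- by rewrite /same_weight (same_codes_eql z (swap_codes y _)) in yz.
- by apply: gen_algM => //; apply: gen_alg_in; exists r.
by rewrite endoM hz hecke_basis_desc ?swapK // swap_lo swap_hi.
Qed.

Let qh_pow_inj i j : (i <= p)%N -> (j <= p)%N -> qh ^+ i = qh ^+ j -> i = j.
Proof.
have qh0 : qh != 0.
  by apply: contraNneq q0 => qh0; rewrite -qhE qh0 expr0n.
wlog ij : i j / (i <= j)%N.
  move=> H ip jp E; have [le|/ltnW le] := leqP i j; first exact: H.
  by apply/esym; apply: H.
move=> ip jp; rewrite -(subnK ij) exprD -[LHS]mul1r => /(mulIf (expf_neq0 _ qh0)).
move=> /esym E; have [/eqP|k0] := posnP (j - i)%N.
  by rewrite subn_eq0 => ji; apply/eqP; rewrite subnK // eqn_leq ij.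
have := @q_order (j - i)%N; rewrite k0 (leq_trans (leq_subr _ _) jp) => /(_ isT).
by rewrite -qhE [_ ^+ 2 ^+ 2 ^+ _]exprAC [_ ^+ 2 ^+ (j - i)]exprAC E !expr1n eqxx.
Qed.

Definition count_letter (i : 'I_n) y : nat := #|[pred s | y s == i]|.

Let count_le i y : (count_letter i y <= p)%N.
Proof. by rewrite -[p in (_ <= p)%N](card_ord p) max_card. Qed.

Lemma same_weightP y z : same_weight y z <-> forall i, count_letter i y = count_letter i z.
Proof.
have cE i u : count_letter i u = (\sum_s (code (fun=> 0%N) u s == i))%N.
  rewrite /count_letter -sum1_card big_mkcond; apply: eq_bigr => s _.
  by rewrite /code mul0n inE val_eqE; case: eqP.
split=> [yz i|yz].
  by rewrite !cE; apply: (same_codes_sum (fun c => nat_of_bool (c == i)) yz).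
apply: same_codes_of_sums => c; have [cn|nc] := ltnP c n.
  by have := yz (Ordinal cn); rewrite !cE.
have big (u : tidx n p) : (\sum_s (code (fun=> 0%N) u s == c) = 0)%N.
  apply: big1 => s _; rewrite /code mul0n add0n.
  by case: eqP => // E; rewrite -E leqNgt ltn_ord in nc.
by rewrite !big.
Qed.

Let in_torus (c : tidx n p -> C) := gen_alg uq_ops (diag_op c).

Let torus_ext c c' : c =1 c' -> in_torus c -> in_torus c'.
Proof.
move=> cc'; rewrite /in_torus (_ : diag_op c' = diag_op c) //.
by apply: app_endo_ext => v y; rewrite !app_diag cc'.
Qed.

Let torus_const a : in_torus (fun=> a).
Proof.
rewrite /in_torus (_ : diag_op _ = a *: (1 : E)); first exact/gen_algZ/gen_alg1.
by apply: app_endo_ext => v y; rewrite app_diag scale_lfunE ffunE endo1.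
Qed.

Let torusD c c' : in_torus c -> in_torus c' -> in_torus (fun y => c y + c' y).
Proof.
move=> Tc Tc'; rewrite /in_torus (_ : diag_op _ = diag_op c + diag_op c').
  exact: gen_algD.
by apply: app_endo_ext => v y; rewrite app_diag add_lfunE ffunE !app_diag mulrDl.
Qed.

Let torusM c c' : in_torus c -> in_torus c' -> in_torus (fun y => c y * c' y).
Proof.
move=> Tc Tc'; rewrite /in_torus (_ : diag_op _ = diag_op c * diag_op c').
  exact: gen_algM.
by apply: app_endo_ext => v y; rewrite app_diag endoM !app_diag mulrA.
Qed.

Let torus_prod (I : Type) (l : seq I) (P : pred I) (F : I -> tidx n p -> C) :
  (forall i, in_torus (F i)) -> in_torus (fun y => \prod_(i <- l | P i) F i y).
Proof.
move=> TF; elim: l => [|i l IH].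
  by apply: (torus_ext _ (torus_const 1)) => y; rewrite big_nil.
case Pi: (P i); last by apply: (torus_ext _ IH) => y; rewrite big_cons Pi.
by apply: (torus_ext _ (torusM (TF i) IH)) => y; rewrite big_cons Pi.
Qed.

Let torus_k i : in_torus (fun y => qh ^+ count_letter i y).
Proof.
rewrite /in_torus /count_letter -(k_op_diag qh).
by apply: gen_alg_in; exists (inl (inl i)).
Qed.

(** Lagrange interpolation: the number of letters i determines the eigenvalue of
    q^(eps_i/2), and conversely as the powers of q^(1/2) up to the p-th are
    distinct. *)
Lemma weight_projection z :
  gen_alg uq_ops (diag_op (fun y => (same_weight z y)%:R)).
Proof.
pose F i (m : 'I_p.+1) y := (qh ^+ count_letter i y - qh ^+ m) /
                  (qh ^+ count_letter i z - qh ^+ m).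
have TF i m : in_torus (F i m).
  apply: torusM; last exact: torus_const.
  by apply: torusD; [exact: torus_k | exact: torus_const].
have T : in_torus (fun y => \prod_(i : 'I_n)
    \prod_(m : 'I_p.+1 | m != count_letter i z :> nat) F i m y).
  by apply: torus_prod => i; apply: torus_prod => m; apply: TF.
apply: (torus_ext _ T) => y.
case zy: (same_weight z y).
  move/same_weightP: zy => zy; apply: big1 => i _; apply: big1 => m mi.
  rewrite /F -zy divff // subr_eq0; apply: contraNneq mi => /qh_pow_inj E.
  by apply/eqP/esym/E; rewrite ?count_le // -ltnS.
have [i zyi] : exists i, count_letter i z != count_letter i y.
  apply: contrapT => /forallNP h; move/negP: zy; apply; apply/same_weightP => i.
  by apply/eqP/negPn/negP/h.
have ip : (count_letter i y < p.+1)%N by rewrite ltnS.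
rewrite (bigD1 i) //= (bigD1 (Ordinal ip)) /=; last by rewrite eq_sym.
by rewrite /F /= subrr !mul0r.
Qed.

(** The descending basis vector of a weight generates the weight space under the
    Hecke algebra; hence f is determined by its values there, which elements
    [u z] of the quantum group can imitate. *)
Lemma hecke_commutant f :
  (forall r, f * hecke_op q n r = hecke_op q n r * f) -> gen_alg uq_ops f.
Proof.
move=> fT.
have /boolp.choice[u uE] : forall z, exists u : E, descending z ->
    gen_alg uq_ops u /\ (u : 'End(_)) (tbasis C z) = (f : 'End(_)) (tbasis C z).
  move=> z; case: (boolP (descending z)) => [zs|_]; last by exists 0.
  have z_anti r : (z (hi r) <= z (lo r))%N by have /forallP := zs; apply.
  have sym : block_symmetric q (fun s => z s) ((f : 'End(_)) (tbasis C z)).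
    move=> r /val_inj zr; rewrite -endoM -fT endoM -linearZ; congr ((f : 'End(_)) _).
    by rewrite lin_ext_basis zr eqxx.
  by have [u Uu uz] := symmetric_generated qhE q0 q_order z_anti sym; exists u.
have fH h : gen_alg hecke_ops h -> f * h = h * f.
  by apply: gen_alg_comm => _ [r ->].
have -> : f = \sum_(z | descending z) u z * diag_op (fun y => (same_weight z y)%:R).
  apply: endoP => y; rewrite sum_lfunE.
  have [z [h [zs yz Hh <-]]] := hecke_sorted y.
  rewrite (bigD1 z) //= big1 ?addr0 => [|z' /andP[z's z'z]].
  - have [Uz uz] := uE z zs; rewrite -!endoM -mulrA.
    have -> : diag_op (fun y0 => (same_weight z y0)%:R) * h =
              h * diag_op (fun y0 => (same_weight z y0)%:R) :> E.
      exact: uq_hecke_comm (weight_projection z) Hh.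
    rewrite mulrA (uq_hecke_comm Uz Hh) fH // -mulrA !endoM; congr ((h : 'End(_)) _).
    rewrite -uz; congr ((u z : 'End(_)) _); apply/ffunP => x.
    rewrite app_diag ffunE; case: eqP => [<-|_]; last by rewrite mulr0.
    by rewrite /same_weight same_codes_refl mulr1.
  - have [Uz uz] := uE z' z's; rewrite -!endoM -mulrA.
    have -> : diag_op (fun y0 => (same_weight z' y0)%:R) * h =
              h * diag_op (fun y0 => (same_weight z' y0)%:R) :> E.
      exact: uq_hecke_comm (weight_projection z') Hh.
    rewrite mulrA endoM (_ : (diag_op _ : 'End(_)) _ = 0) ?linear0 //.
    apply/ffunP => x; rewrite app_diag !ffunE; case: eqP => [<-|_]; last by rewrite mulr0.
    case same: (same_weight z' z); last by rewrite mul0r.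
    by rewrite (descending_unique z's zs same) eqxx in z'z.
apply: gen_alg_sum => z zs; have [Uz _] := uE z zs.
by apply: gen_algM => //; apply: weight_projection.
Qed.

(** Without equal neighbouring letters every tensor counts as q-symmetric. *)
Lemma distinct_generated (x : tidx n p) :
    (forall r : 'I_p.-1, (x (hi r) < x (lo r))%N) ->
  forall v, exists2 u, gen_alg uq_ops u & (u : 'End(_)) (tbasis C x) = v.
Proof.
move=> xdec v; apply: (symmetric_generated qhE q0 q_order) => r.
  exact/ltnW.
by move=> E; have := xdec r; rewrite E ltnn.
Qed.

(** f e_x has the weight of e_x, and this weight space is H e_x. *)
Lemma uq_commutant_distinct (x : tidx n p) f :
    (forall r : 'I_p.-1, (x (hi r) < x (lo r))%N) ->
  (forall u, gen_alg uq_ops u -> f * u = u * f) -> gen_alg hecke_ops f.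
Proof.
move=> xdec fU; have xs : descending x by apply/forallP => r; apply: ltnW.
have [h Hh hx] : exists2 h, gen_alg hecke_ops h &
    (h : 'End(_)) (tbasis C x) = (f : 'End(_)) (tbasis C x).
  have /boolp.choice[h hE] : forall y, exists h : E, gen_alg hecke_ops h /\
      (same_weight x y -> (h : 'End(_)) (tbasis C x) = tbasis C y).
    move=> y; have [z [h [zs yz Hh hz]]] := hecke_sorted y.
    exists h; split=> // xy; rewrite (descending_unique xs zs) //.
    exact: same_codes_trans xy yz.
  exists (\sum_y coord x y f *: h y).
    by apply: gen_alg_sum => y _; apply/gen_algZ/(hE y).1.
  rewrite sum_lfunE [RHS]tspace_sum; apply: eq_bigr => y _.
  rewrite scale_lfunE; case xy: (same_weight x y).
    by rewrite (hE y).2 // xy.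
  suff f0 : (f : 'End(_)) (tbasis C x) y = 0 by rewrite /coord f0 !scale0r.
  have := fU _ (weight_projection x).
  move/(congr1 (coord x y)); rewrite /coord !endoM app_diag xy mul0r => <-.
  congr (_ _ y); congr ((f : 'End(_)) _); apply/ffunP => z.
  rewrite app_diag ffunE; case: eqP => [<-|_]; last by rewrite mulr0.
  by rewrite /same_weight same_codes_refl mulr1.
suff -> : f = h by [].
apply/lfunP => v; have [u Uu <-] := distinct_generated xdec v.
rewrite -[LHS]endoM fU // endoM -hx -endoM.
by rewrite (uq_hecke_comm Uu Hh) endoM.
Qed.

End HeckeCommutant.

(** * The weight function of the symmetrizing trace *)

Section Telescoping.
Variables (K : fieldType) (w : K) (p : nat) (B : nat -> nat) (z : nat -> bool) (t : nat).

(** Here [B l] stands for the number of letters below [l] in a word with one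
    letter missing, and [z l] says that [l] does not occur in it. Then
    [tele_term j] is the weight of the word completed by the letter [j], and
    [tele_left] a primitive of it. *)
Definition tele_left (j : nat) : K :=
  \prod_(l < p) (w ^+ (B l + t + (j <= l)) - (z l)%:R * w ^+ l).
Definition tele_term (j : nat) : K :=
  \prod_(l < p) (w ^+ (B l + t + (j < l)) - ((j != l :> nat) && z l)%:R * w ^+ l).

Lemma tele_step j : (j < p)%N ->
  tele_left j - tele_left j.+1 = (w - 1) * tele_term j.
Proof.
move=> jp; pose jo := Ordinal jp.
pose P := \prod_(l < p | l != jo) (w ^+ (B l + t + (j < l)) - (z l)%:R * w ^+ l).
have -> : tele_left j = (w ^+ (B j + t).+1 - (z j)%:R * w ^+ j) * P.
  rewrite /tele_left (bigD1 jo) //= leqnn addn1; congr (_ * _).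
  apply: eq_bigr => l lj; suff -> : (j <= l)%N = (j < l)%N by [].
  by rewrite -(inj_eq val_inj) /= eq_sym in lj; rewrite ltn_neqAle lj.
have -> : tele_left j.+1 = (w ^+ (B j + t) - (z j)%:R * w ^+ j) * P.
  by rewrite /tele_left (bigD1 jo) //= ltnn addn0.
have -> : tele_term j = w ^+ (B j + t) * P.
  rewrite /tele_term (bigD1 jo) //= ltnn eqxx mul0r subr0 addn0; congr (_ * _).
  apply: eq_bigr => l lj; suff -> : (j != l :> nat) by [].
  by rewrite -(inj_eq val_inj) /= eq_sym in lj.
by rewrite exprS; ring.
Qed.

Lemma tele_term_hit i : ~~ z i -> tele_term i = tele_left i.+1.
Proof.
by move=> zi; apply: eq_bigr => l _; case: eqP => [<-|//]; rewrite (negPf zi).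
Qed.

Lemma sum_tele_term j : (j <= p)%N ->
  (w - 1) * \sum_(l < p | (j <= l)%N) tele_term l = tele_left j - tele_left p.
Proof.
move=> jp; rewrite mulr_sumr.
have := big_geq_mkord j p xpredT (fun l => (w - 1) * tele_term l) => /= <-.
rewrite (telescope_sumr_eq (fun l => - tele_left l)) //; last first.
  by move=> k /andP[_ kp]; rewrite -tele_step // opprK addrC.
by rewrite opprK addrC.
Qed.

(** The sequence [B l + t] starts at or above the diagonal and ends below it, and
    it can only cross at a letter which does not occur; this gives a zero factor. *)
Lemma tele_left_end : (forall l, (B l + ~~ z l <= B l.+1)%N) -> (B p + t < p)%N ->
  tele_left p = 0.
Proof.
move=> Bz Bp; have [/existsP[l /andP[/eqP Bl zl]]|/existsPn h] :=
    boolP [exists l : 'I_p, (B l + t == l)%N && z l].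
  by rewrite /tele_left (bigD1 l) //= leqNgt ltn_ord addn0 Bl zl mul1r subrr mul0r.
have : forall l, (l <= p)%N -> (l <= B l + t)%N.
  elim=> // l IH lp; have := IH (ltnW lp); rewrite leq_eqVlt => /orP[/eqP E|].
    have := h (Ordinal lp); rewrite /= -E eqxx /= => zl.
    by have := Bz l; rewrite zl; lia.
  by have := Bz l; lia.
by move/(_ p (leqnn p)); rewrite leqNgt Bp.
Qed.

End Telescoping.

Section WeightFunction.
Variables (C : numClosedFieldType) (q : C) (p : nat).
Hypothesis q0 : q != 0.
Hypothesis q_order : forall k, (0 < k <= p)%N -> (q ^+ 2) ^+ k != 1.
Implicit Types (x y : tidx p p) (S : pred 'I_p) (r s : 'I_p).

Let w : C := q ^- 2.

(* Weights of words in which only the positions in S are filled *)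
Definition below S x (l : nat) : nat := #|[pred s | S s && (x s < l)%N]|.
Definition missed S x (l : nat) : bool := ~~ [exists s, S s && (x s == l :> nat)].
Definition partial_weight S t x : C :=
  \prod_(l < p) (w ^+ (below S x l + t) - (missed S x l)%:R * w ^+ l).
(** The Markov property [trace_weight_markov] says that the weight of x depends
    linearly on the monomial \prod_s z_(x s) modulo the relations
    z_i (q z_i + (q - q^-1) \sum_(j > i) z_j) = 0. In degree p these leave a space
    of dimension one, so the formula is forced up to a constant factor. *)
Definition trace_weight x : C := partial_weight predT 0 x.

Definition add_pos S r : pred 'I_p := fun s => (s == r) || S s.

Lemma below_upd S x r (j : 'I_p) l : ~~ S r ->
  below (add_pos S r) (upd x r j) l = (below S x l + (j < l))%N.
Proof.
move=> Sr; rewrite /below (cardD1 r) addnC; congr (_ + _)%N; last first.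
  by rewrite inE /= /add_pos eqxx upd_same.
apply: eq_card => s; rewrite !inE /add_pos.
by have [->|sr] := eqVneq s r; rewrite ?(negPf Sr) //= upd_diff.
Qed.

Lemma missed_upd S x r (j : 'I_p) l : ~~ S r ->
  missed (add_pos S r) (upd x r j) l = (j != l :> nat) && missed S x l.
Proof.
move=> Sr; rewrite /missed -negb_or; congr (~~ _).
apply/existsP/orP => [[s /andP[]]|[jl|/existsP[s /andP[Ss xs]]]].
- rewrite /add_pos; have [->|sr] := eqVneq s r; first by rewrite upd_same; left.
  by rewrite upd_diff //= => Ss xs; right; apply/existsP; exists s; rewrite Ss.
- by exists r; rewrite /add_pos eqxx upd_same.
- exists s; rewrite /add_pos Ss orbT upd_diff //.
  by apply: contraNneq Sr => <-.
Qed.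

Lemma partial_weight_upd S t x r (j : 'I_p) : ~~ S r ->
  partial_weight (add_pos S r) t (upd x r j) =
  tele_term w p (below S x) (missed S x) t j.
Proof.
move=> Sr; apply: eq_bigr => l _.
by rewrite below_upd // missed_upd // addnAC.
Qed.

Lemma partial_weight_tele S t x :
  partial_weight S t.+1 x = tele_left w p (below S x) (missed S x) t 0.
Proof. by apply: eq_bigr => l _; rewrite addn1 addnS. Qed.

Lemma tele_left_weight S t x : (#|S| + t < p)%N ->
  tele_left w p (below S x) (missed S x) t p = 0.
Proof.
move=> Sp; apply: tele_left_end => [l|].
  rewrite /missed negbK; case: existsP => [[s /andP[Ss /eqP xs]]|_] /=; last first.
    rewrite addn0; apply: subset_leq_card; apply/fintype.subsetP => s.
    by rewrite !inE => /andP[-> /ltnW].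
  rewrite addn1; apply/proper_card/properP; split.
    by apply/fintype.subsetP => u; rewrite !inE => /andP[-> /ltnW].
  by exists s; rewrite !inE Ss xs ?ltnS ?leqnn ?ltnn.
rewrite (_ : below S x p = #|S|) //; apply: eq_card => s.
by rewrite !inE ltn_ord andbT.
Qed.

Let wE : q - q^-1 = - q * (w - 1).
Proof. by rewrite /w; field. Qed.

(** The coefficients are the diagonal entries of t at e_i e_j. The sum over j > i
    telescopes, and as i occurs elsewhere in x its value is a multiple of the
    term j = i. *)
Lemma trace_weight_markov x r (i : 'I_p) : (exists2 s, s != r & x s = i) ->
  \sum_(j : 'I_p) (if i == j then q else if (j < i)%N then 0 else q - q^-1) *
    trace_weight (upd x r j) = 0.
Proof.
move=> [s0 s0r xs0]; pose S : pred 'I_p := predC1 r.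
have Sr : ~~ S r by rewrite /S /= eqxx.
have Scard : (#|S| + 0 < p)%N.
  have := cardC1 r; rewrite card_ord -/S addn0 => ->.
  by rewrite prednK // (leq_ltn_trans _ (ltn_ord r)).
have all j : trace_weight (upd x r j) = tele_term w p (below S x) (missed S x) 0 j.
  rewrite -(partial_weight_upd _ _ _ Sr); apply: eq_bigr => l _.
  have addE s : add_pos S r s by rewrite /add_pos /S /= orbN.
  rewrite /below /missed; congr (_ ^+ (_ + _) - (~~ _)%:R * _).
    by apply: eq_card => s; rewrite !inE addE.
  by apply: eq_existsb => s; rewrite addE.
under eq_bigr => j _ do rewrite all.
have hit : ~~ missed S x i.
  by rewrite /missed negbK; apply/existsP; exists s0; rewrite /S /= s0r xs0 eqxx.
have := sum_tele_term w (below S x) (missed S x) 0 (ltn_ord i).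
rewrite tele_left_weight // subr0 -tele_term_hit // => E.
rewrite (bigD1 i) //= eqxx -[in X in X + _]E mulrA wE.
set T := \sum_(l < p | (i < l)%N) _.
rewrite (_ : \sum_(j | j != i) _ = - q * (w - 1) * T); first by ring.
rewrite /T mulr_sumr big_mkcond [RHS]big_mkcond; apply: eq_bigr => j _.
rewrite -!val_eqE /= eq_sym; case: ltngtP => //= _; by rewrite mul0r.
Qed.

Let w_neq1 k : (0 < k <= p)%N -> w ^+ k != 1.
Proof.
by move=> kp; rewrite /w exprVn invr_eq1 q_order.
Qed.

(** Replaces a summation over words by one over a single letter. *)
Lemma sum_upd n' (r : 'I_p) (F : tidx n' p -> C) :
  \sum_x \sum_(j : 'I_n') F (upd x r j) = n'%:R * \sum_x F x.
Proof.
rewrite pair_bigA /=; pose h (u : tidx n' p * 'I_n') := (upd u.1 r u.2, u.1 r).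
have hK : involutive h.
  by move=> [x j]; rewrite /h /= upd_same upd_upd upd_id.
rewrite (reindex_inj (inv_inj hK)) /= /h /=.
under eq_bigr => u _ do rewrite upd_upd upd_id.
rewrite -(pair_bigA _ (fun (x : tidx n' p) (j : 'I_n') => F x)) /= mulr_sumr; apply: eq_bigr => x _.
by rewrite sumr_const card_ord mulr_natl.
Qed.

(** Filling the positions one at a time, each step telescopes and contributes a
    factor (w - 1)^-1; what remains at the end is the product of the w^p - w^l.
    So up to a power of q this is the quantum factorial of p. *)
Lemma trace_weight_total : \sum_x trace_weight x != 0.
Proof.
pose S (k : nat) : pred 'I_p := fun s => (s < k)%N.
pose G (k : nat) := \sum_x partial_weight (S k) (p - k) x.
have w0 : w != 0 by rewrite invr_eq0 expf_neq0.
have Gp : \sum_x trace_weight x = G p.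
  rewrite /G subnn; apply: eq_bigr => x _; apply: eq_bigr => l _.
  rewrite /below /missed; congr (_ ^+ (_ + _) - (~~ _)%:R * _).
    by apply: eq_card => s; rewrite !inE /S ltn_ord.
  by apply: eq_existsb => s; rewrite /S ltn_ord.
have G0 : G 0%N != 0.
  have -> : G 0%N = (\prod_(l < p) (w ^+ p - w ^+ l)) *+ #|{: tidx p p}|.
    rewrite -sumr_const /G subn0; apply: eq_bigr => x _; apply: eq_bigr => l _.
    rewrite (_ : below _ _ _ = 0%N); last by apply: eq_card0 => s; rewrite !inE.
    by rewrite (_ : missed _ _ _) ?mul1r //; apply/existsPn.
  rewrite mulrn_eq0 negb_or -lt0n; apply/andP; split.
    by apply/card_gt0P; exists [ffun s => s].
  apply/prodf_neq0 => l _.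
  have -> : w ^+ p - w ^+ l = w ^+ l * (w ^+ (p - l) - 1).
    by rewrite mulrBr mulr1 -exprD subnKC // ltnW.
  by rewrite mulf_neq0 ?expf_neq0 // subr_eq0 w_neq1 // subn_gt0 ltn_ord leq_subr.
have step k (kp : (k < p)%N) : (w - 1) * (p%:R * G k.+1) = G k.
  pose r := Ordinal kp; have Sr : ~~ S k r by rewrite /S ltnn.
  have SS : S k.+1 =1 add_pos (S k) r.
    by move=> s; rewrite /S /add_pos ltnS leq_eqVlt -val_eqE.
  rewrite -(sum_upd r) mulr_sumr; apply: eq_bigr => x _.
  rewrite (_ : (p - k = (p - k.+1).+1)%N); last by lia.
  rewrite partial_weight_tele.
  have /(tele_left_weight (S := S k) x) end0 : (#|S k| + (p - k.+1) < p)%N.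
    have : (#|S k| <= k)%N.
      rewrite -[k in (_ <= k)%N](card_ord k).
      have inj : injective (widen_ord (ltnW kp)).
        by move=> i j E; apply: val_inj; exact: (congr1 val E).
      rewrite -(card_codom inj); apply: subset_leq_card.
      apply/fintype.subsetP => s sk; apply/codomP.
      by exists (Ordinal (sk : (s < k)%N)); apply: val_inj.
    by lia.
  rewrite -[RHS]subr0 -[X in _ = _ - X]end0 -sum_tele_term //; congr (_ * _); apply: eq_big => [//|j _].
  rewrite -(partial_weight_upd _ _ _ Sr); apply: eq_bigr => l _.
  rewrite /below /missed; congr (_ ^+ (_ + _) - (~~ _)%:R * _).
    by apply: eq_card => s; rewrite !inE SS.
  by apply: eq_existsb => s; rewrite SS.
rewrite Gp; elim: {-2}p (leqnn p) => // k IH kp.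
have := IH (ltnW kp); apply: contraNneq => Gk.
by rewrite -step // Gk !mulr0.
Qed.

End WeightFunction.

(** * The chain of Hecke algebras *)

Section HeckeFiltration.
Variables (C : numClosedFieldType) (q : C) (n p : nat).
Hypothesis q0 : q != 0.
Local Notation V := (tspace C n p).
Local Notation E := (endo V).
Local Notation T r := (hecke_op q n r).
Implicit Types (x y z : tidx n p) (r s : 'I_p.-1) (a b f g h : E).

Definition hecke_below (k : nat) : E -> Prop :=
  gen_alg (fun g => exists2 r : 'I_p.-1, (r < k)%N & g = T r).

Lemma hecke_below_mono k l f : (k <= l)%N -> hecke_below k f -> hecke_below l f.
Proof.
move=> kl; apply: gen_alg_sub => _ [r rk ->].
by apply: gen_alg_in; exists r => //; apply: leq_trans kl.
Qed.

Lemma hecke_below_gen k r : (r < k)%N -> hecke_below k (T r).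
Proof. by move=> rk; apply: gen_alg_in; exists r. Qed.

Lemma hecke_below_all f : gen_alg (@hecke_ops C q n p) f -> hecke_below p.-1 f.
Proof.
by apply: gen_alg_sub => _ [r ->]; apply: hecke_below_gen.
Qed.

Lemma hecke_quad_eq r : T r * T r = (q - q^-1) *: T r + 1.
Proof.
have := @hecke_op_quad C q n p r q0; rewrite /= mulrDr mulrDl -endo_scaleAr mulr1.
rewrite mulNr -endo_scaleAl mul1r scalerDr scalerN scalerA mulVf // scale1r => H.
apply: coordP => x y; apply/eqP; rewrite -subr_eq0.
have := congr1 (coord x y) H; rewrite !coordE => <-.
by apply/eqP; ring.
Qed.

Lemma hecke_far_eq r s : (r.+1 < s)%N -> T r * T s = T s * T r.
Proof.
by move=> rs; apply/eqP; rewrite -subr_eq0; apply/eqP/hecke_op_far; rewrite rs.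
Qed.

Lemma hecke_braid_eq r s : s = r.+1 :> nat -> T r * T s * T r = T s * T r * T s.
Proof.
by move=> rs; apply/eqP; rewrite -subr_eq0; apply/eqP/hecke_op_braid.
Qed.

(* Membership in the span of H_r and H_r t_r H_r *)
Definition spanned r h := forall P : E -> Prop,
  (forall f g, P f -> P g -> P (f + g)) -> (forall c f, P f -> P (c *: f)) ->
  (forall f, hecke_below r f -> P f) ->
  (forall a b, hecke_below r a -> hecke_below r b -> P (a * T r * b)) -> P h.

(** In a product t_r b t_r with b in H_r, induction reduces to two cases: either b
    commutes with t_r and t_r^2 is expanded, or b contains t_(r-1) once and the
    braid relation applies. *)
Lemma hecke_below_spanned r h : hecke_below r.+1 h -> spanned r h.
Proof.
have [k] := ubnP r; elim: k r h => // k IH r h rk.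
have sD r' f g : spanned r' f -> spanned r' g -> spanned r' (f + g).
  by move=> sf sg P PD PZ P1 P2; apply: (PD); [exact: (sf P PD PZ P1 P2) | exact: (sg P PD PZ P1 P2)].
have sZ r' c f : spanned r' f -> spanned r' (c *: f).
  by move=> sf P PD PZ P1 P2; apply: (PZ); exact: (sf P PD PZ P1 P2).
have s1 f : hecke_below r f -> spanned r f by move=> Hf P _ _ P1 _; apply: P1.
have s2 a b : hecke_below r a -> hecke_below r b -> spanned r (a * T r * b).
  by move=> Ha Hb P _ _ _ P2; apply: P2.
have s3 a b : hecke_below r a -> hecke_below r b -> spanned r (a * T r * b * T r).

  move=> Ha Hb.
  have quad g : hecke_below r g -> g * T r = T r * g -> spanned r (a * T r * g * T r).
    move=> Hg gT; rewrite -mulrA gT !mulrA -[a * T r * T r]mulrA hecke_quad_eq.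
    rewrite mulrDr mulr1 mulrDl -endo_scaleAr -endo_scaleAl.
    apply: sD; first by apply: sZ; apply: s2.
    by apply: s1; apply: gen_algM.
  have [r0|r0] := posnP r.
    apply: (quad b Hb); apply/esym; move: (T r) Hb => Tr; apply: gen_alg_comm.
    by move=> g [s]; rewrite r0.
  have sp : (r.-1 < p.-1)%N by rewrite (leq_ltn_trans (leq_pred _) (ltn_ord r)).
  pose s := Ordinal sp; have rs : r = s.+1 :> nat by rewrite /= prednK.
  have Hs f : hecke_below s f -> hecke_below r f.
    by apply: hecke_below_mono; rewrite rs.
  have sT f : hecke_below s f -> f * T r = T r * f.
    move=> Hf; apply/esym; apply: gen_alg_comm Hf => _ [u us ->].
    by apply/esym/hecke_far_eq; rewrite rs ltnS.
  have : spanned s b by apply: IH; [rewrite -ltnS -rs | rewrite -rs].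
  move/(_ (fun b => spanned r (a * T r * b * T r))); apply.
  - by move=> f g sf sg; rewrite mulrDr mulrDl; apply: sD.
  - by move=> c f sf; rewrite -endo_scaleAr -endo_scaleAl; apply: sZ.
  - by move=> f Hf; apply: quad; [exact: Hs | exact: sT].
  move=> b1 b2 Hb1 Hb2.
  have -> : a * T r * (b1 * T s * b2) * T r = (a * b1 * T s) * T r * (T s * b2).
    rewrite !mulrA -[_ * b2 * T r]mulrA (sT b2 Hb2) -[a * T r * b1]mulrA.
    rewrite -(sT b1 Hb1) !mulrA.
    have br f : f * T r * T s * T r = f * T s * T r * T s.
      by rewrite -!mulrA; congr (f * _); rewrite !mulrA (hecke_braid_eq rs).
    by rewrite br.
  have HTs : hecke_below r (T s) by apply: hecke_below_gen; rewrite rs.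
  apply: s2; last by apply: gen_algM => //; apply: Hs.
  by apply: gen_algM => //; apply: gen_algM => //; apply: Hs.
apply: (@gen_alg_word _ _ _ (spanned r)).
- by apply: s1; apply: gen_alg1.
- exact: sD.
- exact: sZ.
move=> f _ sf [s sr ->]; have [E|sr'] := eqVneq s r; last first.
  have HT : hecke_below r (T s).
    by apply: hecke_below_gen; rewrite ltn_neqAle -ltnS sr andbT.
  apply: (sf (fun f => spanned r (f * T s))).
  - by move=> g g' sg sg'; rewrite mulrDl; apply: sD.
  - by move=> c g sg; rewrite -endo_scaleAl; apply: sZ.
  - by move=> g Hg; apply: s1; apply: gen_algM.
  - by move=> a b Ha Hb; rewrite -mulrA; apply: s2 => //; apply: gen_algM.
rewrite E; apply: (sf (fun f => spanned r (f * T r))).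
- by move=> g g' sg sg'; rewrite mulrDl; apply: sD.
- by move=> c g sg; rewrite -endo_scaleAl; apply: sZ.
- by move=> g Hg; rewrite -[_ * _]mulr1; apply: s2 => //; apply: gen_alg1.
- by move=> a b Ha Hb; apply: s3.
Qed.

Definition site_unit (s : 'I_p) (i j : 'I_n) : E :=
  lin_ext (fun x => (x s == j)%:R *: tbasis C (upd x s i)).

Lemma site_unit_hecke (s : 'I_p) i j r : s != lo r -> s != hi r ->
  site_unit s i j * T r = T r * site_unit s i j.
Proof.
move=> sl sh; apply: endoP => x; rewrite !endoM.
have swE : swap r (upd x s i) = upd (swap r x) s i.
  apply/ffunP => t; rewrite !(ffunE, updE).
  case: tpermP => [->|->|//].
    by rewrite ![_ == s]eq_sym (negPf sl) (negPf sh).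
  by rewrite ![_ == s]eq_sym (negPf sl) (negPf sh).
have lE : upd x s i (lo r) = x (lo r) by rewrite upd_diff // eq_sym.
have hE : upd x s i (hi r) = x (hi r) by rewrite upd_diff // eq_sym.
have sE : swap r x s = x s by rewrite swapD.
rewrite [(site_unit s i j : 'End(_)) (tbasis C x)]lin_ext_basis linearZ /=.
rewrite !lin_ext_basis lE hE swE.
case: ifP => _; first by rewrite linearZ /= lin_ext_basis !scalerA mulrC.
case: ifP => _; first by rewrite lin_ext_basis sE.
by rewrite linearD linearZ /= !lin_ext_basis sE scalerDr !scalerA [_ * (q - _)]mulrC.
Qed.

(** An element of H_r acts on the sites up to r only. This is expressed by
    commutation with matrix units, which is stable under products; the next
    lemmas extract that such an element fixes the letters further right and that
    its coefficients do not depend on them. *)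
Lemma hecke_below_site r g (s : 'I_p) i j : hecke_below r g -> (r < s)%N ->
  site_unit s i j * g = g * site_unit s i j.
Proof.
move=> Hg rs; apply: gen_alg_comm Hg => _ [t tr ->].
by apply: site_unit_hecke; rewrite -val_eqE /=; move: tr rs; clear; lia.
Qed.

Lemma app_site_unit (s : 'I_p) i j v y :
  (site_unit s i j : 'End(_)) v y = (y s == i)%:R * v (upd y s j).
Proof.
rewrite lin_extE sum_ffunE (bigD1 (upd y s j)) //= big1 ?addr0 => [|x xy].
  rewrite upd_same eqxx scale1r upd_upd ffunE [tbasis _ _ _]ffunE.
  rewrite /GRing.scale /= mulrC; suff -> : (upd y s i == y) = (y s == i) by [].
  apply/eqP/eqP => [<-|<-]; [exact: upd_same | exact: upd_id].
rewrite ffunE; have [xs|] := eqVneq (x s) j; last by rewrite scale0r ffunE scaler0.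
rewrite scale1r ffunE; have [E|_] := eqVneq (upd x s i) y; last by rewrite scaler0.
by case/eqP: xy; rewrite -E upd_upd -xs upd_id.
Qed.

Lemma coord_site_unit f (s : 'I_p) i j x y :
    site_unit s i j * f = f * site_unit s i j ->
  (x s == j)%:R * coord (upd x s i) y f = (y s == i)%:R * coord x (upd y s j) f.
Proof.
move/(congr1 (coord x y)); rewrite /coord !endoM app_site_unit => ->.
by rewrite lin_ext_basis linearZ ffunE.
Qed.

Lemma hecke_below_fix r g (s : 'I_p) x y : hecke_below r g -> (r < s)%N ->
  x s != y s -> coord x y g = 0.
Proof.
move=> Hg rs xy; have := coord_site_unit x y (hecke_below_site (x s) (x s) Hg rs).
by rewrite eqxx mul1r upd_id [y s == _]eq_sym (negPf xy) mul0r.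
Qed.

Lemma hecke_below_diag r g (s : 'I_p) x i : hecke_below r g -> (r < s)%N ->
  coord (upd x s i) (upd x s i) g = coord x x g.
Proof.
move=> Hg rs.
have := coord_site_unit x (upd x s i) (hecke_below_site i (x s) Hg rs).
by rewrite eqxx upd_same eqxx !mul1r upd_upd upd_id.
Qed.

End HeckeFiltration.

(** * The symmetrizing trace *)

Section TraceForm.
Variables (C : numClosedFieldType) (q qh : C) (p : nat).
Hypotheses (qhE : qh ^+ 2 = q) (q0 : q != 0).
Hypothesis q_order : forall k, (0 < k <= p)%N -> (q ^+ 2) ^+ k != 1.
Local Notation V := (tspace C p p).
Local Notation E := (endo V).
Local Notation T r := (hecke_op q p r).
Local Notation hecke_ops := (@hecke_ops C q p p).
Local Notation A := (gen_alg hecke_ops).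
Local Notation c := (@trace_weight C q p).
Implicit Types (x y z : tidx p p) (r s : 'I_p.-1) (a b f g h : E).

(** The trace over V^(x)p twisted by the weight function. As the weight does not
    depend on the order of the letters, this is a linear combination of
    characters of the Hecke algebra. *)
Definition twisted_trace f : C := \sum_x c x * coord x x f.

Fact twisted_trace_linear : linear_for *%R twisted_trace.
Proof.
move=> k f g; rewrite /twisted_trace mulr_sumr -big_split; apply: eq_bigr => x _.
by rewrite /= !coordE mulrDr mulrCA.
Qed.
HB.instance Definition _ :=
  GRing.isLinear.Build C E C *%R twisted_trace twisted_trace_linear.

Lemma trace_weight_swap x r : c (swap r x) = c x.
Proof.
rewrite /trace_weight /partial_weight; apply: eq_bigr => l _.
have -> : below predT (swap r x) l = below predT x l.
  rewrite /below -!sum1_card (reindex_inj (@perm_inj _ (tperm (lo r) (hi r)))) /=.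
  by apply: eq_bigl => s; rewrite !inE ffunE tpermK.
suff -> : missed predT (swap r x) l = missed predT x l by [].
rewrite /missed; congr (~~ _); apply/existsP/existsP => -[s xs].
  by exists (tperm (lo r) (hi r) s); move: xs; rewrite ffunE.
by exists (tperm (lo r) (hi r) s); rewrite ffunE tpermK.
Qed.

Lemma hecke_trace_weight f x y : A f -> c x * coord x y f = c y * coord x y f.
Proof.
move=> Af; have : diag_op c * f = f * diag_op c.
  by apply: gen_alg_comm Af => _ [r ->]; apply: diag_hecke => z; apply: trace_weight_swap.
move/(congr1 (coord x y)); rewrite /coord !endoM app_diag => ->.
have -> : (diag_op c : 'End(_)) (tbasis C x) = c x *: tbasis C x by exact: lin_ext_basis.
by rewrite linearZ ffunE.
Qed.

Lemma twisted_traceC f g : A f -> twisted_trace (f * g) = twisted_trace (g * f).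
Proof.
move=> Af; rewrite /twisted_trace.
under eq_bigr => x _ do rewrite coordM mulr_sumr.
under [RHS]eq_bigr => x _ do rewrite coordM mulr_sumr.
rewrite exchange_big; apply: eq_bigr => y _; apply: eq_bigr => x _ /=.
by rewrite mulrCA -(hecke_trace_weight y x Af) mulrC -mulrA.
Qed.

(** Up to the off-diagonal part of t_r, which does not contribute as g fixes the
    letter at the site after r, the sum over this letter is that of
    [trace_weight_markov]. *)
Lemma twisted_trace_markov r g : hecke_below q r g -> twisted_trace (g * T r) = 0.
Proof.
move=> Hg; have rh : (r < hi r)%N by [].
pose th (i j : 'I_p) := if i == j then q else if (j < i)%N then 0 else q - q^-1.
have E : twisted_trace (g * T r) = \sum_x c x * (th (x (lo r)) (x (hi r)) * coord x x g).
  apply: eq_bigr => x _; rewrite coord_hecke_op /th; congr (_ * _).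
  have [//|xlh] := eqVneq (x (lo r)) (x (hi r)).
  rewrite (hecke_below_fix Hg rh) ?swap_hi // add0r.
  by case: ifP => _ //; rewrite mul0r.
have p0 : p%:R != 0 :> C by rewrite pnatr_eq0 -lt0n (leq_ltn_trans _ (ltn_ord (hi r))).
apply: (mulfI p0); rewrite mulr0 E -(sum_upd (hi r)); apply: big1 => x _.
have lE j : upd x (hi r) j (lo r) = x (lo r) by rewrite upd_diff // lo_neq_hi.
under eq_bigr => j _ do rewrite (hecke_below_diag x j Hg rh) lE upd_same mulrA.
rewrite -mulr_suml (_ : \sum_j _ = 0) ?mul0r //.
under eq_bigr => j _ do rewrite mulrC.
rewrite -[RHS](trace_weight_markov q0 (x := x) (r := hi r) (i := x (lo r))) //.
by exists (lo r) => //; apply: lo_neq_hi.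
Qed.

Definition reversed_letters : tidx p p := [ffun s => rev_ord s].
Local Notation x0 := reversed_letters.

Let x0_dec r : (x0 (hi r) < x0 (lo r))%N.
Proof. by rewrite !ffunE /=; have := ltn_ord r; lia. Qed.

Lemma hecke_same_weight f x y : A f -> coord x y f != 0 -> same_weight x y.
Proof.
move=> Af; apply: contraNT => xy.
have := uq_hecke_comm qhE q0 (weight_projection qhE q0 q_order x) Af.
move/(congr1 (coord x y)); rewrite /coord !endoM app_diag (negPf xy) mul0r.
rewrite [(diag_op _ : 'End(_)) _]lin_ext_basis linearZ ffunE /same_weight.
by rewrite same_codes_refl /GRing.scale /= mul1r => <-.
Qed.

(** On the words that occur in b e_x the letter at the site after r is smaller
    than the one before it, so t_r exchanges them without a diagonal term; then a
    cannot restore the letter at the site after r. *)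
Lemma coord_x0_markov r a b : hecke_below q r a -> hecke_below q r b ->
  coord x0 x0 (a * T r * b) = 0.
Proof.
move=> Ha Hb; rewrite coordM big1 // => z _.
have Ab : A b by apply: gen_alg_sub Hb => _ [s _ ->]; apply: gen_alg_in; exists s.
have [->|bz] := eqVneq (coord x0 z b) 0; first by rewrite mul0r.
have zfix (s : 'I_p) : (r < s)%N -> z s = x0 s.
  by move=> rs; apply/esym/eqP; apply: contraNT bz => zs; rewrite (hecke_below_fix Hb rs).
have zhi := zfix (hi r) (ltnSn r).
have zlo : (z (hi r) < z (lo r))%N.
  rewrite ltnNge; apply/negP => le.
  pose s := rev_ord (z (lo r)).
  have x0s : x0 s = z (lo r) by rewrite ffunE rev_ordK.
  have rs : (r < s)%N.
    by move: le; rewrite zhi ffunE /=; have := ltn_ord r; have := ltn_ord (z (lo r)); lia.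
  have zs : z s = z (lo r) by rewrite zfix.
  have /same_weightP/(_ (z (lo r))) := hecke_same_weight Ab bz.
  rewrite /count_letter (_ : #|[pred t | x0 t == z (lo r)]| = 1%N); last first.
    apply: (@eq_card1 _ s) => t; rewrite !inE -x0s !ffunE.
    by rewrite (inj_eq rev_ord_inj).
  rewrite (cardD1 s) (cardD1 (lo r)) !inE zs eqxx /=.
  by rewrite andbT -val_eqE /= (ltn_eqF rs).
rewrite coord_hecke_op zlo; case: eqP => [E|_]; first by rewrite E ltnn in zlo.
rewrite (hecke_below_fix Ha (ltnSn r : r < hi r)%N) ?mulr0 // swap_hi.
by rewrite -zhi -val_eqE /= gtn_eqF.
Qed.

Local Notation kappa := (\sum_x c x).

(** Both sides vanish on H_r t_r H_r and agree at 1. *)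
Lemma twisted_trace_coord f : A f -> twisted_trace f = kappa * coord x0 x0 f.
Proof.
suff H k g : (k <= p.-1)%N -> hecke_below q k g ->
    twisted_trace g = kappa * coord x0 x0 g.
  by move/hecke_below_all; apply: H.
elim: k g => [|k IH] {f}f kp Hf.
  elim/gen_alg_word: Hf => {f} [|f g Ef Eg|a f Ef|f g _ [s]] //.
  - rewrite coord1 eqxx mulr1; apply: eq_bigr => x _.
    by rewrite coord1 eqxx mulr1.
  - by rewrite linearD /= Ef Eg coordD mulrDr.
  - by rewrite linearZ /= Ef coordZ mulrCA.
pose r : 'I_p.-1 := Ordinal kp.
apply: (@hecke_below_spanned C q p p q0 r f Hf
  (fun f => twisted_trace f = kappa * coord x0 x0 f)).
- by move=> g h Eg Eh; rewrite linearD /= Eg Eh coordD mulrDr.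
- by move=> a g Eg; rewrite linearZ /= Eg coordZ mulrCA.
- by move=> g; apply: IH; apply: ltnW.
move=> a b Ha Hb; rewrite (coord_x0_markov Ha Hb) mulr0.
have Ab : A b by apply: gen_alg_sub Hb => _ [s _ ->]; apply: gen_alg_in; exists s.
rewrite -twisted_traceC // mulrA; apply: twisted_trace_markov.
exact: gen_algM.
Qed.

(** The coefficient of e_y in f e_x is that of e_x in transp h (f e_x), where
    h e_x = e_y. So f e_x = 0, and e_x generates the space under the quantum
    group, which commutes with f. *)
Lemma twisted_trace_nondeg f :
  A f -> (forall g, A g -> twisted_trace (f * g) = 0) -> f = 0.
Proof.
move=> Af f0.
have fx0 : (f : 'End(_)) (tbasis C x0) = 0.
  apply/ffunP => y; rewrite ffunE -[LHS]/(coord x0 y f).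
  apply/eqP; apply: contraT => fy; have x0y := hecke_same_weight Af fy.
  have [z [h [zs yz Ah hz]]] := hecke_sorted q y.
  have x0s : descending x0 by apply/forallP => r; apply: ltnW.
  have {}hz : (h : 'End(_)) (tbasis C x0) = tbasis C y.
    by rewrite (descending_unique x0s zs) //; apply: same_codes_trans x0y yz.
  have Ah' : A (transp h).
    by apply: gen_alg_transp Ah => _ [r ->]; exists r; apply: transp_hecke.
  have := f0 _ Ah'; rewrite twisted_traceC // twisted_trace_coord; last exact: gen_algM.
  move/eqP; rewrite mulf_eq0 (negPf (trace_weight_total q0 q_order)) /= coordM.
  rewrite (bigD1 y) //= big1 ?addr0 => [|u uy].
    by rewrite coord_transp /coord hz ffunE eqxx mulr1 -[X in X == 0]/(coord x0 y f) (negPf fy).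
  by rewrite coord_transp /coord hz ffunE eq_sym (negPf uy) mulr0.
apply: endoP => y; rewrite zero_lfunE.
have [u Uu <-] := distinct_generated qhE q0 q_order x0_dec (tbasis C y).
by rewrite -endoM -(uq_hecke_comm qhE q0 Uu Af) endoM fx0 linear0.
Qed.

(** The twist is a diagonal operator that commutes with f, so its product with f
    is again nilpotent. *)
Lemma twisted_trace_nil f m : A f -> f ^+ m = 0 -> twisted_trace f = 0.
Proof.
move=> Af fm; pose N := #|{: tidx p p}|.
pose mx g : 'M[C]_N := \matrix_(i, j) coord (enum_val j) (enum_val i) g.
have mxM g h : mx (g * h) = mx g *m mx h.
  apply/matrixP => i j; rewrite !mxE coordM.
  rewrite (reindex (enum_val : 'I_N -> _)) /=; last exact/onW_bij/enum_val_bij.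
  by apply: eq_bigr => k _; rewrite !mxE mulrC.
have mx1 : mx 1 = 1%:M.
  by apply/matrixP => i j; rewrite !mxE coord1 (inj_eq enum_val_inj) eq_sym.
have mxX g k : mx (g ^+ k) = mx g ^+ k.
  by elim: k => [|k IH]; [exact: mx1 | rewrite !exprS mxM IH].
pose D : E := diag_op c.
have DfC : D * f = f * D.
  by apply: gen_alg_comm Af => _ [r ->]; apply: diag_hecke => z; apply: trace_weight_swap.
have tE : twisted_trace f = \tr (mx (D * f)).
  rewrite /twisted_trace (reindex (enum_val : 'I_N -> _)) /=; last exact/onW_bij/enum_val_bij.
  by apply: eq_bigr => i _; rewrite mxE [RHS]/coord endoM app_diag.
rewrite tE; apply: (@trace_nilpotent _ _ _ m).
have -> : mx (D * f) ^+ m = mx (D ^+ m * f ^+ m).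
  rewrite -mxX; congr mx; elim: m {fm} => [|m IH]; first by rewrite !expr0 mulr1.
  rewrite !exprS IH !mulrA; congr (_ * _); rewrite -!mulrA; congr (_ * _).
  by elim: m {IH} => [|k IH]; rewrite ?expr0 ?mulr1 ?mul1r // exprS -!mulrA -IH !mulrA DfC.
by rewrite fm mulr0; apply/matrixP => i j; rewrite !mxE coord0.
Qed.

Lemma hecke_separable : separable A.
Proof.
have AL k f g : A f -> A g -> A (k *: f + g).
  by move=> Af Ag; apply: gen_algD => //; apply: gen_algZ.
have [U UA] := vspace_of_pred (gen_alg0 hecke_ops) AL.
have [] := @symmetric_separable C V U twisted_trace.
- exact/UA/gen_alg1.
- by move=> f g /UA Af /UA Ag; apply/UA/gen_algM.
- by move=> f g /UA Af _; apply: twisted_traceC.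
- move=> f /UA Af f0; apply: twisted_trace_nondeg => // g /UA; exact: f0.
- by move=> f m /UA Af; apply: twisted_trace_nil.
move=> d [a [b [Ua Ub ab1 cas]]]; exists d, a, b; split=> // [i|i|h /UA].
- exact/UA/Ua.
- exact/UA/Ub.
- exact: cas.
Qed.

End TraceForm.

(** * Restriction to fewer letters *)

Section Restriction.
Variables (C : numClosedFieldType) (q : C) (n p : nat) (np : (n <= p)%N).
Implicit Types (x y : tidx n p) (f g : endo (tspace C p p)).

Let iota x : tidx p p := [ffun s => widen_ord np (x s)].

Let iota_inj : injective iota.
Proof.
move=> x y /ffunP xy; apply/ffunP => s; apply: val_inj.
by have := congr1 val (xy s); rewrite !ffunE.
Qed.

Definition restrict f : endo (tspace C n p) :=
  lin_ext (fun x => [ffun y => coord (iota x) (iota y) f]).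

Let coord_restrict f x y : coord x y (restrict f) = coord (iota x) (iota y) f.
Proof. by rewrite /coord lin_ext_basis ffunE. Qed.

Fact restrict_linear : linear restrict.
Proof.
by move=> c f g; apply: coordP => x y; rewrite !(coord_restrict, coordE).
Qed.
HB.instance Definition _ := GRing.isLinear.Build C
  (endo (tspace C p p)) (endo (tspace C n p)) *:%R restrict restrict_linear.

Let restrict1 : restrict 1 = 1.
Proof.
by apply: coordP => x y; rewrite coord_restrict !coord1 (inj_eq iota_inj).
Qed.

Let restrict_hecke r : restrict (hecke_op q p r) = hecke_op q n r.
Proof.
apply: coordP => x y; rewrite coord_restrict !coord_hecke.
have swE : swap r (iota x) = iota (swap r x) by apply/ffunP => s; rewrite !ffunE.
by rewrite swE !(inj_eq iota_inj) !ffunE /= -!val_eqE.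
Qed.

(* stability of the tensors in the first n letters *)
Let stable f := forall x (y' : tidx p p), (forall y, y' != iota y) -> coord (iota x) y' f = 0.

Let hecke_stable f : gen_alg (@hecke_ops C q p p) f -> stable f.
Proof.
elim=> {f} [|_ [r ->]|f g _ sf _ sg|c f _ sf|f g _ sf _ sg] x y' out.
- by rewrite coord1 eq_sym (negPf (out x)).
- have swE : swap r (iota x) = iota (swap r x) by apply/ffunP => s; rewrite !ffunE.
  rewrite coord_hecke swE ![iota _ == _]eq_sym !(negPf (out _)) !mulr0 addr0.
  by case: ifP => _ //; case: ifP.
- by rewrite coordD sf ?sg ?addr0.
- by rewrite coordZ sf ?mulr0.
rewrite coordM big1 // => z _; have [[y ->]|/forallNP nz] := pselect (exists y, z = iota y).
  by rewrite (sf y) ?mulr0.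
by rewrite (sg x z) ?mul0r // => y; apply/eqP/nz.
Qed.

Let restrictM f g : stable g -> restrict (f * g) = restrict f * restrict g.
Proof.
move=> sg; apply: coordP => x y; rewrite coord_restrict !coordM.
rewrite (bigID (mem (iota @: predT))) /= [X in _ + X]big1 ?addr0 => [|z zout].
  rewrite (big_imset _ (in2W iota_inj)) /=.
  by apply: eq_bigr => u _; rewrite !coord_restrict.
by rewrite (sg x z) ?mul0r // => u; apply: contraNneq zout => ->; apply: imset_f.
Qed.

(** The tensors in the first n of the p letters form a summand of the module, so
    restriction is a surjective homomorphism. *)
Lemma hecke_separable_restrict :
  separable (gen_alg (@hecke_ops C q p p)) -> separable (gen_alg (@hecke_ops C q n p)).
Proof.
apply: (@separable_quotient _ _ _ _ _ restrict).
- exact: restrict1.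
- by move=> f g _ Ag; apply/restrictM/hecke_stable.
- apply: (@gen_alg_word _ _ _ (fun f => gen_alg _ (restrict f)))
    => [|f g Af Ag|c f Af|f _ Af [r ->]].
  + by rewrite restrict1; apply: gen_alg1.
  + by rewrite linearD; apply: gen_algD.
  + by rewrite linearZ; apply: gen_algZ.
  rewrite restrictM; last by apply/hecke_stable/gen_alg_in; exists r.
  by rewrite restrict_hecke; apply: gen_algM => //; apply: gen_alg_in; exists r.
- move=> g; elim=> {g} [|_ [r ->]|f g _ [f' Af <-] _ [g' Ag <-]
    |c f _ [f' Af <-]|f g _ [f' Af <-] _ [g' Ag <-]].
  + by exists 1; [apply: gen_alg1 | apply: restrict1].
  + by exists (hecke_op q p r); [apply: gen_alg_in; exists r | apply: restrict_hecke].
  + by exists (f' + g'); [apply: gen_algD | rewrite linearD].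
  + by exists (c *: f'); [apply: gen_algZ | rewrite linearZ].
  + by exists (f' * g'); [apply: gen_algM | apply/restrictM/hecke_stable].
Qed.

End Restriction.

(** * Mutual commutants *)

Local Open Scope classical_set_scope.

(** [k] = 0 iff q^(2k) = 1. *)
Lemma qfact_order (K : fieldType) (q : K) p : q != 0 -> qfact q p != 0 ->
  forall k, (0 < k <= p)%N -> (q ^+ 2) ^+ k != 1.
Proof.
move=> q0 qp k /andP[k0 kp]; move: qp; apply: contra_neq => qk.
rewrite /qfact (bigD1_seq k) ?iota_uniq //=; last by rewrite mem_index_iota k0 ltnS.
have qkk : q ^+ k * q ^+ k = 1 by rewrite -exprD addnn -mul2n exprM.
have -> : qint q k = 0; last by rewrite mul0r.
rewrite /qint; have -> : q ^- k = q ^+ k by rewrite -[LHS]mul1r -qkk mulfK // expf_neq0.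
by rewrite subrr mul0r.
Qed.

Section DoubleCommutant.
Variables (C : numClosedFieldType) (q qh : C) (n p : nat).
Hypotheses (qhE : qh ^+ 2 = q) (q0 : q != 0).
Hypothesis q_order : forall k, (0 < k <= p)%N -> (q ^+ 2) ^+ k != 1.

(** For n < p, the commutant of the Hecke algebra lies in the quantum group, so f
    is in the bicommutant of a separable algebra. *)
Lemma uq_commutant (f : endo (tspace C n p)) :
  (forall u, gen_alg (@uq_ops C qh n p) u -> f * u = u * f) ->
  gen_alg (@hecke_ops C q n p) f.
Proof.
move=> fU; have [pn|/ltnW np] := leqP p n.
  pose x : tidx n p := [ffun s => widen_ord pn (rev_ord s)].
  apply: (uq_commutant_distinct qhE q0 q_order (x := x)) => // r.
  by rewrite !ffunE /=; have := ltn_ord r; lia.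
apply: separable_bicommutant.
- exact: gen_alg1.
- by move=> c g h Ag Ah; apply: gen_algD => //; apply: gen_algZ.
- exact: gen_algM.
- by apply: (hecke_separable_restrict np); apply: hecke_separable qhE q0 q_order.
move=> g gA; apply: fU; apply: (hecke_commutant qhE q0 q_order) => r.
by apply: gA; apply: gen_alg_in; exists r.
Qed.

End DoubleCommutant.

Theorem theorem6p1 (R : realType) (q qh : R[i]) (n p : nat)
    (q_neq0 : q != 0) (q2_neq1 : q ^+ 2 != 1) (qhE : qh ^+ 2 = q)
    (n_gt0 : (0 < n)%N) (qfact_neq0 : qfact q p != 0) :
  commutant (range (hecke_rep n p q_neq0)) =
    range (uq_rep n p qhE q_neq0 q2_neq1) /\
  commutant (range (uq_rep n p qhE q_neq0 q2_neq1)) =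
    range (hecke_rep n p q_neq0).
Proof.
have q_order := qfact_order q_neq0 qfact_neq0.
have -> : range (hecke_rep n p q_neq0) = [set f | gen_alg (@hecke_ops R[i] q n p) f].
  exact: range_lift.
have -> : range (uq_rep n p qhE q_neq0 q2_neq1) = [set f | gen_alg (@uq_ops R[i] qh n p) f].
  exact: range_lift.
split; rewrite eqEsubset; split=> f /= fA.
- apply: (hecke_commutant qhE q_neq0 q_order) => r.
  by apply: fA; apply: gen_alg_in; exists r.
- by move=> h Hh; apply: (uq_hecke_comm qhE q_neq0 fA Hh).
- exact: (uq_commutant qhE q_neq0 q_order fA).
- by move=> u Uu; apply/esym; apply: (uq_hecke_comm qhE q_neq0 Uu fA).
Qed.
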